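(* Let $k\in(1,+\infty]$, let $E$ be a complex Banach space such that $E'$ is separable, and let $(\mathcal{P}_\Theta({}^{m}E))_{m=0}^\infty$ be a holomorphy type from $E$ to $\mathbb C$ that is both a $\pi_1$-holomorphy type and a $\pi_{2,k}$-holomorphy type. Let $T\in[Exp_{\Theta,0}^k(E)]'$ be a continuous linear functional which is not a scalar multiple of $\delta_0$, where $\delta_0(f)=f(0)$. Then the map $\Gamma_{\Theta,0}^k(T): f\mapsto T*f$ is a convolution operator on $Exp_{\Theta,0}^k(E)$ that is not a scalar multiple of the identity; hence it is mixing.
   Context: $E$ is a complex Banach space, $E'$ its topological dual, $\mathbb{N}_0=\mathbb{N}\cup\{0\}$. $\mathcal{P}({}^jE)$ is the Banach space of continuous $j$-homogeneous polynomials $E\to\mathbb{C}$ with the sup norm on the unit ball; $\check P$ is the symmetric $j$-linear form associated to $P\in\mathcal P({}^jE)$; $\mathcal{P}_f({}^jE)$ is the span of $\{\phi^j:\phi\in E'\}$; $\mathcal H(E)$ is the space of entire functions on $E$. If $f(x)=\sum_m P_m(x-a)$ is the Taylor expansion of $f$ at $a$, then $\hat d^m f(a)=m!P_m$. A holomorphy type $\Theta$ from $E$ to $\mathbb C$ is a sequence of Banach spaces $(\mathcal P_\Theta({}^jE))_{j=0}^\infty$, with norms denoted $\|\cdot\|_\Theta$, such that: (1) each $\mathcal P_\Theta({}^jE)$ is a vector subspace of $\mathcal P({}^jE)$, and $\mathcal P_\Theta({}^0E)=\mathbb C$ as a normed space; (2) there is $\sigma\ge 1$ such that for all $k\le j$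 in $\mathbb N_0$, $a\in E$ and $P\in\mathcal P_\Theta({}^jE)$, one has $\hat d^kP(a)\in\mathcal P_\Theta({}^kE)$ and $\|\frac1{k!}\hat d^kP(a)\|_\Theta\le\sigma^j\|P\|_\Theta\|a\|^{j-k}$. $\Theta$ is a $\pi_1$-holomorphy type if: (i) $\mathcal P_f({}^jE)\subset\mathcal P_\Theta({}^jE)$ and there is $K>0$ such that $\|b\,\phi^j\|_\Theta\le K^j\|\phi\|^j|b|$ for all $\phi\in E'$, $b\in\mathbb C$, $j\in\mathbb N_0$; (ii) $\mathcal P_f({}^jE)$ is dense in $(\mathcal P_\Theta({}^jE),\|\cdot\|_\Theta)$ for every $j$. For $k\in[1,+\infty)$, $Exp_{\Theta,0}^k(E)$ is the space of all $f\in\mathcal H(E)$ with $\hat d^jf(0)\in\mathcal P_\Theta({}^jE)$ for all $j\in\mathbb N_0$ and $\|f\|_{\Theta,k,\rho}=\sum_{j=0}^\infty\rho^{-j}\left(\frac{j}{ke}\right)^{j/k}\left\|\frac1{j!}\hat d^jf(0)\right\|_\Theta<\infty$ for all $\rho>0$ (the weight being $1$ for $j=0$), with the topology given by the norms $\|\cdot\|_{\Theta,k,\rho}$, $\rho>0$. For $k=+\infty$, $Exp_{\Theta,0}^\infty(E)$ is the space of all $f\in\mathcal H(E)$ with $\hat d^jf(0)\in\mathcal P_\Theta({}^jE)$ for all $j$ and $\lim_{j\to\infty}\|\frac1{j!}\hat d^jf(0)\|_\Theta^{1/j}=0$, with the topology given by the norms $p^\infty_{\Theta,\rho}(f)=\sum_j\rho^{-j}\|\frac1{j!}\hat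 d^jf(0)\|_\Theta$, $\rho>0$. These are Fréchet spaces. $\Theta$ is a $\pi_{2,k}$-holomorphy type if for each $T\in[Exp_{\Theta,0}^k(E)]'$: (1) for all $m\le j$ in $\mathbb N_0$ and $P\in\mathcal P_\Theta({}^jE)$ with associated symmetric $j$-linear form $B=\check P$, the polynomial $T(\widehat{B\cdot^m}):E\to\mathbb C$, $y\mapsto T\big(x\mapsto B(x,\dots,x,y,\dots,y)\big)$ ($x$ taken $m$ times, $y$ taken $j-m$ times), belongs to $\mathcal P_\Theta({}^{j-m}E)$; (2) whenever $C>0$ and $\rho>0$ satisfy $|T(f)|\le C\|f\|_{\Theta,k,\rho}$ (if $k<\infty$), respectively $|T(f)|\le Cp^\infty_{\Theta,\rho}(f)$ (if $k=\infty$), for all $f\in Exp_{\Theta,0}^k(E)$, there is $M>0$ such that for all $m\le j$ in $\mathbb{N}_0$ and $P\in\mathcal P_\Theta({}^jE)$, with $B=\check P$, one has $\|T(\widehat{B\cdot^m})\|_\Theta\le CM^j\rho^{-m}\left(\frac{m}{ke}\right)^{m/k}\|P\|_\Theta$ if $k<\infty$, respectively $\|T(\widehat{B\cdot^m})\|_\Theta\le CM^j\rho^{-m}\|P\|_\Theta$ if $k=\infty$. For $T\in[Exp_{\Theta,0}^k(E)]'$ and $f\in Exp_{\Theta,0}^k(E)$, $(T*f)(x)=T(\tau_{-x}f)$, where $(\tau_{-x}f)(y)=f(y+x)$ (and $\tau_{-x}f\in Exp_{\Theta,0}^k(E)$). A convolution operator on $Exp_{\Theta,0}^k(E)$ is a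 continuous linear map $L$ of $Exp_{\Theta,0}^k(E)$ into itself such that $d(Lf)(\cdot)a=L(df(\cdot)a)$ for all $a\in E$ and $f$, where $df(\cdot)a$ is the function $x\mapsto\hat d^1f(x)(a)$. A continuous linear operator $S:X\to X$ is mixing if for any non-empty open sets $U,V\subset X$ there is $n_0\in\mathbb N$ with $S^n(U)\cap V\ne\emptyset$ for all $n\ge n_0$. *)

(* Defs.v *)
From HB Require Import structures.
From mathcomp Require Import all_boot all_order all_algebra.
From mathcomp Require Import all_fingroup complex.
From mathcomp Require Import all_classical all_reals all_analysis.
From mathcomp Require Import ring lra.

Set Implicit Arguments.
Unset Strict Implicit.
Unset Printing Implicit Defensive.

Import Order.TTheory GRing.Theory Num.Theory numFieldNormedType.Exports.

Local Open Scope classical_set_scope.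
Local Open Scope ring_scope.

(* The complex field as a normed space over itself. *)
Notation Cn R := (R[i])^o.

(* Norms of normed modules over R[i] take their (nonnegative) values in R[i]. *)
Definition rnorm (R : realType) (V : normedModType R[i]) (x : V) : R :=
  complex.Re `|x|.

Section polynomials.
Context (R : realType) (E : normedModType R[i]).

Definition multilinear_form j (A : ('I_j -> E) -> Cn R) : Prop :=
  forall (i : 'I_j) (v : 'I_j -> E),
    linear ((fun x => A (@dfwith _ (fun=> E) v i x)) : E -> Cn R).

Definition symmetric_form j (A : ('I_j -> E) -> Cn R) : Prop :=
  forall (s : 'S_j) (v : 'I_j -> E), A (v \o s) = A v.

Definition hpoly j : set (E -> Cn R) :=
  [set P | (exists2 A, @multilinear_form j A & forall x, P x = A (fun=> x)) /\
           continuous P].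

(* \check P; the symmetric form is unique by the polarization formula. *)
Definition polar j (P : E -> Cn R) : ('I_j -> E) -> Cn R :=
  get [set B | [/\ @multilinear_form j B, symmetric_form B &
                   forall x, P x = B (fun=> x)]].

Definition is_taylor (f : E -> Cn R) (a : E) (P : nat -> E -> Cn R) : Prop :=
  (forall m, hpoly m (P m)) /\
  exists2 r : R, 0 < r &
    {uniform ball a r%:C%C,
      (fun (n : nat) (x : E) => \sum_(m < n) P m (x - a)) @ \oo --> f}.

Definition entire (f : E -> Cn R) : Prop := forall a, exists P, is_taylor f a P.

(* get picks the Taylor expansion of f at a, unique by is_taylor_uniq. *)
Definition dhat (m : nat) (f : E -> Cn R) (a : E) : E -> Cn R :=
  fun x => m`!%:R * get (is_taylor f a) m x.

Definition dual : set (E -> Cn R) := [set phi : E -> Cn R | linear phi /\ continuous phi].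

Definition dual_norm (phi : E -> Cn R) : R :=
  sup [set rnorm (phi x) | x in [set x | rnorm x <= 1]].

Definition dual_separable : Prop :=
  exists D : set (E -> Cn R), [/\ countable D, D `<=` dual &
    forall phi (e : R), dual phi -> 0 < e ->
      exists2 psi, D psi & dual_norm (phi - psi) < e].

Definition fin_hpoly j : set (E -> Cn R) :=
  [set P | exists (n : nat) (c : 'I_n -> R[i]) (phi : 'I_n -> E -> Cn R),
     (forall i, dual (phi i)) /\
     P = (fun x => \sum_(i < n) c i * phi i x ^+ j)].

End polynomials.
Arguments polar {R E} j P.

(* ht_space j, embedded in the j-homogeneous polynomials by ht_val j, is the
   Banach space P_Theta(^j E). *)
Record holomorphy_type (R : realType) (E : normedModType R[i]) := HolomorphyType {
  ht_space : nat -> completeNormedModType R[i] ;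
  ht_val : forall j, {linear ht_space j -> (E -> Cn R)} ;
  ht_val_inj : forall j, injective (ht_val j) ;
  ht_val_hpoly : forall j p, hpoly j (ht_val j p) ;
  ht_space0 : forall c : R[i],
    exists2 p : ht_space 0, ht_val 0 p = (fun=> c) & `|p| = `|c| ;
  ht_sigma : exists2 s : R, 1 <= s &
    forall k j (a : E) (p : ht_space j), (k <= j)%N ->
      exists2 q : ht_space k, ht_val k q = dhat k (ht_val j p) a &
        rnorm ((k`!%:R)^-1 *: q) <= s ^+ j * rnorm p * rnorm a ^+ (j - k)
}.

Section exp_spaces.
Context (R : realType) (E : normedModType R[i]) (Th : holomorphy_type E).

Definition ht_poly j : set (E -> Cn R) := range (ht_val Th j).

Definition ht_norm j (P : E -> Cn R) : R :=
  rnorm (xget 0 [set p | ht_val Th j p = P]).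

(* (j / (k e)) ^ (j / k); the value at j = 0 is 1, because 0 `^ 0 = 1. *)
Definition exp_weight (k : \bar R) (j : nat) : R :=
  if k is r%:E then (j%:R / (r * expR 1)) `^ (j%:R / r) else 1.

Definition exp_coef (f : E -> Cn R) (j : nat) : R :=
  ht_norm j ((j`!%:R)^-1 *: dhat j f 0).

(* For k = +oo the weight is 1 and this is the norm p^oo_(Theta, rho). *)
Definition exp_norm (k : \bar R) (rho : R) (f : E -> Cn R) : \bar R :=
  (\sum_(0 <= j <oo) (rho ^- j * exp_weight k j * exp_coef f j)%:E)%E.

Definition Exp (k : \bar R) : set (E -> Cn R) :=
  [set f | [/\ entire f, forall j, ht_poly j (dhat j f 0) &
     if k == +oo%E then (exp_coef f j `^ j%:R^-1) @[j --> \oo] --> (0 : R)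
     else forall rho : R, 0 < rho -> (exp_norm k rho f < +oo)%E]].

Definition pi1_type : Prop :=
  [/\ forall j, @fin_hpoly _ E j `<=` ht_poly j,
      exists2 K : R, 0 < K & forall (phi : E -> Cn R) (b : Cn R) j, dual phi ->
        ht_norm j (fun x => b * phi x ^+ j)
          <= K ^+ j * dual_norm phi ^+ j * rnorm b &
      forall j, dense [set p : ht_space Th j | fin_hpoly j (ht_val Th j p)]].

End exp_spaces.

Section rnorm_lemmas.
Context (R : realType) (V : normedModType R[i]).
Implicit Types x y : V.

Lemma rnormE x : (rnorm x)%:C%C = `|x|.
Proof. by rewrite /rnorm RRe_real// normr_real. Qed.

Lemma rnorm_ge0 x : 0 <= rnorm x.
Proof. by rewrite -lecR rnormE normr_ge0. Qed.

Lemma rnorm0 : rnorm (0 : V) = 0.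
Proof. by rewrite /rnorm normr0. Qed.

Lemma rnormD x y : rnorm (x + y) <= rnorm x + rnorm y.
Proof. by rewrite -lecR rmorphD/= !rnormE ler_normD. Qed.

Lemma rnormN x : rnorm (- x) = rnorm x.
Proof. by rewrite /rnorm normrN. Qed.

Lemma rnormZ (c : Cn R) x : rnorm (c *: x) = rnorm c * rnorm x.
Proof.
by apply: (@complexI R); rewrite rmorphM/= !rnormE normrZ.
Qed.

Lemma rnorm0_eq0 x : rnorm x = 0 -> x = 0.
Proof. by move=> x0; apply/eqP; rewrite -normr_eq0 -rnormE x0. Qed.

End rnorm_lemmas.

Lemma rnorm_real (R : realType) (t : R) : rnorm (t%:C%C : Cn R) = `|t|.
Proof.
apply: (@complexI R); rewrite rnormE normc_def /= expr0n/= addr0.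
by rewrite sqrtr_sqr.
Qed.

Section power_series.
Context (R : realType).

Lemma rnorm_sum (n : nat) (F : nat -> Cn R) (m : nat) :
  rnorm (\sum_(m <= i < n) F i) <= \sum_(m <= i < n) rnorm (F i).
Proof.
elim/big_rec2: _ => [|i y x _ h]; first by rewrite rnorm0.
by rewrite (le_trans (rnormD _ _))// lerD2l.
Qed.

Local Definition small (t0 : R) (c : nat -> Cn R) := forall t : R, 0 < t <= t0 ->
  forall e : R, 0 < e -> exists N, forall n, (N <= n)%N ->
    rnorm (\sum_(i < n) c i * (t%:C%C) ^+ i : Cn R) <= e.

Lemma small0 t0 c : 0 < t0 -> small t0 c -> c 0%N = 0.
Proof.
move=> t00 sc; apply: rnorm0_eq0; apply/eqP.
rewrite eq_le rnorm_ge0 andbT.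
have [M M0 cM] : exists2 M : R, 0 < M & forall i, rnorm (c i) * t0 ^+ i <= M.
  have [|N hN] := sc t0 _ 1 ltr01; first by rewrite t00 lexx.
  have hN' n : (N <= n)%N -> rnorm (c n) * t0 ^+ n <= 2.
    move=> Nn; have -> : rnorm (c n) * t0 ^+ n =
        rnorm (c n * (t0%:C%C) ^+ n : Cn R).
      rewrite -[c n * _]/(c n *: (_ : Cn R)) rnormZ -rmorphXn/= rnorm_real.
      by rewrite ger0_norm// exprn_ge0// ltW.
    have -> : c n * (t0%:C%C) ^+ n = \sum_(i < n.+1) c i * (t0%:C%C) ^+ i
        - \sum_(i < n) c i * (t0%:C%C) ^+ i :> Cn R.
      by rewrite big_ord_recr/= [_ + c n * _]addrC addrK.
    rewrite (le_trans (rnormD _ _))// rnormN -[leRHS]/(1 + 1 : R).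
    by rewrite lerD// hN// ltnW.
  exists (2 + \sum_(i < N) rnorm (c i) * t0 ^+ i).
    rewrite ltr_pwDl// sumr_ge0// => i _.
    by rewrite mulr_ge0 ?rnorm_ge0// exprn_ge0// ltW.
  have p0 i : 0 <= rnorm (c i) * t0 ^+ i.
    by rewrite mulr_ge0 ?rnorm_ge0// exprn_ge0// ltW.
  move=> i; have [/hN' h|iN] := leqP N i.
    by rewrite (le_trans h)// lerDl sumr_ge0.
  by rewrite (bigD1 (Ordinal iN))//= addrCA lerDl addr_ge0// sumr_ge0.
apply/ler_addgt0Pl => e e0; rewrite addr0.
pose t := Num.min (t0 / 2) (t0 * (e / 2) / (M *+ 2)).
have t_gt0 : 0 < t.
  rewrite lt_min divr_gt0//= divr_gt0// ?mulr_gt0// ?divr_gt0//.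
  by rewrite pmulrn_lgt0.
have tt0 : t <= t0 by rewrite ge_min ler_pdivrMr// ler_pMr// ler1n.
have [||N hN] := sc t _ (e / 2); rewrite ?t_gt0 ?divr_gt0//.
have {hN} := hN N.+1 (leqnSn _).
rewrite big_ord_recl expr0 mulr1.
set S := \sum_(i < N) _ => hS.
have -> : c 0%N = (c 0%N + S) - S by rewrite addrK.
rewrite (le_trans (rnormD _ _))// rnormN [e]splitr lerD//.
pose q := t / t0.
have q0 : 0 <= q by rewrite divr_ge0// ltW.
have q12 : q <= 1 / 2.
  by rewrite ler_pdivrMr// ge_min mul1r mulrC lexx.
have q1 : q < 1 by rewrite (le_lt_trans q12)// ltr_pdivrMr// mul1r ltr1n.
have : rnorm S <= \sum_(i < N) M * q ^+ i.+1.
  rewrite /S -(big_mkord xpredT (fun i => c (bump 0 i) * (t%:C%C) ^+ (bump 0 i))).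
  rewrite (le_trans (rnorm_sum _ _ _))// big_mkord ler_sum// => i _.
  rewrite -[_ * _ in leLHS]/(c _ *: (_ : Cn R)) rnormZ -rmorphXn/= rnorm_real.
  rewrite /bump leq0n add1n ger0_norm; last by rewrite exprn_ge0// ltW.
  rewrite expr_div_n mulrA ler_pdivlMr ?exprn_gt0//.
  by rewrite mulrAC ler_wpM2r// exprn_ge0// ltW.
move/le_trans; apply.
rewrite -mulr_sumr; under eq_bigr do rewrite exprS.
rewrite -mulr_sumr.
have : \sum_(i < N) q ^+ i <= 2.
  rewrite -(ler_pM2l (_ : 0 < 1 - q)) ?subr_gt0//.
  rewrite -opprB mulNr -subrX1 opprB.
  have : 0 <= q ^+ N by rewrite exprn_ge0.
  lra.
set G := \sum_(i < N) q ^+ i => G2.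
rewrite (@le_trans _ _ (M * (q * 2)))//; first by rewrite !ler_wpM2l// ltW.
have : q * M <= e / 4.
  have : t <= t0 * (e / 2) / (M *+ 2) by rewrite ge_min lexx orbT.
  rewrite ler_pdivlMr ?pmulrn_lgt0// /q mulrAC ler_pdivrMr//; lra.
lra.
Qed.

Lemma power_series_eq0 t0 c : 0 < t0 -> small t0 c -> forall i, c i = 0.
Proof.
move=> t00 sc i; elim: i c sc => [|i ih] c sc; first exact: small0 sc.
have c0 := small0 t00 sc.
apply: (ih (fun i => c i.+1)) => t /andP[t_gt0 tt0] e e0.
have [||N hN] := sc t _ (e * t); rewrite ?t_gt0 ?mulr_gt0//.
exists N => n Nn; have := hN n.+1 (leqW Nn).
rewrite big_ord_recl c0 mul0r add0r.
under eq_bigr do rewrite lift0 exprS mulrCA.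
rewrite -mulr_sumr -[_ * _]/((t%:C%C : Cn R) *: (_ : Cn R)) rnormZ rnorm_real.
by rewrite gtr0_norm// mulrC ler_pM2r.
Qed.

End power_series.

Section polynomial_lemmas.
Context (R : realType) (E : normedModType R[i]).

Lemma hpolyZ j (P : E -> Cn R) : hpoly j P ->
  forall (a : R[i]) x, P (a *: x) = a ^+ j * P x.
Proof.
case=> -[A mA PA] _ a x; rewrite !PA.
have h n : (n <= j)%N ->
    A (fun i : 'I_j => if (i < n)%N then a *: x else x) = a ^+ n * A (fun=> x).
  elim: n => [|n ih] nj; first by rewrite expr0 mul1r.
  rewrite exprS -mulrA -ih 1?ltnW//.
  set v := fun i : 'I_j => if (i < n)%N then a *: x else x.
  have /(_ a x 0) := mA (Ordinal nj) v.
  have d0 : A (@dfwith _ (fun=> E) v (Ordinal nj) 0) = 0.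
    have := mA (Ordinal nj) v (-1) 0 0.
    by rewrite scaler0 addr0 scaleN1r addNr.
  rewrite addr0 d0 addr0.
  have -> : @dfwith _ (fun=> E) v (Ordinal nj) x = v.
    apply/funext => i; case: dfwithP => [|//]; by rewrite /v /= ltnn.
  move=> e; rewrite -[RHS]/(a *: (A v : Cn R)) -e; congr A; apply/funext => i; case: dfwithP => [|i' ne].
    by rewrite /= ltnS leqnn.
  rewrite /v ltnS leq_eqVlt; case: eqP => //= e'.
  by move/negP : ne; rewrite -val_eqE/= e' eqxx.
rewrite -h//; congr A; apply/funext => i; by rewrite ltn_ord.
Qed.

Lemma hpolyD j (a : R[i]) (P Q : E -> Cn R) :
  hpoly j P -> hpoly j Q -> hpoly j (a *: P + Q).
Proof.
move=> [[A mA PA] cP] [[B mB QB] cQ]; split.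
  exists (fun v => a * A v + B v).
    move=> i v b x y /=; rewrite mA mB.
    rewrite -![_ *: _]/(_ * _ : R[i]) -![a * _]/(_ * _ : R[i]); ring.
  by move=> x; rewrite -PA -QB.
move=> x; apply: cvgD; last exact: cQ.
apply: cvgZr; exact: cP.
Qed.

Lemma uniform_cvgP (A : set E) (u : nat -> E -> Cn R) (f : E -> Cn R) :
  {uniform A, u @ \oo --> f} <-> forall e : R, 0 < e ->
    exists N, forall n, (N <= n)%N -> forall x, A x -> rnorm (f x - u n x) < e.
Proof.
split=> [uf e e0|h].
  have /uf : nbhs (f : {uniform` A -> Cn R})
      [set g | forall x, A x -> rnorm (f x - g x) < e].
    apply/uniform_nbhs; exists [set xy | ball xy.1 e%:C%C xy.2]; split.
      by rewrite -entourage_from_ballE; exists e%:C%C => //=; rewrite ltcR.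
    move=> g /= fg x /fg; rewrite -ball_normE/= -rnormE ltcR//.
  by move=> [N _ hN]; exists N => n /hN.
move=> W /uniform_nbhs[V [+ VW]].
rewrite -entourage_from_ballE => -[e /= e0 eV].
have eE : (complex.Re e)%:C%C = e by rewrite RRe_real// gtr0_real.
have [|N hN] := h (complex.Re e); first by rewrite -ltcR eE.
exists N => // n /hN un; apply: VW => x /un xe; apply: eV => /=.
by rewrite -ball_normE/= -rnormE -eE ltcR.
Qed.

Lemma is_taylorD (f g : E -> Cn R) (a : E) (c : R[i]) P Q :
  is_taylor f a P -> is_taylor g a Q ->
  is_taylor (c *: f + g) a (fun m => c *: P m + Q m).
Proof.
move=> [hP [r r0 /uniform_cvgP fP]] [hQ [s s0 /uniform_cvgP gQ]]; split.
  by move=> m; exact: hpolyD.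
exists (Num.min r s); first by rewrite lt_min r0.
apply/uniform_cvgP => e e0.
have c0 : 0 < rnorm (c : Cn R) + 1 by rewrite ltr_wpDl ?rnorm_ge0.
have [|N hN] := fP (e / 2 / (rnorm (c : Cn R) + 1)); first by rewrite !divr_gt0.
have [|M hM] := gQ (e / 2); first by rewrite divr_gt0.
exists (maxn N M) => n; rewrite geq_max => /andP[Nn Mn] x rx.
have -> : (c *: f + g) x - \sum_(m < n) (c *: P m + Q m) (x - a) =
   c *: (f x - \sum_(m < n) P m (x - a)) + (g x - \sum_(m < n) Q m (x - a)).
  rewrite big_split/= scalerBr -scaler_sumr opprD addrACA; congr (_ + _ + _).
rewrite (le_lt_trans (rnormD _ _))// rnormZ [e]splitr ltr_leD//; last first.
  apply: ltW; apply: hM => //; apply: le_ball rx; by rewrite lecR ge_min lexx orbT.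
have /(hN _ Nn)/ltW h : ball a r%:C%C x.
  by apply: le_ball rx; rewrite lecR ge_min lexx.
rewrite (@le_lt_trans _ _
  (rnorm (c : Cn R) * (e / 2 / (rnorm (c : Cn R) + 1))))//.
  by rewrite ler_wpM2l ?rnorm_ge0.
by rewrite mulrCA -[ltRHS]mulr1 ltr_pM2l ?divr_gt0// ltr_pdivrMr// mul1r ltrDl.
Qed.

Lemma is_taylor0 (a : E) : is_taylor 0 a (fun=> 0).
Proof.
split; last first.
  exists 1 => //; apply/uniform_cvgP => e e0; exists 0%N => n _ x _.
  by rewrite big1// subrr rnorm0.
move=> m; split; last exact: cst_continuous.
by exists (fun=> 0) => // i v c x y; rewrite scaler0 addr0.
Qed.

Lemma is_taylor_uniq (f : E -> Cn R) (a : E) P Q :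
  is_taylor f a P -> is_taylor f a Q -> P = Q.
Proof.
move=> fP fQ; have := is_taylorD (-1) fP fQ.
rewrite scaleN1r addNr => -[hD [r r0 /uniform_cvgP DD]].
suff D0 m x : (-1 *: P m + Q m) x = 0.
  apply/funext => m; apply/funext => x; have := D0 m x.
  by rewrite scaleN1r => /eqP; rewrite addrC subr_eq0 => /eqP.
set D := fun m => -1 *: P m + Q m in hD DD *.
rewrite -/(D m x).
have nx0 : 0 < rnorm x + 1 by rewrite ltr_wpDl ?rnorm_ge0.
apply: (@power_series_eq0 _ (r / (rnorm x + 1)) (fun m => D m x)).
  by rewrite divr_gt0.
move=> t /andP[t0 tr] e e0.
have [N hN] := DD e e0; exists N => n Nn.
have {hN} := hN n Nn (a + t%:C%C *: x).
have /[swap]/[apply] : ball a r%:C%C (a + t%:C%C *: x).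
  rewrite -ball_normE/= opprD addrA subrr sub0r normrN -rnormE ltcR.
  rewrite (rnormZ (t%:C%C : Cn R)) rnorm_real gtr0_norm//.
  move: tr; rewrite ler_pdivlMr// mulrDr mulr1; lra.
move=> /ltW; rewrite sub0r rnormN addrAC subrr add0r.
by under eq_bigr => i _ do rewrite (hpolyZ (hD i)) mulrC.
Qed.

Lemma dhatE (f : E -> Cn R) (a : E) P m :
  is_taylor f a P -> dhat m f a = (m`!%:R : R[i]) *: P m.
Proof.
move=> fP; rewrite /dhat; suff -> : get (is_taylor f a) = P by [].
by apply: is_taylor_uniq (fP); apply: getPex; exists P.
Qed.

Lemma dhatD (f g : E -> Cn R) (a : E) (c : R[i]) m : entire f -> entire g ->
  dhat m (c *: f + g) a = c *: dhat m f a + dhat m g a.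
Proof.
move=> /(_ a)[P fP] /(_ a)[Q gQ].
rewrite (dhatE _ fP) (dhatE _ gQ) (dhatE _ (is_taylorD c fP gQ)).
by rewrite scalerDr !scalerA mulrC.
Qed.

Lemma entireD (f g : E -> Cn R) (c : R[i]) :
  entire f -> entire g -> entire (c *: f + g).
Proof.
move=> ef eg a; have [P fP] := ef a; have [Q gQ] := eg a.
by exists (fun m => c *: P m + Q m); exact: is_taylorD.
Qed.

Lemma entire0 : entire (0 : E -> Cn R).
Proof. by move=> a; exists (fun=> 0); exact: is_taylor0. Qed.

Lemma dhat0 (a : E) m : dhat m (0 : E -> Cn R) a = 0.
Proof. by rewrite (dhatE _ (is_taylor0 a)) scaler0. Qed.

End polynomial_lemmas.

Lemma root_cvg0 (R : realType) (a : R) (u v w : nat -> R) : 0 <= a ->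
  (forall j, 0 <= u j) -> (forall j, 0 <= v j) -> (forall j, 0 <= w j) ->
  (forall j, w j <= a * u j + v j) ->
  u j `^ j%:R^-1 @[j --> \oo] --> (0 : R) ->
  v j `^ j%:R^-1 @[j --> \oo] --> (0 : R) ->
  w j `^ j%:R^-1 @[j --> \oo] --> (0 : R).
Proof.
move=> a0 u0 v0 w0 wuv /cvgrPdist_lt uc /cvgrPdist_lt vc.
apply/cvgrPdist_le => e e0.
have e'0 : 0 < e / (a + 1) by rewrite divr_gt0// ltr_wpDl.
near=> j.
have j0 : j%:R != 0 :> R.
  by rewrite pnatr_eq0 -lt0n; near: j; exists 1%N.
rewrite sub0r normrN ger0_norm ?powR_ge0//.
have le_pow (h : R) : `|0 - h `^ j%:R^-1| < e / (a + 1) -> 0 <= h ->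
    h <= (e / (a + 1)) ^+ j.
  rewrite sub0r normrN ger0_norm ?powR_ge0// => hj h0.
  have := ge0_ler_powR (ler0n R j).
  move=> /(_ (h `^ j%:R^-1) (e / (a + 1))); rewrite !nnegrE powR_ge0.
  rewrite (ltW e'0) => /(_ isT isT (ltW hj)).
  by rewrite -powRrM mulVf// powRr1// powR_mulrn// ltW.
have hu : u j <= (e / (a + 1)) ^+ j.
  by apply: le_pow (u0 j); near: j; exact: uc.
have hv : v j <= (e / (a + 1)) ^+ j.
  by apply: le_pow (v0 j); near: j; exact: vc.
have h : w j <= e ^+ j.
  rewrite (le_trans (wuv j))//.
  rewrite (@le_trans _ _ ((a + 1) * (e / (a + 1)) ^+ j))//.
    by rewrite mulrDl mul1r lerD// ler_wpM2l.
  rewrite expr_div_n mulrCA ler_piMr ?exprn_ge0 ?(ltW e0)//.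
  rewrite ler_pdivrMr ?exprn_gt0 ?ltr_wpDl// mul1r.
  have -> : j = j.-1.+1 by rewrite prednK// lt0n -(pnatr_eq0 R).
  by rewrite exprS ler_peMr ?addr_ge0// exprn_ege1// lerDr.
rewrite (@le_trans _ _ ((e ^+ j) `^ j%:R^-1))//.
  by rewrite ge0_ler_powR ?nnegrE ?exprn_ge0 ?invr_ge0// ltW.
by rewrite -powR_mulrn ?(ltW e0)// -powRrM mulfV// powRr1// ltW.
Unshelve. all: by end_near. Qed.

Section exp_lemmas.
Context (R : realType) (E : normedModType R[i]) (Th : holomorphy_type E).

Lemma ht_normE j (p : ht_space Th j) : ht_norm Th j (ht_val Th j p) = rnorm p.
Proof.
rewrite /ht_norm; congr rnorm; apply: (@ht_val_inj _ _ Th).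
by case: xgetP => [q -> ->//|/(_ p)]; last by case.
Qed.

Lemma exp_coef_ge0 f j : 0 <= exp_coef Th f j.
Proof. exact: rnorm_ge0. Qed.

Lemma exp_coef0 j : exp_coef Th 0 j = 0.
Proof.
by rewrite /exp_coef dhat0 scaler0 -(linear0 (ht_val Th j)) ht_normE rnorm0.
Qed.

Lemma exp_coefD f g (c : R[i]) j : entire f -> entire g ->
  ht_poly Th j (dhat j f 0) -> ht_poly Th j (dhat j g 0) ->
  exp_coef Th (c *: f + g) j
    <= rnorm (c : Cn R) * exp_coef Th f j + exp_coef Th g j.
Proof.
move=> ef eg [p _ fp] [q _ gq].
rewrite /exp_coef dhatD// -fp -gq -(linearP (ht_val Th j)) -!(linearZ_LR (ht_val Th j)) !ht_normE.
rewrite scalerDr (le_trans (rnormD _ _))// lerD2r.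
by rewrite scalerA mulrC -scalerA rnormZ.
Qed.

Lemma exp_weight_ge0 (k : \bar R) j : 0 <= exp_weight k j.
Proof. by case: k => //= r; exact: powR_ge0. Qed.

Let term_ge0 k (rho : R) f j : 0 < rho ->
  (0 <= (rho ^- j * exp_weight k j * exp_coef Th f j)%:E)%E.
Proof.
move=> r0; rewrite lee_fin !mulr_ge0 ?exp_weight_ge0 ?exp_coef_ge0//.
by rewrite invr_ge0 exprn_ge0// ltW.
Qed.

Lemma Exp0 k : Exp Th k 0.
Proof.
split; first exact: entire0.
  by move=> j; exists 0 => //; rewrite linear0 dhat0.
case: ifPn => [_|_ rho r0].
  apply: cvg_near_cst; exists 1%N => // j /= j0.
  rewrite exp_coef0 powR0// invr_neq0// pnatr_eq0; by case: j j0.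
rewrite /exp_norm eseries0// => j _ _.
by rewrite exp_coef0 mulr0.
Qed.

Lemma ExpD k f g (c : R[i]) : Exp Th k f -> Exp Th k g -> Exp Th k (c *: f + g).
Proof.
move=> [ef pf nf] [eg pg ng]; split; first exact: entireD.
  move=> j; rewrite dhatD//; have [p _ <-] := pf j; have [q _ <-] := pg j.
  by rewrite -linearP; exists (c *: p + q).
have cfg j := exp_coefD c ef eg (pf j) (pg j).
have [koo|koo] := boolP (k == +oo%E); rewrite ?koo ?(negbTE koo) in nf ng *.
  apply: (root_cvg0 (rnorm_ge0 _) _ _ _ cfg nf ng) => j; exact: exp_coef_ge0.
move=> rho r0.
rewrite (@le_lt_trans _ _
  ((rnorm (c : Cn R))%:E * exp_norm Th k rho f + exp_norm Th k rho g)%E)//.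
  rewrite /exp_norm -nneseriesZl//; last by move=> j _; exact: term_ge0.
  rewrite -nneseriesD//; last 2 first.
    by move=> j _ _; rewrite mule_ge0 ?lee_fin ?rnorm_ge0//; exact: term_ge0.
    by move=> j _ _; exact: term_ge0.
  apply: lee_nneseries => [j _ _|j _]; first exact: term_ge0.
  rewrite -EFinM -EFinD lee_fin mulrCA -mulrDr ler_wpM2l//.
  by rewrite mulr_ge0 ?exp_weight_ge0// invr_ge0 exprn_ge0// ltW.
rewrite lte_add_pinfty//; last exact: ng.
by rewrite lte_mul_pinfty ?lee_fin ?rnorm_ge0//; exact: nf.
Qed.

End exp_lemmas.

Section exp_space_type.
Context (R : realType) (E : normedModType R[i]) (Th : holomorphy_type E)
  (k : \bar R).

Record exp_space : Type := ExpSpace {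
  exp_fun :> E -> Cn R ;
  exp_funP : exp_fun \in Exp Th k }.

HB.instance Definition _ := [isSub for exp_fun].
HB.instance Definition _ := [Choice of exp_space by <:].

Lemma Exp_submod_closed : submod_closed (mem (Exp Th k)).
Proof.
split; first by apply/mem_set; exact: Exp0.
by move=> c f g /set_mem Ef /set_mem Eg; apply/mem_set; exact: ExpD.
Qed.
HB.instance Definition _ :=
  GRing.SubChoice_isSubLmodule.Build _ _ _ exp_space Exp_submod_closed.

HB.instance Definition _ := isPointed.Build exp_space 0.

(* The topology generated by the open balls of the norms exp_norm k rho,
   rho > 0. *)
HB.instance Definition _ := @isSubBaseTopological.Build exp_space
  (exp_space * R * R)%type
  [set i : exp_space * R * R | 0 < i.1.2 /\ 0 < i.2]
  (fun i => [set g : exp_space | (exp_norm Th k i.1.2 (g - i.1.1)%R < i.2%:E)%E]).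

End exp_space_type.

Section convolution.
Context (R : realType) (E : normedModType R[i]) (Th : holomorphy_type E)
  (k : \bar R).

(* \widehat{B \cdot^m} at y: x |-> B(x, ..., x, y, ..., y), x taken m times *)
Definition contract j (B : ('I_j -> E) -> Cn R) (m : nat) (y : E) : E -> Cn R :=
  fun x => B (fun i => if (i < m)%N then x else y).

(* T (\widehat{B \cdot^m}) is fun y => T (g y), where g y is contract B m y as a
   point of exp_space (determined by y, because exp_fun is injective). *)
Definition pi2_type : Prop :=
  forall T : {linear exp_space Th k -> Cn R}, continuous T ->
  (forall m j (p : ht_space Th j) (g : E -> exp_space Th k), (m <= j)%N ->
     (forall y, exp_fun (g y) = contract (polar j (ht_val Th j p)) m y) ->
     ht_poly Th (j - m) (fun y => T (g y))) /\
  (forall C rho : R, 0 < C -> 0 < rho ->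
     (forall f : exp_space Th k,
        ((rnorm (T f))%:E <= C%:E * exp_norm Th k rho f)%E) ->
     exists2 M : R, 0 < M &
       forall m j (p : ht_space Th j) (g : E -> exp_space Th k), (m <= j)%N ->
         (forall y, exp_fun (g y) = contract (polar j (ht_val Th j p)) m y) ->
         ht_norm Th (j - m) (fun y => T (g y))
           <= C * M ^+ j * rho ^- m * exp_weight k m * rnorm p).

(* tau_(-x) f *)
Definition translate (x : E) (f : E -> Cn R) : E -> Cn R := fun y => f (y + x).

(* L f = T * f for all f, including the membership of the translates of f in
   Exp. *)
Definition is_convolution_by (T : exp_space Th k -> Cn R)
    (L : exp_space Th k -> exp_space Th k) : Prop :=
  forall (f : exp_space Th k) (x : E),
    exists2 g : exp_space Th k, exp_fun g = translate x f & L f x = T g.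

Definition convolution_operator (L : exp_space Th k -> exp_space Th k) : Prop :=
  [/\ linear L, continuous L &
    forall (a : E) (f : exp_space Th k),
      exists2 g : exp_space Th k, exp_fun g = (fun x => dhat 1 f x a) &
        (fun x => dhat 1 (L f) x a) = exp_fun (L g)].

End convolution.

Definition mixing (X : topologicalType) (S : X -> X) : Prop :=
  forall U V : set X, open U -> open V -> U !=set0 -> V !=set0 ->
    exists n0 : nat, forall n, (n0 <= n)%N -> (iter n S @` U) `&` V !=set0.

(* Main.v *)
Require Import Defs.
From HB Require Import structures.
From mathcomp Require Import all_boot all_order all_algebra.
From mathcomp Require Import all_fingroup cyclic separable cyclotomic complex.
From mathcomp Require Import all_classical all_reals all_analysis.
From mathcomp Require Import ring lra.
Import Defs.

Import Order.TTheory GRing.Theory Num.Theory numFieldNormedType.Exports.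

Local Open Scope classical_set_scope.
Local Open Scope ring_scope.

Set Implicit Arguments.
Unset Strict Implicit.
Unset Printing Implicit Defensive.

(** Convolution with a continuous functional [T] on the space of entire functions
    of type (Theta, k), [1 < k], is mixing, because it has many eigenvectors.

    The exponential [expo phi] of a continuous functional [phi] on [E] belongs to
    the space, since for [1 < k] the weights grow more slowly than the factorials
    ([exp_weight_fact]), and its translates are its multiples ([shift_expo]); so
    it is an eigenvector of the operator, with eigenvalue [T (expo phi)]. If this
    eigenvalue did not depend on [phi], the functional would vanish on the powers
    of positive degree of functionals, which together with the constants span a
    dense subspace, and [T] would be a multiple of the evaluation at 0
    ([apply_expo_nonconstant]). So [t |-> T (expo (t psi))] is a nonconstant entire
    function for some [psi]. By Liouville's theorem, applied to it and to its
    reciprocal ([liouville_bounded], [liouville_away0]), it takes values inside and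
    outside the unit disc, and by continuity this persists near the points found.
    The exponentials of the functionals near a given one span a dense subspace
    ([expo_dense]): the coefficients of the entire series
    [t |-> expo (phi + t psi)] lie in any closed subspace containing its values
    near 0, and these coefficients suffice to recover all exponentials, then all
    powers of functionals, and then everything, by the density axiom of
    pi1-types. Hence the vectors whose iterates
    tend to 0, and those having preimages of all orders that tend to 0, are dense,
    and the operator is mixing by Kitai's criterion ([mixing_criterion]).

    That convolution is a continuous operator ([convolution_ex]) comes from
    expanding [T (shift x f)] in homogeneous polynomials in [x]: the component of
    degree [l] is the sum over [m] of the polynomials in [x] that the axioms of
    pi2-types provide, and bound, when [T] is applied to the part of degree [m] of
    the translate by [x] of the Taylor component of degree [m + l] of [f]. It commutes
    with differentiation because it commutes with translations, and translations
    have a Taylor expansion in the space ([shift_expansion]).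

    Throughout, the norms are replaced by suprema of weighted coefficients
    ([seq_bound]), so that all series in sight are geometric, and contour integrals
    by averages over roots of unity ([root_average]). *)

(** * The complex modulus *)

Section rnorm_field.
Context (R : realType).
(** The modulus as a function on the field itself, so that arguments are parsed
    with the field operations rather than those of the regular module. *)
Definition cnorm (z : R[i]) : R := rnorm (z : Cn R).
Implicit Types x y : R[i].

Lemma cnormE x : cnorm x = rnorm (x : Cn R). Proof. by []. Qed.

Lemma cnorm_ge0 x : 0 <= cnorm x. Proof. exact: rnorm_ge0. Qed.

Lemma cnormD x y : cnorm (x + y) <= cnorm x + cnorm y.
Proof. exact: rnormD. Qed.

Lemma cnormN x : cnorm (- x) = cnorm x. Proof. exact: rnormN. Qed.

Lemma cnormB x y : cnorm (x - y) = cnorm (y - x).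
Proof. by rewrite -cnormN opprB. Qed.

Lemma cnorm0 : cnorm 0 = 0. Proof. exact: rnorm0. Qed.

Lemma cnorm1 : cnorm 1 = 1.
Proof. by apply: (@complexI R); rewrite rnormE normr1. Qed.

Lemma cnormM x y : cnorm (x * y) = cnorm x * cnorm y.
Proof. exact: (rnormZ (x : Cn R) (y : Cn R)). Qed.

Lemma cnormX x n : cnorm (x ^+ n) = cnorm x ^+ n.
Proof.
elim: n => [|n ih]; first by rewrite !expr0 cnorm1.
by rewrite !exprS cnormM ih.
Qed.

Lemma rnorm_eq0 (V : normedModType R[i]) (x : V) : (rnorm x == 0) = (x == 0).
Proof. by apply/eqP/eqP => [/rnorm0_eq0//|->]; rewrite rnorm0. Qed.

Lemma cnorm_eq0 x : (cnorm x == 0) = (x == 0).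
Proof. exact: (rnorm_eq0 (x : Cn R)). Qed.

Lemma cnorm_gt0 x : (0 < cnorm x) = (x != 0).
Proof. by rewrite lt_def cnorm_ge0 andbT cnorm_eq0. Qed.

Lemma cnormV x : cnorm (x^-1) = (cnorm x)^-1.
Proof.
have [->|x0] := eqVneq x 0; first by rewrite invr0 cnorm0 invr0.
have n0 : cnorm x != 0 by rewrite cnorm_eq0.
by apply: (mulfI n0); rewrite -cnormM !divff// cnorm1.
Qed.

Lemma cnorm_real (t : R) : cnorm t%:C%C = `|t|. Proof. exact: rnorm_real. Qed.

Lemma cnorm_nat n : cnorm n%:R = n%:R.
Proof.
have -> : n%:R = (n%:R : R)%:C%C :> R[i] by rewrite rmorph_nat.
by rewrite cnorm_real ger0_norm.
Qed.

Lemma cnorm_sum (I : Type) (r : seq I) (P : pred I) (F : I -> R[i]) :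
  cnorm (\sum_(i <- r | P i) F i) <= \sum_(i <- r | P i) cnorm (F i).
Proof.
elim/big_rec2: _ => [|i y x _ h]; first by rewrite cnorm0.
by rewrite (le_trans (cnormD _ _))// lerD2l.
Qed.

Lemma rnorm_scale (V : normedModType R[i]) (c : R[i]) (v : V) :
  rnorm (c *: v) = cnorm c * rnorm v.
Proof. exact: rnormZ. Qed.

Lemma rnormB (V : normedModType R[i]) (x y : V) : rnorm (x - y) = rnorm (y - x).
Proof. by rewrite -rnormN opprB. Qed.

Lemma rnorm_sumI (V : normedModType R[i]) (I : Type) (r : seq I) (P : pred I)
  (F : I -> V) : rnorm (\sum_(i <- r | P i) F i) <= \sum_(i <- r | P i) rnorm (F i).
Proof.
elim/big_rec2: _ => [|i y x _ h]; first by rewrite rnorm0.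
by rewrite (le_trans (rnormD _ _))// lerD2l.
Qed.

End rnorm_field.

(** Discrete Fourier inversion: coefficients of a vector polynomial of degree
    less than [N] are averages of its values at the [N]-th roots of unity. *)
Lemma root_average (K : numFieldType) (V : lmodType K) N (w : K) (c : nat -> V) m :
  N.-primitive_root w -> (m < N)%N ->
  c m = N%:R^-1 *: \sum_(l < N) ((w ^- l) ^+ m : K) *: \sum_(i < N) ((w ^+ l) ^+ i : K) *: c i.
Proof.
move=> wP mN; have N0 := prim_order_gt0 wP.
have w0 : w != 0 by rewrite (prim_root_eq0 wP) -lt0n.
under eq_bigr do rewrite scaler_sumr.
rewrite exchange_big/= (bigD1 (Ordinal mN))//= [X in _ + X]big1 => [|i im].
  rewrite addr0 (eq_bigr (fun=> c m)) => [|l _]; last first.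
    by rewrite scalerA -exprMn mulVf ?expf_neq0// expr1n scale1r.
  by rewrite sumr_const card_ord -(scaler_nat N (c m)) scalerA mulVf ?scale1r// pnatr_eq0 -lt0n.
pose z := w ^+ i / w ^+ m.
have zE l : ((w ^- l) ^+ m) *: ((w ^+ l) ^+ i *: c i) = z ^+ l *: c i.
  by rewrite scalerA exprMn exprVn exprVn -!exprM mulrC [(l * i)%N]mulnC [(l * m)%N]mulnC.
under eq_bigr do rewrite zE.
rewrite -scaler_suml; suff -> : \sum_(l < N) z ^+ l = 0 by rewrite scale0r.
have zN : z ^+ N = 1.
  by rewrite exprMn exprVn -!exprM ![(_ * N)%N]mulnC !exprM (prim_expr_order wP) !expr1n mulfV ?oner_neq0.
have z1 : z - 1 != 0.
  rewrite subr_eq0; apply: contra im => /eqP z1.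
  have /eqP : w ^+ i = w ^+ m by rewrite -[RHS]mul1r -z1 divfK// expf_neq0.
  by rewrite (eq_prim_root_expr wP) !modn_small.
by apply: (mulfI z1); rewrite mulr0 -subrX1 zN subrr.
Qed.

Section roots_of_unity.
Context (R : realType).

Lemma prim_root_ex N : (0 < N)%N -> exists w : R[i], N.-primitive_root w.
Proof.
move=> N0; pose p : {poly R[i]} := 'X^N - 1.
have [r Dp] := closed_field_poly_normal p.
have sz_p : size p = N.+1 by rewrite size_XnsubC.
rewrite (monicP _) ?monicXnsubC// scale1r in Dp.
have rn1 : all N.-unity_root r by apply/allP => z; rewrite -root_prod_XsubC -Dp.
have sz_r : (N <= size r)%N.
  by rewrite -ltnS -sz_p Dp size_prod_XsubC.
have [|z] := hasP (has_prim_root N0 rn1 _ sz_r); last by exists z.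
by rewrite -separable_prod_XsubC -Dp separable_Xn_sub_1// pnatr_eq0 -lt0n.
Qed.

Lemma prim_root_rnorm N (w : R[i]) : N.-primitive_root w -> cnorm w = 1.
Proof.
move=> wP; have N0 := prim_order_gt0 wP.
apply/eqP; rewrite -(pexpr_eq1 N0 (cnorm_ge0 w)) -cnormX.
by rewrite (prim_expr_order wP) cnorm1.
Qed.

(** Cauchy's estimate; the average over roots of unity is an exact substitute
    for the contour integral. *)
Lemma cauchy_estimate (V : normedModType R[i]) (c : nat -> V) N (r B : R) :
  0 < r ->
  (forall z : R[i], cnorm z = r -> rnorm (\sum_(i < N) z ^+ i *: c i) <= B) ->
  forall m, (m < N)%N -> rnorm (c m) * r ^+ m <= B.
Proof.
move=> r0 cB m mN; have N0 : (0 < N)%N by apply: leq_ltn_trans mN.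
have [w wP] := prim_root_ex N0.
have w1 : cnorm w = 1 by apply: prim_root_rnorm wP.
have NR : (0 : R) < N%:R by rewrite ltr0n.
have := root_average (fun i => (r%:C%C : R[i]) ^+ i *: c i) wP mN.
move/(congr1 (@rnorm R V)).
rewrite (rnorm_scale (r%:C%C ^+ m)) cnormX cnorm_real (gtr0_norm r0) mulrC => ->.
rewrite (rnorm_scale N%:R^-1) cnormV cnorm_nat mulrC ler_pdivrMr//.
rewrite (le_trans (rnorm_sumI _ _ _))// mulr_natr.
have -> : B *+ N = \sum_(i < N) B by rewrite sumr_const card_ord.
apply: ler_sum => l _.
rewrite (rnorm_scale ((w ^- l) ^+ m)) cnormX cnormV cnormX w1 expr1n invr1 expr1n mul1r.
under eq_bigr do rewrite scalerA -exprMn.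
by apply: cB; rewrite cnormM cnormX w1 expr1n mul1r cnorm_real gtr0_norm.
Qed.

Lemma cauchy_estimate_scalar (c : nat -> R[i]) N (r B : R) : 0 < r ->
  (forall z : R[i], cnorm z = r -> cnorm (\sum_(i < N) z ^+ i * c i) <= B) ->
  forall m, (m < N)%N -> cnorm (c m) * r ^+ m <= B.
Proof. exact: (@cauchy_estimate (Cn R)). Qed.

End roots_of_unity.

(** * Liouville's theorem, by power series *)

Section liouville.
Context (R : realType).

(** Convergence on every disc, at the geometric rate of a power series with
    infinite radius of convergence. *)
Definition entire_series (g : R[i] -> R[i]) (a : nat -> R[i]) :=
  forall r : R, 0 < r -> exists C : R, forall J (t : R[i]), cnorm t <= r ->
    cnorm (g t - \sum_(j < J) t ^+ j * a j) <= C * (cnorm t / r) ^+ J.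

Lemma half_small (C e : R) m : 0 < e ->
  exists2 J, (m <= J)%N & C * (2^-1) ^+ J <= e.
Proof.
move=> e0.
have : C * (2^-1) ^+ n @[n --> \oo] --> C * (0 : R).
  by apply: cvgMr; apply: cvg_expr; rewrite ger0_norm ?invf_lt1 ?ltr1n.
rewrite mulr0 => /cvgrPdist_le/(_ e e0)[J _ hJ].
exists (maxn m J); first exact: leq_maxl.
have := hJ (maxn m J) (leq_maxr _ _); rewrite sub0r normrN.
by apply: le_trans; rewrite ler_norm.
Qed.

Lemma entire_series_half g a (s : R) : entire_series g a -> 0 < s ->
  exists C : R, forall J (t : R[i]), cnorm t <= s ->
    cnorm (g t - \sum_(j < J) t ^+ j * a j) <= C * (2^-1) ^+ J.
Proof.
move=> ga s0; have [|C hC] := ga (s * 2); first by rewrite mulr_gt0.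
exists C => J t ts; have s20 : 0 < s * 2 by rewrite mulr_gt0.
have C0 : 0 <= C.
  have := hC 0%N 0; rewrite cnorm0 => /(_ (ltW s20)).
  by rewrite expr0 mulr1; apply: le_trans; rewrite cnorm_ge0.
have h : cnorm t <= s * 2 by rewrite (le_trans ts)// ler_peMr ?ler1n// ltW.
apply: (le_trans (hC J t h)); rewrite ler_wpM2l// lerXn2r ?nnegrE ?divr_ge0 ?cnorm_ge0 ?(ltW s20)//.
by rewrite ler_pdivrMr// mulrC mulfK.
Qed.

Lemma le_div_all (x B : R) : 0 <= x ->
  (forall r : R, 1 <= r -> x * r <= B) -> x = 0.
Proof.
move=> x0 h; apply/eqP; rewrite eq_le x0 andbT leNgt; apply/negP => xp.
have := h (`|B| / x + 1); rewrite lerDr divr_ge0// => /(_ isT).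
rewrite mulrDr mulrCA divff ?gt_eqF// !mulr1.
have := ler_norm B; lra.
Qed.

(** Cauchy's estimate for the Taylor polynomials, on larger and larger discs. *)
Lemma liouville_bounded g a : entire_series g a ->
  (forall t, cnorm (g t) <= 1) -> forall m, (0 < m)%N -> a m = 0.
Proof.
move=> ga g1 m m0; apply/eqP; rewrite -cnorm_eq0; apply/eqP.
apply: (@le_div_all _ 2 (cnorm_ge0 _)) => r r1.
have r0 : 0 < r by apply: lt_le_trans r1.
have [C hC] := entire_series_half ga r0.
have [J mJ CJ] := half_small C m.+1 ltr01.
apply: (@le_trans _ _ (cnorm (a m) * r ^+ m)).
  rewrite ler_wpM2l ?cnorm_ge0//.
  by case: m m0 {mJ} => // m _; rewrite exprS ler_peMr ?(ltW r0)// exprn_ege1.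
apply: (@cauchy_estimate_scalar _ a J) => // z zr.
have := hC J z; rewrite zr lexx => /(_ isT) h.
set S := \sum_(_ < J) _ in h *.
have -> : S = g z - (g z - S) by rewrite subKr.
rewrite (le_trans (cnormD _ _))// cnormN.
have := g1 z; lra.
Qed.

(** The reciprocal of a factor [1 - X / zeta] is on the disc a geometric series of
    ratio at most 1/4, and convolution with it preserves geometric decay of ratio
    1/2, at the cost of a factor 2. *)
Lemma reciprocal_series (r : R) (s : seq R[i]) : 0 < r ->
  (forall z : R[i], z \in s -> 4 * r <= cnorm z) ->
  let S : {poly R[i]} := \prod_(z <- s) (1 - z^-1 *: 'X) in
  exists u : nat -> R[i],
  [/\ exists A : R, forall n, cnorm (u n) * r ^+ n <= A * (2^-1) ^+ n,
      forall N, exists W, S * (\sum_(i < N) (u i : R[i]) *: 'X^i) = 1 + W * 'X^N &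
      exists A : R, forall N (z : R[i]), cnorm z <= r ->
        cnorm (S.[z] * (\sum_(i < N) z ^+ i * u i) - 1 : R[i]) <= A * (2^-1) ^+ N].
Proof.
move=> r0; elim: s => [|z s ih] hs /=.
  rewrite big_nil; exists (fun n => (n == 0%N)%:R); split.
  - exists 1 => -[|n]; first by rewrite cnorm1 !mul1r.
    by rewrite cnorm0 mul0r mul1r exprn_ge0// invr_ge0.
  - move=> [|N].
      exists (-1); rewrite big_ord0 mulr0 expr0; ring.
    exists 0; rewrite mul1r mul0r addr0 big_ord_recl scale1r expr0 big1 ?addr0// => i _.
    by rewrite scale0r.
  - exists 1 => -[|N] t tr.
      by rewrite big_ord0 mulr0 sub0r cnormN cnorm1 mul1r.
    rewrite -polyC1 hornerC !mul1r big_ord_recl big1 => [|i _]; last by rewrite mulr0.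
    by rewrite expr0 mulr1 addr0 subrr cnorm0 exprn_ge0// invr_ge0.
have [|v [[A hA] hW [A' hA']]] := ih.
  by move=> t ts; apply: hs; rewrite in_cons ts orbT.
have zr : 4 * r <= cnorm (z : R[i]) by apply: hs; rewrite mem_head.
have z0 : 0 < cnorm (z : R[i]) by apply: lt_le_trans zr; rewrite mulr_gt0.
have A0 : 0 <= A.
  by have := hA 0%N; rewrite !mulr1; apply: le_trans; rewrite cnorm_ge0.
have [u u0 uS] : exists2 u : nat -> R[i], u 0%N = v 0%N &
    forall n, u n.+1 = v n.+1 + z^-1 * u n.
  by exists (fix u n := if n is m.+1 then v n + z^-1 * u m else v 0%N).
have hu n : cnorm (u n) * r ^+ n <= (2 * A) * (2^-1) ^+ n.
  elim: n => [|n ihn]; first by have := hA 0%N; rewrite u0 !mulr1; lra.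
  rewrite uS (@le_trans _ _ ((cnorm (v n.+1) + cnorm (z^-1 : R[i]) * cnorm (u n)) * r ^+ n.+1))//.
    by rewrite ler_wpM2r ?exprn_ge0 ?(ltW r0)// -cnormM cnormD.
  rewrite mulrDl [X in _ + X <= _](_ : _ =
    (cnorm (z^-1 : R[i]) * r) * (cnorm (u n) * r ^+ n)); last by rewrite exprS; ring.
  have h1 : cnorm (z^-1 : R[i]) * r <= 4^-1.
    by rewrite cnormV mulrC ler_pdivrMr// mulrC ler_pdivlMr// mulrC.
  have h2 : (cnorm (z^-1 : R[i]) * r) * (cnorm (u n) * r ^+ n) <=
      4^-1 * ((2 * A) * (2^-1) ^+ n).
    by apply: ler_pM => //; rewrite mulr_ge0 ?cnorm_ge0 ?exprn_ge0 ?(ltW r0).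
  apply: (le_trans (lerD (hA n.+1) h2)).
  by rewrite exprS le_eqVlt; apply/orP; left; apply/eqP; field.
have key N : (1 - z^-1 *: 'X) * (\sum_(i < N.+1) (u i : R[i]) *: 'X^i) =
    \sum_(i < N.+1) (v i : R[i]) *: 'X^i - (z^-1 * u N : R[i]) *: 'X^(N.+1) :> {poly R[i]}.
  elim: N => [|N ihN].
    rewrite !big_ord1 /= u0 mulrBl mul1r expr0 expr1 -!mul_polyC polyCM; ring.
  rewrite big_ord_recr/= mulrDr ihN [in RHS]big_ord_recr/= uS.
  rewrite [X in X.+1]/= -!mul_polyC !polyCD !polyCM !exprS; ring.
exists u; split; first by exists (2 * A).
  move=> [|N]; first by exists (-1); rewrite big_ord0 mulr0 expr0 mulr1 addrN.
  have [W hN] := hW N.+1.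
  exists (W - (z^-1 * u N : R[i]) *: \prod_(z <- s) (1 - z^-1 *: 'X)).
  rewrite big_cons mulrAC key mulrC mulrBr hN -!mul_polyC; ring.
set S := \prod_(z <- s) _ in hA' hW *.
have [B hB] : exists B : R, forall t : R[i], cnorm t <= r -> cnorm (S.[t] : R[i]) <= B.
  exists (\sum_(i < size S) cnorm (S`_i : R[i]) * r ^+ i) => t tr.
  rewrite horner_coef (le_trans (cnorm_sum _ _ _))// ler_sum// => i _.
  by rewrite cnormM cnormX ler_wpM2l ?cnorm_ge0// lerXn2r ?nnegrE ?cnorm_ge0// ltW.
have B0 : 0 <= B by apply: (le_trans (cnorm_ge0 _)); apply: (hB 0); rewrite cnorm0 ltW.
exists (Num.max 1 (A' + B * A)) => -[|N] t tr.
  by rewrite big_ord0 mulr0 sub0r cnormN cnorm1 expr0 mulr1 le_max lexx.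
have -> : \sum_(i < N.+1) t ^+ i * u i = (\sum_(i < N.+1) (u i : R[i]) *: 'X^i).[t].
  by rewrite horner_sum; apply: eq_bigr => i _; rewrite hornerE hornerXn mulrC.
rewrite -hornerM big_cons mulrAC key mulrC mulrBr hornerD hornerN addrAC.
rewrite (le_trans (cnormD _ _))// cnormN (@le_trans _ _ ((A' + B * A) * 2^-1 ^+ N.+1))//; last first.
  by rewrite ler_wpM2r ?exprn_ge0 ?invr_ge0// le_max lexx orbT.
rewrite mulrDl lerD//.
  rewrite hornerM (_ : (\sum_(i < N.+1) _).[t] = \sum_(i < N.+1) t ^+ i * v i) ?hA'//.
  by rewrite horner_sum; apply: eq_bigr => i _; rewrite hornerE hornerXn mulrC.
rewrite hornerM hornerZ hornerXn cnormM -mulrA ler_pM ?cnorm_ge0 ?hB//.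
rewrite !cnormM cnormX.
rewrite (@le_trans _ _ (cnorm (z^-1 : R[i]) * cnorm (u N) * r ^+ N.+1))//.
  by rewrite ler_wpM2l ?mulr_ge0 ?cnorm_ge0// lerXn2r ?nnegrE ?cnorm_ge0// ltW.
have h1 : cnorm (z^-1 : R[i]) * r <= 4^-1.
  by rewrite cnormV mulrC ler_pdivrMr// mulrC ler_pdivlMr// mulrC.
rewrite (_ : _ * r ^+ N.+1 = (cnorm (z^-1 : R[i]) * r) * (cnorm (u N) * r ^+ N)); last first.
  by rewrite exprS; ring.
have : (cnorm (z^-1 : R[i]) * r) * (cnorm (u N) * r ^+ N) <=
      4^-1 * ((2 * A) * (2^-1) ^+ N).
  by apply: ler_pM => //; rewrite mulr_ge0 ?cnorm_ge0 ?exprn_ge0 ?(ltW r0).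
move/le_trans; apply; rewrite exprS le_eqVlt; apply/orP; left; apply/eqP; field.
by [].
Qed.

(** The Taylor polynomials [P] of high order do not vanish on a large disc, hence
    have there a convergent reciprocal series [u], normalized by [u_0 = 1], whose coefficients obey Cauchy's estimate, because
    [1 / P] is bounded. So [u_i] is small for [i > 0], and the convolution
    relation between the coefficients of [P] and [u] makes [a_m] small. *)
Lemma liouville_away0 g a : entire_series g a ->
  (forall t, 1 <= cnorm (g t)) -> forall m, (0 < m)%N -> a m = 0.
Proof.
move=> ga g1 m m0; apply/eqP; rewrite -cnorm_eq0; apply/eqP.
apply: (@le_div_all _ (\sum_(i < m) cnorm (a i) * (4 * cnorm (a 0%N)))).
  exact: cnorm_ge0.
move=> r r1; have r0 : 0 < r by apply: lt_le_trans r1.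
have r40 : 0 < 4 * r by rewrite mulr_gt0.
(* The truncation order [J] makes the Taylor polynomial [P] at least 1/2 on the
   disc of radius [4 r], so that its roots are at distance at least [4 r]. *)
have [C hC] := entire_series_half ga r40.
have [J mJ CJ] := @half_small C 2^-1 m.+1 ltac:(by rewrite invr_gt0).
pose P : {poly R[i]} := \sum_(i < J) a i *: 'X^i.
have PE t : P.[t] = \sum_(i < J) t ^+ i * a i.
  by rewrite horner_sum; apply: eq_bigr => i _; rewrite hornerE hornerXn mulrC.
have P2 t : cnorm t <= 4 * r -> 2^-1 <= cnorm P.[t].
  move=> tr; have := hC J t tr; rewrite -PE => h.
  have := cnormD P.[t] (g t - P.[t]); rewrite addrCA subrr addr0.
  have := g1 t; lra.
have Pi i : (i < J)%N -> P`_i = a i.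
  move=> iJ; rewrite coef_sum (bigD1 (Ordinal iJ))//= coefZ coefXn eqxx mulr1.
  rewrite big1 ?addr0// => j; rewrite -val_eqE/= => ji.
  by rewrite coefZ coefXn eq_sym (negbTE ji) mulr0.
have J0 : (0 < J)%N by apply: leq_ltn_trans mJ.
have a0 : a 0%N != 0.
  rewrite -Pi// -horner_coef0 -cnorm_gt0 (lt_le_trans _ (P2 0 _)) ?invr_gt0//.
  by rewrite cnorm0 ltW.
have [s Ps] := closed_field_poly_normal P.
have lP : lead_coef P != 0.
  rewrite lead_coef_eq0; apply: contra_neq a0 => P0.
  by rewrite -Pi// P0 coef0.
have sr z : z \in s -> 4 * r <= cnorm z.
  move=> zs; rewrite leNgt; apply/negP => /ltW /P2.
  have /eqP -> : root P z by rewrite Ps rootZ// root_prod_XsubC.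
  by rewrite cnorm0 leNgt invr_gt0 ltr0n.
have [u [[A hA] hW [A' hA']]] := reciprocal_series r0 sr.
have s0 z : z \in s -> z != 0 by move=> /sr; rewrite -cnorm_gt0; apply: lt_le_trans.
set S := \prod_(z <- s) _ in hW hA'.
(* Normalize the factors of [P] to be 1 at the origin. *)
have PS : P = a 0%N *: S.
  have : exists c, P = c *: S.
    rewrite Ps /S; have : {in s, forall z, z != 0} by [].
    elim: (s) (lead_coef P) => [|z s' ih] c hs'; first by exists c; rewrite !big_nil.
    rewrite !big_cons scalerAr -[X in _ * X]mul1r.
    have [|c' e] := ih (c * - z); first by move=> t ts; rewrite hs'// in_cons ts orbT.
    exists c'; rewrite scalerAr -e -!mul_polyC mul1r.
    have z0 : z != 0 by rewrite hs'// mem_head.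
    have zz : z%:P * z^-1%:P = 1 :> {poly R[i]} by rewrite -polyCM divff.
    rewrite polyCM polyCN; set w := z^-1%:P in zz *.
    have -> : 'X - z%:P = - z%:P * (1 - w * 'X).
      by rewrite mulrBr mulr1 mulNr mulrA zz mul1r opprK addrC.
    ring.
  move=> [c Pc]; suff -> : a 0%N = c by [].
  rewrite -Pi// Pc -horner_coef0 hornerZ /S horner_prod big1 ?mulr1// => z _.
  by rewrite hornerD hornerN hornerZ hornerX mulr0 subr0 -polyC1 hornerC.
have u0 : u 0%N = 1.
  have [W] := hW 1%N; move/(congr1 (fun p : {poly R[i]} => p.[0])).
  have S0 : S.[0] = 1.
    rewrite /S horner_prod big1// => z _.
    by rewrite hornerD hornerN hornerZ hornerX mulr0 subr0 -polyC1 hornerC.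
  rewrite hornerM hornerD hornerM hornerX mulr0 addr0 -polyC1 hornerC S0 mul1r.
  by rewrite big_ord1 hornerZ expr0 -polyC1 hornerC mulr1.
have ub i : cnorm (u i) * r ^+ i <= 4 * cnorm (a 0%N).
  have [N iN AN] := @half_small A' 1 i.+1 ltr01.
  apply: (@cauchy_estimate_scalar _ u N) => // z zr.
  have h := hA' N z ltac:(by rewrite zr).
  have := P2 z ltac:(by rewrite zr; lra).
  rewrite PS hornerZ cnormM; set U := \sum_(_ < N) _ in h *.
  have h2 : cnorm (S.[z] * U) <= 2.
    have := cnormD (S.[z] * U - 1) 1; rewrite subrK cnorm1; lra.
  move: h2; rewrite cnormM => h2 h3.
  have := ler_pM _ _ h3 h2; rewrite invr_ge0 mulr_ge0 ?cnorm_ge0// => _.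
  have S0 : 0 < cnorm S.[z].
    rewrite lt_def cnorm_ge0 andbT; apply: contraTneq h3 => ->.
    by rewrite mulr0 -ltNge invr_gt0.
  rewrite -(ler_pM2l S0) (le_trans h2)//.
  move: h3; lra.
(* The coefficient of order [m] of [P * (sum of u_i X^i) = a_0 + O(X^(m+1))]. *)
have conv : a m = - \sum_(i < m) a i * u (m - i)%N.
  apply/eqP; rewrite -addr_eq0; apply/eqP.
  have [W] := hW m.+1; move/(congr1 (fun p : {poly R[i]} => (a 0%N *: p)`_m)).
  rewrite scalerAl -PS coefM.
  have -> : (a 0%N *: (1 + W * 'X^(m.+1)))`_m = 0.
    by rewrite coefZ coefD coefMXn ltnSn coef1 gtn_eqF// addr0 mulr0.
  rewrite big_ord_recr/= subnn => e; rewrite addrC -[RHS]e; congr (_ + _).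
    apply: eq_bigr => i _; rewrite Pi; last exact: ltn_trans (ltn_ord i) mJ.
    congr (_ * _); rewrite coef_sum (bigD1 (Ordinal (leq_ltn_trans (leq_subr i m) (ltnSn m))))//=.
    rewrite coefZ coefXn eqxx mulr1 big1 ?addr0// => j; rewrite -val_eqE/= => ji.
    by rewrite coefZ coefXn eq_sym (negbTE ji) mulr0.
  rewrite Pi// coef_sum (bigD1 ord0)//= coefZ coefXn eqxx mulr1 u0 big1 ?addr0 ?mulr1// => j.
  by rewrite -val_eqE/= => ji; rewrite coefZ coefXn eq_sym (negbTE ji) mulr0.
rewrite conv cnormN (le_trans (ler_wpM2r (ltW r0) (cnorm_sum _ _ _)))// mulr_suml.
apply: ler_sum => i _; rewrite cnormM -mulrA ler_wpM2l ?cnorm_ge0//.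
rewrite (le_trans _ (ub (m - i)%N))// ler_wpM2l ?cnorm_ge0//.
by rewrite -[leLHS]expr1 ler_weXn2l// subn_gt0.
Qed.

End liouville.

(** * Translates of homogeneous polynomials *)

Section multilinear.
Context (R : realType) (E : normedModType R[i]).
Implicit Types (j m n : nat) (a x y : E).

Local Notation dfw := (@dfwith _ (fun=> E)).

Lemma multilinear_scale j (A : ('I_j -> E) -> Cn R) (c : nat -> R[i]) v :
  multilinear_form A ->
  A (fun i => c i *: v i) = (\prod_(0 <= i < j) c i) * A v.
Proof.
move=> mA.
have A0 i u : A (dfw u i 0) = 0.
  have := mA i u (-1) 0 0.
  by rewrite scaler0 addr0 scaleN1r addNr.
have h n : (n <= j)%N -> A (fun i : 'I_j => if (i < n)%N then c i *: v i else v i)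
    = (\prod_(0 <= i < n) c i) * A v.
  elim: n => [|n ih] nj; first by rewrite big_nil mul1r; congr A; apply/funext.
  rewrite big_nat_recr//= [_ * c n]mulrC -mulrA -ih 1?ltnW//.
  set u := fun i : 'I_j => if (i < n)%N then c i *: v i else v i.
  have := mA (Ordinal nj) u (c n) (v (Ordinal nj)) 0; rewrite A0 !addr0.
  have -> : dfw u (Ordinal nj) (v (Ordinal nj)) = u.
    by apply/funext => i; case: dfwithP => [|//]; rewrite /u /= ltnn.
  move=> e; rewrite -[RHS]/(c n *: (A u : Cn R)) -e; congr A; apply/funext => i.
  case: dfwithP => [|i' ne]; first by rewrite /= ltnS leqnn.
  rewrite /u ltnS leq_eqVlt; case: eqP => //= e'.
  by move/negP : ne; rewrite -val_eqE/= e' eqxx.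
by rewrite -h//; congr A; apply/funext => i; rewrite ltn_ord.
Qed.

Lemma contractZ j (A : ('I_j -> E) -> Cn R) m (s t : R[i]) a x :
  multilinear_form A -> (m <= j)%N ->
  contract A m (s *: a) (t *: x) = s ^+ (j - m) * t ^+ m * contract A m a x.
Proof.
move=> mA mj; rewrite /contract.
transitivity (A (fun i : 'I_j => (if (i < m)%N then t else s) *:
  (if (i < m)%N then x else a))).
  by congr A; apply/funext => i; case: ifP.
rewrite (multilinear_scale (fun i => if (i < m)%N then t else s)
  (fun i => if (i < m)%N then x else a) mA).
congr (_ * _); rewrite (@big_cat_nat _ _ _ m)//= mulrC.
congr (_ * _).
  rewrite (@eq_big_nat _ _ _ m j _ (fun=> s)); first by rewrite prodr_const_nat.
  by move=> i /andP[mi _]; rewrite ltnNge mi.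
rewrite (@eq_big_nat _ _ _ 0 m _ (fun=> t)); first by rewrite prodr_const_nat subn0.
by move=> i /andP[_ im]; rewrite im.
Qed.

(** Symmetrize any multilinear form representing [P]. *)
Lemma polarP j (P : E -> Cn R) : hpoly j P ->
  [/\ multilinear_form (polar j P), symmetric_form (polar j P) &
      forall x, P x = polar j P (fun=> x)].
Proof.
move=> [[A mA PA] _].
pose B v : Cn R := (j`!%:R^-1 : R[i]) *: \sum_(s : 'S_j) (A (v \o s) : Cn R).
suff : [set B | [/\ @multilinear_form _ _ j B, symmetric_form B &
                   forall x, P x = B (fun=> x)]] (get [set B | [/\ @multilinear_form _ _ j B, symmetric_form B &
                   forall x, P x = B (fun=> x)]]) by [].
apply: getPex; exists B; split => [i v c x y|t v|x].
- have dE s z : dfw v i z \o (s : 'S_j) = dfw (v \o s) (s^-1%g i) z.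
    apply/funext => k /=; have [ki|ki] := eqVneq (s^-1%g i) k.
      by rewrite -ki permKV !dfwithin.
    by rewrite [RHS]dfwithout// dfwithout//; apply: contra_neq ki => ->; rewrite permK.
  rewrite /B scalerA mulrC -scalerA -scalerDr; congr (_ *: _).
  rewrite scaler_sumr -big_split; apply: eq_bigr => s _.
  by rewrite !dE mA.
- rewrite /B; congr (_ *: _).
  rewrite [RHS](reindex_inj (mulIg t)); apply: eq_bigr => s _.
  by congr A; apply/funext => k /=; rewrite permM.
- rewrite /B (eq_bigr (fun=> P x)) => [|s _]; last by rewrite PA; congr A; apply/funext.
  have -> : \sum_(s : 'S_j) (P x : Cn R) = j`!%:R * P x by rewrite sumr_const mulr_natl card_Sn.
  rewrite -[RHS]/(j`!%:R^-1 * (j`!%:R * P x)) mulrA mulVf ?mul1r//.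
Qed.

(** Induction on the number [n] of coordinates equal to [a + y]: expand the last of them, and use the symmetry
    to move the new [y] next to the previous ones. *)
Lemma symmetric_binomial j (B : ('I_j -> E) -> Cn R) a y :
  multilinear_form B -> symmetric_form B ->
  B (fun=> a + y) = \sum_(m < j.+1) ('C(j, m)%:R : R[i]) *: contract B m a y.
Proof.
move=> mB sB.
pose G n m (v : 'I_j -> E) (i : 'I_j) :=
  if (i < m)%N then y else if (i < n)%N then a else v i.
have h n : (n <= j)%N -> forall v,
    B (fun i : 'I_j => if (i < n)%N then a + y else v i) =
    \sum_(m < n.+1) ('C(n, m)%:R : R[i]) *: B (G n m v).
  elim: n => [|n ih] nj v.
    by rewrite big_ord1 bin0 scale1r; congr B; apply/funext.
  pose o := Ordinal nj.
  pose u := fun i : 'I_j => if (i < n)%N then a + y else v i.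
  have dE z : dfw u o z = (fun i : 'I_j => if (i < n)%N then a + y else dfw v o z i).
    apply/funext => i; case: dfwithP => [|i' ne]; first by rewrite ltnn dfwithin.
    by rewrite dfwithout.
  have := mB o u 1 a y; rewrite !scale1r !dE.
  have -> : (fun i : 'I_j => if (i < n)%N then a + y else dfw v o (a + y) i) =
      (fun i : 'I_j => if (i < n.+1)%N then a + y else v i).
    apply/funext => i; rewrite ltnS [(i <= n)%N]leq_eqVlt; case: ltnP => // ni; first by rewrite orbT.
    rewrite orbF; case: eqP => [e|ne].
      have -> : i = o; [exact/val_inj|by rewrite dfwithin].
    by rewrite dfwithout//; apply/eqP => e; apply: ne; rewrite -e.
  move=> ->; rewrite !ih 1?ltnW//.
  have Ga m : (m <= n)%N -> G n m (dfw v o a) = G n.+1 m v.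
    move=> mn; apply/funext => i; rewrite /G; case: ifP => // _.
    rewrite ltnS [(i <= n)%N]leq_eqVlt; case: ltnP => // ni; first by rewrite orbT.
    rewrite orbF; case: eqP => [e|ne].
      have -> : i = o; [exact/val_inj|by rewrite dfwithin].
    by rewrite dfwithout//; apply/eqP => e; apply: ne; rewrite -e.
  have Gy m : (m <= n)%N -> B (G n m (dfw v o y)) = B (G n.+1 m.+1 v).
    move=> mn; have mj : (m < j)%N := leq_ltn_trans mn nj.
    pose q := Ordinal mj; rewrite -[RHS](sB (tperm q o)); congr B; apply/funext => i /=.
    rewrite /G; case: tpermP => [->|->|/eqP iq /eqP io] /=.
    - rewrite ltnn !ltnS leqnn; have [nm|mn'] := leqP n m; last by [].
      have -> : q = o; [by apply/val_inj/eqP; rewrite eqn_leq mn nm|].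
      by rewrite dfwithin.
    - by rewrite ltnS leqnn ltnNge mn/= ltnn dfwithin.
    - rewrite dfwithout 1?eq_sym// !ltnS.
      have im : (i <= m)%N = (i < m)%N.
        by rewrite [in LHS]leq_eqVlt (_ : (i == m :> nat) = false)//; apply/negbTE.
      have in' : (i <= n)%N = (i < n)%N.
        by rewrite [in LHS]leq_eqVlt (_ : (i == n :> nat) = false)//; apply/negbTE.
      by rewrite im in'.
  rewrite (eq_bigr (fun m : 'I_n.+1 => ('C(n, m)%:R : R[i]) *: B (G n.+1 m v))); last first.
    by move=> m _; rewrite Ga// -ltnS.
  rewrite [X in _ + X](eq_bigr (fun m : 'I_n.+1 => ('C(n, m)%:R : R[i]) *: B (G n.+1 m.+1 v))); last first.
    by move=> m _; rewrite Gy// -ltnS.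
  rewrite big_ord_recl [RHS]big_ord_recl !bin0 -addrA; congr (_ + _).
  rewrite [RHS](eq_bigr (fun m : 'I_n.+1 => ('C(n, m.+1)%:R : R[i]) *: B (G n.+1 m.+1 v)
     + ('C(n, m)%:R : R[i]) *: B (G n.+1 m.+1 v))); last first.
    by move=> m _; rewrite /= /bump leq0n add1n binS natrD scalerDl.
  rewrite big_split /=; congr (_ + _).
  by rewrite [RHS]big_ord_recr/= bin_small// scale0r addr0.
have := h j (leqnn j) (fun=> a); under eq_fun do rewrite ltn_ord.
move=> ->; apply: eq_bigr => m _; congr (_ *: _); congr B; apply/funext => i.
by rewrite /G ltn_ord.
Qed.

Definition taylor_poly j (P : E -> Cn R) a m : E -> Cn R :=
  ('C(j, m)%:R : R[i]) *: contract (polar j P) m a.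

Lemma taylor_polyE j (P : E -> Cn R) a m y :
  taylor_poly j P a m y = 'C(j, m)%:R * contract (polar j P) m a y :> R[i].
Proof. by []. Qed.

Lemma poly_translate j (P : E -> Cn R) a y : hpoly j P ->
  P (a + y) = \sum_(m < j.+1) taylor_poly j P a m y.
Proof. by move=> /polarP[mB sB ->]; exact: symmetric_binomial. Qed.

Lemma taylor_polyZ j (P : E -> Cn R) a m (s t : R[i]) y : hpoly j P ->
  (m <= j)%N ->
  taylor_poly j P (s *: a) m (t *: y) = s ^+ (j - m) * t ^+ m * taylor_poly j P a m y.
Proof.
move=> /polarP[mB _ _] mj; by rewrite taylor_polyE contractZ// mulrCA.
Qed.

Lemma hpoly_comp_scale_continuous (P : E -> Cn R) (a : E) (z : R[i]) :
  continuous P -> continuous (fun y => P (a + z *: y)).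
Proof.
move=> cP y; apply: continuous_comp; last exact: cP.
apply: continuousD; first exact: cst_continuous.
by apply: (@scaler_continuous R[i] E).
Qed.

(** Continuity holds because the component is an average of [P (a + w^l y)] over
    roots of unity [w^l], with coefficients of modulus 1. *)
Lemma hpoly_taylor_poly j (P : E -> Cn R) a m : hpoly j P -> hpoly m (taylor_poly j P a m).
Proof.
move=> hP; have [mB sB PB] := polarP hP.
have [jm|mj] := ltnP j m.
  have -> : taylor_poly j P a m = 0 by rewrite /taylor_poly bin_small// scale0r.
  split; last exact: cst_continuous.
  by exists (fun=> 0) => // i v c x y; rewrite scaler0 addr0.
split.
  pose ext (u : 'I_m -> E) (i : 'I_j) := if insub (val i) is Some k then u k else a.
  exists (fun u => 'C(j, m)%:R * polar j P (ext u)).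
    move=> i v c x y /=.
    have dE z : ext (dfw v i z) = dfw (ext v) (widen_ord mj i) z.
      apply/funext => k; rewrite /ext; have [->|ki] := eqVneq k (widen_ord mj i).
        by rewrite dfwithin /= valK dfwithin.
      rewrite dfwithout 1?eq_sym//; case: insubP => // k' _ e.
      rewrite dfwithout//; apply: contra_neq ki => ->.
      by apply/val_inj; rewrite /= e.
    rewrite !dE mB -[_ *: _]/(_ * _) mulrDr mulrCA//.
  move=> x; rewrite taylor_polyE; congr (_ * _).
  rewrite /contract; congr (polar j P _); apply/funext => i.
  by rewrite /ext; case: insubP => [k /= ->//|/negbTE ->].
have [w wP] := @prim_root_ex R j.+1 isT.
have -> : taylor_poly j P a m = fun y =>
   (j.+1%:R^-1 : R[i]) *: \sum_(l < j.+1) ((w ^- l) ^+ m : R[i]) *: P (a + w ^+ l *: y).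
  apply/funext => y.
  rewrite (root_average (fun i => (taylor_poly j P a i y : Cn R)) wP) ?ltnS//.
  congr (_ *: _); apply: eq_bigr => l _; congr (_ *: _).
  rewrite (poly_translate _ _ hP); apply: eq_bigr => i _.
  have ij : (i <= j)%N by rewrite -ltnS.
  have := taylor_polyZ a 1 (w ^+ l) y hP ij; rewrite scale1r expr1n mul1r; exact.
move=> y; apply: cvgZr; apply: cvg_big => [|l _]; first exact: add_continuous.
apply: cvgZr.
exact: hpoly_comp_scale_continuous (hP.2) y.
Qed.

Lemma is_taylor_poly j (P : E -> Cn R) a : hpoly j P ->
  is_taylor P a (taylor_poly j P a).
Proof.
move=> hP; split; first by move=> m; exact: hpoly_taylor_poly.
exists 1 => //; apply/uniform_cvgP => e e0; exists j.+1 => n jn x _.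
have xE : a + (x - a) = x by rewrite addrC subrK.
have := poly_translate a (x - a) hP; rewrite xE => ->.
rewrite (big_ord_widen n (fun m => taylor_poly j P a m (x - a)) jn) big_mkcond/=.
rewrite -sumrB big1 ?rnorm0// => m _; case: ifPn => [_|]; first by rewrite subrr.
by rewrite -leqNgt => jm; rewrite taylor_polyE bin_small// mul0r subr0.
Qed.

Lemma dhat_poly j (P : E -> Cn R) a m : hpoly j P ->
  dhat m P a = (m`!%:R : R[i]) *: taylor_poly j P a m.
Proof. by move=> hP; rewrite (dhatE _ (is_taylor_poly a hP)). Qed.

Lemma hpoly_entire j (P : E -> Cn R) : hpoly j P -> entire P.
Proof. by move=> hP a; exists (taylor_poly j P a); exact: is_taylor_poly. Qed.

End multilinear.

(** * Geometric series in Banach spaces *)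

Section geometric_series.
Context (R : realType).

Lemma geo_sum_le (q : R) n : 0 <= q <= 2^-1 -> \sum_(i < n) q ^+ i <= 2.
Proof.
move=> /andP[q0 q2]; have := subrX1 q n.
have : 0 <= q ^+ n by rewrite exprn_ge0.
have : 0 <= \sum_(i < n) q ^+ i by rewrite sumr_ge0// => i _; rewrite exprn_ge0.
set S := \sum_(_ < _) _ => S0 qn0 e; nra.
Qed.

Lemma geo_tail_le (V : normedModType R[i]) (u : nat -> V) (A q : R) m n :
  0 <= q <= 2^-1 -> (forall i, rnorm (u i) <= A * q ^+ i) -> (m <= n)%N ->
  rnorm (\sum_(i < n) u i - \sum_(i < m) u i) <= 2 * A * q ^+ m.
Proof.
move=> q01 hu mn; have /andP[q0 _] := q01.
have A0 : 0 <= A by have := hu 0%N; rewrite expr0 mulr1; apply: le_trans; exact: rnorm_ge0.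
rewrite -!(big_mkord xpredT u) (@big_cat_nat _ _ _ m 0 n)//= addrAC subrr add0r.
rewrite -{1}[m]add0n big_addn big_mkord.
rewrite (le_trans (rnorm_sumI _ _ _))//.
apply: (@le_trans _ _ (\sum_(i < n - m) (A * q ^+ m) * q ^+ i)).
  by apply: ler_sum => i _; rewrite -mulrA -exprD addnC hu.
rewrite -mulr_sumr mulrC -[leRHS]mulrA ler_wpM2r ?mulr_ge0 ?exprn_ge0//.
exact: geo_sum_le.
Qed.

Lemma geo_series (V : completeNormedModType R[i]) (u : nat -> V) (A q : R) :
  0 <= q <= 2^-1 -> (forall i, rnorm (u i) <= A * q ^+ i) ->
  exists s, forall n, rnorm (s - \sum_(i < n) u i) <= 2 * A * q ^+ n.
Proof.
move=> q01 hu; have /andP[q0 q2] := q01.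
pose S n := \sum_(i < n) u i.
have cauchyS : cvg (S @ \oo).
  apply: cauchy_cvg; apply: cauchy_exP => e e0.
  have eE : (complex.Re e)%:C%C = e by rewrite RRe_real// gtr0_real.
  have re0 : 0 < complex.Re e by rewrite -ltcR eE.
  have re20 : 0 < complex.Re e / 2 by rewrite divr_gt0.
  have [N _ hN] := @half_small R (2 * A) (complex.Re e / 2) 0 re20.
  exists (S N); exists N => // n /= Nn; rewrite -ball_normE /= -rnormE -eE ltcR rnormB.
  rewrite (le_lt_trans (geo_tail_le q01 hu Nn))//.
  apply: (@le_lt_trans _ _ (complex.Re e / 2)); last by lra.
  apply: le_trans hN; rewrite ler_wpM2l//.
    by rewrite mulr_ge0//; have := hu 0%N; rewrite expr0 mulr1; apply: le_trans; exact: rnorm_ge0.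
  by rewrite lerXn2r ?nnegrE ?invr_ge0.
exists (lim (S @ \oo)) => n; apply/ler_addgt0Pl => e e0.
have /cvgrPdist_lt /(_ e%:C%C) := cauchyS; rewrite ltcR => /(_ e0)[N _ hN].
have := hN (maxn N n) (leq_maxl _ _); rewrite -rnormE ltcR => h1.
have h2 := geo_tail_le q01 hu (leq_maxr N n).
by rewrite -(subrKA (S (maxn N n))) (le_trans (rnormD _ _))// lerD// ltW.
Qed.

Lemma triangular_sum (V : zmodType) (c : nat -> nat -> V) N :
  \sum_(j < N) \sum_(m < j.+1) c m (j - m)%N =
  \sum_(m < N) \sum_(l < N - m) c m l.
Proof.
elim: N => [|N ih]; first by rewrite !big_ord0.
rewrite big_ord_recr/= ih [RHS]big_ord_recr/= subSn// subnn big_ord1.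
rewrite big_ord_recr/= subnn addrA; congr (_ + _).
rewrite -big_split; apply: eq_bigr => m _.
by rewrite subSn ?(ltnW (ltn_ord m))// big_ord_recr.
Qed.

(** Summing by antidiagonals truncates the row [m] at [N - m], and the tail lost
    there has size [p^m q^(N - m) <= 4^(- N)]: the factor [N] from counting the
    rows is paid by replacing 4 by 2. *)
Lemma triangular_le (V : normedModType R[i]) (c : nat -> nat -> V) (s : nat -> V)
  (A p q : R) N : 0 <= p <= 4^-1 -> 0 <= q <= 4^-1 -> 0 <= A ->
  (forall m n, rnorm (s m - \sum_(l < n) c m l) <= A * p ^+ m * q ^+ n) ->
  rnorm (\sum_(m < N) s m - \sum_(j < N) \sum_(m < j.+1) c m (j - m)%N)
    <= A * (2^-1) ^+ N.
Proof.
move=> /andP[p0 p4] /andP[q0 q4] A0 h.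
rewrite triangular_sum -sumrB (le_trans (rnorm_sumI _ _ _))//.
apply: (@le_trans _ _ (\sum_(m < N) A * (4^-1) ^+ N)).
  apply: ler_sum => m _; rewrite (le_trans (h _ _))// -mulrA ler_wpM2l//.
  rewrite -[in leRHS](subnKC (ltnW (ltn_ord m))) exprD.
  by rewrite ler_pM ?exprn_ge0// lerXn2r ?nnegrE// invr_ge0.
rewrite -mulr_sumr sumr_const card_ord ler_wpM2l// -[leLHS]mulr_natl.
rewrite (_ : 4^-1 = 2^-1 * 2^-1 :> R); last by lra.
rewrite exprMn mulrA ler_piMl ?exprn_ge0 ?invr_ge0//.
rewrite exprVn ler_pdivrMr ?exprn_gt0// mul1r -natrX ler_nat.
exact/ltnW/ltn_expl.
Qed.

End geometric_series.

(** * The weights *)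

Section weights.
Context (R : realType) (k : \bar R).
Hypothesis k1 : (1 < k)%E.

Local Notation w := (exp_weight k).

Lemma exp_weight0 : w 0 = 1.
Proof. by case: k => [r||]//=; rewrite !mul0r powRr0. Qed.

(** After cancellation of common factors, [i^i m^m <= (i + m)^(i + m)]. *)
Lemma exp_weightM i m : w i * w m <= w (i + m)%N.
Proof.
case: k k1 => [r| |]//=; rewrite ?mul1r// lte_fin => r1.
have r0 : 0 < r by apply: lt_trans r1.
have re0 : 0 < r * expR 1 by rewrite mulr_gt0// expR_gt0.
have mono a b : (a <= b)%N -> (a%:R / (r * expR 1)) `^ (a%:R / r) <=
    (b%:R / (r * expR 1)) `^ (a%:R / r) :> R.
  move=> ab; apply: ge0_ler_powR; rewrite ?nnegrE ?divr_ge0// ?(ltW r0)// ?(ltW re0)//.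
  by rewrite ler_pM2r ?invr_gt0// ler_nat.
have [->|i0] := posnP i; first by rewrite !mul0r powRr0 mul1r add0n.
rewrite (_ : (i + m)%:R / r = i%:R / r + m%:R / r); last first.
  by rewrite natrD mulrDl.
rewrite powRD; last first.
  by apply/implyP => _; rewrite gt_eqF// divr_gt0// ltr0n addn_gt0 i0.
by rewrite ler_pM ?powR_ge0// mono// ?leq_addr ?leq_addl.
Qed.

(** As [n^n >= 1], the weight is at least [(k e)^(- n / k)]. *)
Lemma exp_weight_geo : exists2 c : R, 1 <= c & forall n, 1 <= w n * c ^+ n.
Proof.
case: k k1 => [r| |]//=; last by move=> _; exists 1 => // n; rewrite expr1n mulr1.
rewrite lte_fin => r1.
have r0 : 0 < r by apply: lt_trans r1.
have re0 : 0 < r * expR 1 by rewrite mulr_gt0// expR_gt0.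
have e1 : 1 <= expR 1 :> R by rewrite -[leLHS]expR0 ler_expR.
have re1 : 1 <= r * expR 1 by rewrite mulr_ege1// ltW.
exists (r * expR 1) => // n.
have [->|n0] := posnP n; first by rewrite !mul0r powRr0 mul1r.
have : ((r * expR 1)^-1) `^ (n%:R / r) <= (n%:R / (r * expR 1)) `^ (n%:R / r).
  apply: ge0_ler_powR; rewrite ?nnegrE ?divr_ge0 ?invr_ge0 ?(ltW r0) ?(ltW re0)//.
  by rewrite ler_peMl ?invr_ge0 ?(ltW re0)// ler1n.
move=> h; apply: le_trans (ler_wpM2r _ h); last by rewrite exprn_ge0// ltW.
rewrite -powR_inv1 ?(ltW re0)// -powRrM mulN1r powRN -powR_mulrn ?(ltW re0)//.
rewrite mulrC ler_pdivlMr ?powR_gt0// mul1r ler_powR//.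
by rewrite ler_pdivrMr// ler_peMr// ltW.
Qed.

Lemma natX_le_fact n : n%:R ^+ n <= n`!%:R * expR n%:R :> R.
Proof.
case: n => [|n]; first by rewrite expr0 expR0 fact0 mulr1.
have := expR_ge1Dxn n (ler0n R n.+1); set x := _ / _ => h.
have : x <= expR n.+1%:R by apply: le_trans h; rewrite lerDr.
by rewrite /x ler_pdivrMr ?ltr0n ?fact_gt0// mulrC.
Qed.

(** Since [n^n <= n! e^n], the weight multiplied by [n^(s n)] is at most
    [b^n n!], where [s = 1 - 1/k] is positive because [1 < k]; and [n^(s n)]
    outgrows [(b B)^n]. *)
Lemma exp_weight_fact (B : R) : 0 <= B ->
  exists C : R, forall n, w n * B ^+ n <= C * n`!%:R.
Proof.
move=> B0.
suff [C0 hC0] : exists C : R, forall n, (0 < n)%N -> w n * B ^+ n <= C * n`!%:R.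
  exists (Num.max 1 C0) => -[|n].
    by rewrite exp_weight0 !mulr1 le_max lexx.
  by rewrite (le_trans (hC0 _ _))// ler_wpM2r// le_max lexx orbT.
have [s [b [s0 b0 hb]]] : exists s b : R, [/\ 0 < s, 0 <= b &
    forall n, (0 < n)%N -> w n * n%:R `^ (s * n%:R) <= b ^+ n * n`!%:R].
  case: k k1 => [r| |]//=; last first.
    move=> _; exists 1, (expR 1); split; rewrite ?expR_ge0//.
    move=> n n0; rewrite !mul1r powR_mulrn// (le_trans (natX_le_fact n))//.
    by rewrite mulrC -expRM_natl mulr1.
  rewrite lte_fin => r1.
  have r0 : 0 < r by apply: lt_trans r1.
  have re0 : 0 < r * expR 1 by rewrite mulr_gt0// expR_gt0.
  exists (1 - r^-1), (expR 1); split; rewrite ?expR_ge0//.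
    by rewrite subr_gt0 invf_lt1.
  move=> n n0; have nR : 0 < n%:R :> R by rewrite ltr0n.
  apply: (@le_trans _ _ (n%:R `^ (n%:R / r) * n%:R `^ ((1 - r^-1) * n%:R))).
    rewrite ler_wpM2r ?powR_ge0// ge0_ler_powR ?nnegrE ?divr_ge0 ?(ltW r0) ?(ltW re0)//.
    rewrite ler_pdivrMr// ler_peMr//.
    by rewrite mulr_ege1 ?(ltW r1)// -[leLHS]expR0 ler_expR.
  rewrite -powRD; last by apply/implyP => _; rewrite gt_eqF.
  rewrite mulrBl mul1r mulrC addrC subrK powR_mulrn// (le_trans (natX_le_fact n))//.
  by rewrite mulrC -expRM_natl mulr1.
have [N hN] : exists N, forall n, (N <= n)%N -> b * B <= n%:R `^ s.
  pose x := (b * B) `^ s^-1; exists (Num.truncn x).+1 => n nN.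
  have xn : x <= n%:R.
    by rewrite (le_trans (ltW (truncnS_gt x)))// ler_nat.
  have sn0 : s != 0 by rewrite gt_eqF.
  rewrite -[leLHS]powRr1 ?mulr_ge0// -[X in _ `^ X <= _](mulVf sn0) powRrM.
  apply: ge0_ler_powR xn; [exact: ltW|exact: powR_ge0|exact: ler0n].
have [C hC] : exists C : R, forall n, (n < N)%N -> w n * B ^+ n <= C * n`!%:R.
  exists (\sum_(i < N) w i * B ^+ i) => n nN.
  rewrite (@le_trans _ _ (\sum_(i < N) w i * B ^+ i))//.
    rewrite (bigD1 (Ordinal nN))//= lerDl sumr_ge0// => i _.
    by rewrite mulr_ge0 ?exp_weight_ge0 ?exprn_ge0.
  rewrite ler_peMr ?ler1n ?fact_gt0// sumr_ge0// => i _.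
  by rewrite mulr_ge0 ?exp_weight_ge0 ?exprn_ge0.
exists (Num.max 1 C) => n n0; have [Nn|nN] := leqP N n; last first.
  by rewrite (le_trans (hC n nN))// ler_wpM2r// le_max lexx orbT.
rewrite (@le_trans _ _ n`!%:R)//; last by rewrite ler_peMl// le_max lexx.
have nR : 0 < n%:R :> R by rewrite ltr0n.
have hp : 0 < n%:R `^ (s * n%:R) :> R by rewrite powR_gt0.
rewrite -(ler_pM2r hp) mulrAC (le_trans (ler_wpM2r _ (hb n n0)))// ?exprn_ge0//.
rewrite mulrC mulrA [leRHS]mulrC ler_wpM2r// -exprMn mulrC powRrM powR_mulrn ?powR_ge0//.
by rewrite lerXn2r ?nnegrE ?powR_ge0 ?mulr_ge0// hN.
Qed.

End weights.

(** * Coefficient sequences *)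

Section series.
Context (R : realType).

(** One sum serves all geometric bounds at once; later the bounds of a fixed
    series are varied. *)
Lemma geo_sum (V : completeNormedModType R[i]) (u : nat -> V) :
  (exists A q : R, 0 <= q <= 2^-1 /\ forall n, rnorm (u n) <= A * q ^+ n) ->
  exists s, forall A q : R, 0 <= q <= 2^-1 ->
    (forall n, rnorm (u n) <= A * q ^+ n) ->
    forall n, rnorm (s - \sum_(i < n) u i) <= 2 * A * q ^+ n.
Proof.
move=> [A0 [q0 [q01 hu]]]; have [s hs] := geo_series q01 hu.
exists s => A q q1 hA n; apply/ler_addgt0Pl => e e0.
have [N nN hN] := @half_small R (2 * A0) e n e0.
rewrite -(subrKA (\sum_(i < N) u i)) (le_trans (rnormD _ _))// lerD ?geo_tail_le//.
rewrite (le_trans (hs N))// (le_trans _ hN)// ler_wpM2l//.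
  by rewrite mulr_ge0//; have := hu 0%N; rewrite expr0 mulr1; apply: le_trans; exact: rnorm_ge0.
by have /andP[? ?] := q01; rewrite lerXn2r ?nnegrE ?invr_ge0.
Qed.

End series.

Section exp_space_coefficients.
Context (R : realType) (E : normedModType R[i]) (Th : holomorphy_type E)
  (k : \bar R).
Hypothesis k1 : (1 < k)%E.

Local Notation w := (exp_weight k).
Local Notation V := (ht_space Th).
Local Notation val := (ht_val Th _).

(** The homogeneous components of a translate stay in the spaces [V m], by the
    second axiom of holomorphy types; the choice picks the element. *)
Definition shift_coef j m (a : E) (p : V j) : V m :=
  xget 0 [set q | val q = taylor_poly j (val p) a m].

Lemma ht_valB j (p q : V j) x : val (p - q) x = val p x - val q x.
Proof. by rewrite linearB. Qed.

Lemma ht_val_sum j I (r : seq I) (p : I -> V j) x :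
  val (\sum_(i <- r) p i) x = \sum_(i <- r) val (p i) x.
Proof. by rewrite linear_sum fct_sumE. Qed.

Lemma ht_valZ j (c : R[i]) (p : V j) x : val (c *: p) x = c * val p x :> R[i].
Proof. by rewrite linearZ. Qed.

Lemma shift_coef_ex : exists2 s : R, 1 <= s & forall j m a (p : V j), (m <= j)%N ->
  val (shift_coef m a p) = taylor_poly j (val p) a m /\
  rnorm (shift_coef m a p) <= s ^+ j * rnorm p * rnorm a ^+ (j - m).
Proof.
have [s s1 hs] := ht_sigma Th; exists s => // j m a p mj.
have [q qE qle] := hs m j a p mj.
have q'E : val ((m`!%:R)^-1 *: q) = taylor_poly j (val p) a m.
  apply/funext => x; rewrite ht_valZ qE (dhat_poly _ _ (ht_val_hpoly p)).
  by apply: mulKf; rewrite pnatr_eq0 -lt0n fact_gt0.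
have h : val (shift_coef m a p) = taylor_poly j (val p) a m.
  by rewrite /shift_coef; case: xgetP => // /(_ _ q'E).
split=> //; suff -> : shift_coef m a p = (m`!%:R)^-1 *: q by [].
by apply: (@ht_val_inj _ _ Th); rewrite h.
Qed.

(** A common value for the constant of the holomorphy type and the rate of decay
    of the weights. *)
Definition growth_const (c : R) := [/\ 1 <= c,
  forall j m a (p : V j), (m <= j)%N ->
    rnorm (shift_coef m a p) <= c ^+ j * rnorm p * rnorm a ^+ (j - m) &
  forall n, 1 <= w n * c ^+ n].

Definition growth : R := xget 1 growth_const.

Lemma growthP : growth_const growth.
Proof.
rewrite /growth; case: xgetP => [c -> //|].
have [s s1 hs] := shift_coef_ex; have [c c1 hc] := exp_weight_geo k1.
move=> /(_ (Num.max s c)); case; have s0 : 0 <= s by apply: le_trans s1.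
have c0 : 0 <= c by apply: le_trans c1.
split=> [|j m a p mj|n].
- by rewrite le_max s1.
- rewrite (le_trans (hs j m a p mj).2)// ler_wpM2r ?exprn_ge0 ?rnorm_ge0//.
  by rewrite ler_wpM2r ?rnorm_ge0// lerXn2r ?nnegrE ?le_max ?s0 ?lexx.
- rewrite (le_trans (hc n))// ler_wpM2l ?exp_weight_ge0//.
  by rewrite lerXn2r ?nnegrE ?le_max ?c0 ?lexx ?orbT.
Qed.

Local Notation c := growth.
Local Notation K := (growth ^+ 2).

Lemma growth_ge1 : 1 <= c. Proof. by have [] := growthP. Qed.
Lemma growth_ge0 : 0 <= c. Proof. exact: le_trans growth_ge1. Qed.
Lemma growth2_gt0 : 0 < K.
Proof. by rewrite exprn_gt0// (lt_le_trans _ growth_ge1). Qed.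

Lemma shift_coefE j m a (p : V j) : (m <= j)%N ->
  val (shift_coef m a p) = taylor_poly j (val p) a m.
Proof. by move=> mj; have [s _ h] := shift_coef_ex; have [] := h j m a p mj. Qed.

Lemma shift_coef_le j m a (p : V j) : (m <= j)%N ->
  rnorm (shift_coef m a p) <= c ^+ j * rnorm p * rnorm a ^+ (j - m).
Proof. by have [_ h _] := growthP; exact: h. Qed.

Lemma weight_growth n : 1 <= w n * c ^+ n.
Proof. by have [_ _ h] := growthP. Qed.

Lemma weight_gt0 n : 0 < w n.
Proof.
rewrite lt_def exp_weight_ge0 andbT; apply: contraTneq (weight_growth n) => ->.
by rewrite mul0r ler10.
Qed.

Lemma weight_le_addl m l : w m <= w (m + l)%N * c ^+ l.
Proof.
rewrite (@le_trans _ _ (w m * (w l * c ^+ l)))//.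
  by rewrite ler_peMr ?exp_weight_ge0// weight_growth.
by rewrite mulrA ler_wpM2r ?exprn_ge0 ?growth_ge0// exp_weightM.
Qed.

(** The axiom that bounds the components of a translate also bounds the values,
    since the component of degree 0 of the translate by [x] is the value at [x]. *)
Lemma val_le j (p : V j) x : rnorm (val p x : Cn R) <= c ^+ j * rnorm p * rnorm x ^+ j.
Proof.
have [q qE qn] := ht_space0 Th (val p x).
have := shift_coef_le x p (leq0n j); rewrite subn0; apply: le_trans.
suff -> : shift_coef 0 x p = q.
  by rewrite (_ : rnorm q = rnorm (val p x : Cn R))//; apply: (@complexI R); rewrite !rnormE qn.
apply: (@ht_val_inj _ _ Th); rewrite shift_coefE// qE; apply/funext => y.
have := poly_translate x 0 (ht_val_hpoly p); rewrite addr0 => ->.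
rewrite big_ord_recl big1 ?addr0 => [|i _].
  have := taylor_polyZ x 1 0 y (ht_val_hpoly p) (leq0n j).
  by rewrite scale1r scale0r expr1n expr0 !mul1r => ->.
have ij : (lift ord0 i <= j)%N by rewrite -ltnS ltn_ord.
have := taylor_polyZ x 1 0 0 (ht_val_hpoly p) ij.
by rewrite scale1r scale0r expr1n mul1r expr0n mul0r.
Qed.

(** The scalar field gets its completeness from the space of 0-homogeneous
    polynomials, to which it is isometric. *)
Lemma Cn_geo_sum (u : nat -> Cn R) :
  (exists A q : R, 0 <= q <= 2^-1 /\ forall n, rnorm (u n) <= A * q ^+ n) ->
  exists s : Cn R, forall A q : R, 0 <= q <= 2^-1 ->
    (forall n, rnorm (u n) <= A * q ^+ n) ->
    forall n, rnorm (s - \sum_(i < n) u i) <= 2 * A * q ^+ n.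
Proof.
pose v n : V 0 := s2val (cid2 (ht_space0 Th (u n))).
have vE n : ht_val Th 0 (v n) = (fun=> u n).
  by rewrite /v; case: cid2.
have nE (p : V 0) z : ht_val Th 0 p = (fun=> z) -> rnorm p = rnorm (z : Cn R).
  move=> pz; have [q qE qn] := ht_space0 Th z.
  have -> : p = q by apply: (@ht_val_inj _ _ Th); rewrite pz qE.
  by apply: (@complexI R); rewrite !rnormE qn.
have vn n : rnorm (v n) = rnorm (u n) by exact: nE.
move=> [A [q [q01 hu]]].
have [|s hs] := @geo_sum R (V 0) v.
  by exists A, q; split=> // n; rewrite vn.
have sc : ht_val Th 0 s = (fun=> ht_val Th 0 s 0).
  apply/funext => x; have := hpolyZ (ht_val_hpoly s) 0 x.
  by rewrite scale0r expr0 mul1r.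
exists (ht_val Th 0 s 0) => A' q' q1 hA n.
rewrite -(nE (s - \sum_(i < n) v i)).
  by apply: hs => // m; rewrite vn.
apply/funext => x; rewrite ht_valB ht_val_sum sc; congr (_ - _).
by apply: eq_bigr => i _; rewrite vE.
Qed.

(** Seminorms of supremum type, as a family equivalent to the norms: geometric
    bounds are stable under the operations below without loss of summability. *)
Definition seq_bound (p : forall n, V n) (e A : R) :=
  forall n, w n * rnorm (p n) <= A * e ^+ n.

Definition decays (p : forall n, V n) :=
  forall e : R, 0 < e -> exists A, seq_bound p e A.

Lemma seq_bound_ge0 p e A : seq_bound p e A -> 0 <= A.
Proof.
move=> /(_ 0%N); rewrite expr0 mulr1; apply: le_trans.
by rewrite mulr_ge0 ?rnorm_ge0 ?exp_weight_ge0.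
Qed.

Lemma seq_bound_norm p e A n : seq_bound p e A -> rnorm (p n) <= A * (c * e) ^+ n.
Proof.
move=> h; rewrite (@le_trans _ _ (w n * rnorm (p n) * c ^+ n))//.
  by rewrite mulrAC ler_peMl ?rnorm_ge0// weight_growth.
by rewrite exprMn mulrCA [leRHS]mulrC ler_wpM2r ?exprn_ge0 ?growth_ge0.
Qed.

Lemma seq_bound_val p e A n x : seq_bound p e A ->
  rnorm (val (p n) x : Cn R) <= A * (K * e * rnorm x) ^+ n.
Proof.
move=> h; rewrite (le_trans (val_le _ _))//.
rewrite (@le_trans _ _ (c ^+ n * (A * (c * e) ^+ n) * rnorm x ^+ n))//.
  by rewrite ler_wpM2r ?exprn_ge0 ?rnorm_ge0// ler_wpM2l ?exprn_ge0 ?growth_ge0// seq_bound_norm.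
by rewrite expr2 !exprMn le_eqVlt; apply/orP; left; apply/eqP; ring.
Qed.

(** The bound is again geometric in [m], and also in the order [l] of
    differentiation. One factor [growth] comes from the holomorphy type, and the
    other from passing from the weight of [m + l] to that of [m]. *)
Lemma seq_bound_shift p e A a l : 0 <= e -> seq_bound p e A ->
  seq_bound (fun m => shift_coef m a (p (m + l)%N)) (K * e) (A * (K * e * rnorm a) ^+ l).
Proof.
move=> e0 h m; have A0 := seq_bound_ge0 h.
have := shift_coef_le a (p (m + l)%N) (leq_addr l m); rewrite addKn => h1.
rewrite (le_trans (ler_pM (exp_weight_ge0 _ _) (rnorm_ge0 _) (weight_le_addl m l) h1))//.
have -> : w (m + l)%N * c ^+ l * (c ^+ (m + l) * rnorm (p (m + l)%N) * rnorm a ^+ l)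
  = (w (m + l)%N * rnorm (p (m + l)%N)) * (c ^+ l * c ^+ (m + l) * rnorm a ^+ l) by ring.
rewrite (le_trans (ler_wpM2r _ (h (m + l)%N)))//.
  by rewrite !mulr_ge0 ?exprn_ge0 ?growth_ge0 ?rnorm_ge0.
rewrite expr2 !exprMn !exprD.
have -> : A * (e ^+ m * e ^+ l) * (c ^+ l * (c ^+ m * c ^+ l) * rnorm a ^+ l) =
  (A * (e ^+ l * (c ^+ l * c ^+ l) * rnorm a ^+ l) * e ^+ m * c ^+ m) * 1 by ring.
have -> : A * (c ^+ l * c ^+ l * e ^+ l * rnorm a ^+ l) * (c ^+ m * c ^+ m * e ^+ m) =
  (A * (e ^+ l * (c ^+ l * c ^+ l) * rnorm a ^+ l) * e ^+ m * c ^+ m) * c ^+ m by ring.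
rewrite ler_wpM2l//; last by rewrite exprn_ege1// growth_ge1.
by rewrite !mulr_ge0 ?exprn_ge0 ?growth_ge0 ?rnorm_ge0.
Qed.

End exp_space_coefficients.

(** * Power series of homogeneous polynomials *)

Section power_series_in_Exp.
Context (R : realType) (E : normedModType R[i]) (Th : holomorphy_type E)
  (k : \bar R).
Hypothesis k1 : (1 < k)%E.

Local Notation w := (exp_weight k).
Local Notation V := (ht_space Th).
Local Notation val := (ht_val Th _).
Local Notation c := (growth Th k).
Local Notation K := (growth Th k ^+ 2).
Local Notation seq_bound := (@seq_bound R E Th k).
Local Notation decays := (@decays R E Th k).

(** Convergence is stated with explicit rates, from which local uniformity can be
    read off. *)
Definition sums_to (f : E -> Cn R) (p : forall n, V n) :=
  forall x (e A : R), 0 <= e -> seq_bound p e A -> K * e * rnorm x <= 2^-1 ->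
    forall n, rnorm (f x - \sum_(i < n) val (p i) x) <= 2 * A * (K * e * rnorm x) ^+ n.

(** [q] is the sequence of Taylor coefficients at [a] of the sum of [p]. *)
Definition shifts_to (a : E) (p q : forall n, V n) :=
  forall (e A : R), 0 <= e -> seq_bound p e A -> K * e * rnorm a <= 2^-1 ->
    forall m n, w m * rnorm (q m - \sum_(l < n) shift_coef m a (p (m + l)%N))
      <= 2 * A * (K * e) ^+ m * (K * e * rnorm a) ^+ n.

Lemma rate_ge0 e : 0 <= e -> 0 <= K * e.
Proof. by move=> e0; apply: mulr_ge0 => //; rewrite ltW// growth2_gt0. Qed.

Lemma rate_norm_ge0 e (U : normedModType R[i]) (x : U) : 0 <= e -> 0 <= K * e * rnorm x.
Proof. by move=> e0; apply: mulr_ge0; rewrite ?rate_ge0 ?rnorm_ge0. Qed.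

Lemma small_rate (e' d b : R) : 0 < e' -> 0 < d -> 0 <= b ->
  exists e : R, [/\ 0 < e, K * e <= e' & K * e * b <= d].
Proof.
move=> e'0 d0 b0; have K0 := growth2_gt0 Th k1.
have b1 : 0 < b + 1 by rewrite ltr_wpDl.
exists (Num.min (e' / K) (d / (b + 1) / K)); split.
- by rewrite lt_min !divr_gt0.
- by rewrite mulrC -ler_pdivlMr// ge_min lexx.
- rewrite (@le_trans _ _ (d / (b + 1) * b))//.
    by rewrite ler_wpM2r// mulrC -ler_pdivlMr// ge_min lexx orbT.
  by rewrite mulrAC ler_pdivrMr// ler_pM2l// lerDl.
Qed.

Lemma decays_sum p : decays p -> exists f, sums_to f p.
Proof.
move=> dp.
suff /choice[f hf] : forall x, exists s : Cn R, forall (e A : R), 0 <= e ->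
    seq_bound p e A -> K * e * rnorm x <= 2^-1 ->
    forall n, rnorm (s - \sum_(i < n) val (p i) x) <= 2 * A * (K * e * rnorm x) ^+ n.
  by exists f.
move=> x; have half0 : (0 : R) < 2^-1 by rewrite invr_gt0.
have K0 := ltW (growth2_gt0 Th k1).
have [s hs] : exists s : Cn R, forall A q : R, 0 <= q <= 2^-1 ->
    (forall n, rnorm (val (p n) x : Cn R) <= A * q ^+ n) ->
    forall n, rnorm (s - \sum_(i < n) val (p i) x) <= 2 * A * q ^+ n.
  apply: (@Cn_geo_sum _ _ Th).
  have [e [e0 _ ex]] := small_rate ltr01 half0 (rnorm_ge0 x).
  have [A hA] := dp e e0; exists A, (K * e * rnorm x); split.
    by rewrite ex rate_norm_ge0// ltW.
  by move=> n; apply: seq_bound_val.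
exists s => e A e0 hA ex; apply: hs; first by rewrite ex rate_norm_ge0.
by move=> n; apply: seq_bound_val.
Qed.

Lemma decays_shift a p : decays p -> exists q, shifts_to a p q.
Proof.
move=> dp; have half0 : (0 : R) < 2^-1 by rewrite invr_gt0.
have K0 := ltW (growth2_gt0 Th k1).
have sb m e A : 0 <= e -> seq_bound p e A -> forall l,
    rnorm (shift_coef m a (p (m + l)%N)) <= (A * (K * e) ^+ m / w m) * (K * e * rnorm a) ^+ l.
  move=> e0 hA l; rewrite mulrAC ler_pdivlMr ?(weight_gt0 Th k1)// mulrC mulrAC.
  exact: seq_bound_shift.
have H m : exists q : V m, forall A r : R, 0 <= r <= 2^-1 ->
    (forall l, rnorm (shift_coef m a (p (m + l)%N)) <= A * r ^+ l) ->
    forall n, rnorm (q - \sum_(l < n) shift_coef m a (p (m + l)%N)) <= 2 * A * r ^+ n.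
  apply: geo_sum; have [e [e0 _ ex]] := small_rate ltr01 half0 (rnorm_ge0 a).
  have [A hA] := dp e e0; exists (A * (K * e) ^+ m / w m), (K * e * rnorm a); split.
    by rewrite ex rate_norm_ge0// ltW.
  exact: sb (ltW e0) hA.
exists (fun m => sval (cid (H m))) => e A e0 hA ea m n.
case: cid => q hq /=; have := hq _ (K * e * rnorm a) _ (sb m e A e0 hA) n.
rewrite ea rate_norm_ge0// => /(_ isT) h.
rewrite mulrC -ler_pdivlMr ?(weight_gt0 Th k1)// (le_trans h)// le_eqVlt.
apply/orP; left; apply/eqP; ring.
Qed.

Lemma shifts_to_bound a p q e A : shifts_to a p q -> 0 <= e -> seq_bound p e A ->
  K * e * rnorm a <= 2^-1 -> seq_bound q (K * e) (2 * A).
Proof.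
move=> pq e0 hA ea m; have := pq e A e0 hA ea m 0%N.
by rewrite big_ord0 subr0 expr0 mulr1.
Qed.

Lemma shifts_to_decays a p q : shifts_to a p q -> decays p -> decays q.
Proof.
move=> pq dp e' e'0; have half0 : (0 : R) < 2^-1 by rewrite invr_gt0.
have [e [e0 ee' ea]] := small_rate e'0 half0 (rnorm_ge0 a).
have [A hA] := dp e e0; exists (2 * A) => n.
have K0 := ltW (growth2_gt0 Th k1).
rewrite (le_trans (shifts_to_bound pq (ltW e0) hA ea n))//.
rewrite ler_wpM2l ?mulr_ge0 ?(seq_bound_ge0 hA)//.
by rewrite lerXn2r ?nnegrE ?rate_ge0 ?(ltW e0)// ltW.
Qed.

(** Expanding each [p_j (a + y)] and summing the resulting triangular array by
    rows instead of antidiagonals gives the expansion at [a]. *)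
Lemma sums_to_shift f a p q : sums_to f p -> shifts_to a p q ->
  forall y (e A : R), 0 <= e -> seq_bound p e A -> K * e * rnorm a <= 4^-1 ->
    K * (K * e) * rnorm y <= 4^-1 -> K * e * rnorm (a + y) <= 2^-1 ->
  forall N, rnorm (f (a + y) - \sum_(m < N) val (q m) y) <= 4 * A * (2^-1) ^+ N.
Proof.
move=> fp pq y e A e0 hA ea ey eay N.
have K0 := ltW (growth2_gt0 Th k1); have A0 := seq_bound_ge0 hA.
have Ke0 : 0 <= K * e by rewrite rate_ge0.
pose d m l : Cn R := val (shift_coef m a (p (m + l)%N)) y.
have sumE : \sum_(j < N) val (p j) (a + y) = \sum_(j < N) \sum_(m < j.+1) d m (j - m)%N.
  apply: eq_bigr => j _; rewrite (poly_translate _ _ (ht_val_hpoly (p j))).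
  apply: eq_bigr => m _; have mj : (m <= j)%N by rewrite -ltnS.
  by rewrite -shift_coefE// /d subnKC.
have h1 : rnorm (f (a + y) - \sum_(j < N) val (p j) (a + y)) <= 2 * A * (2^-1) ^+ N.
  rewrite (le_trans (fp _ _ _ e0 hA eay N))// ler_wpM2l ?mulr_ge0//.
  by rewrite lerXn2r ?nnegrE ?rate_norm_ge0.
have h2 : rnorm (\sum_(m < N) val (q m) y - \sum_(j < N) val (p j) (a + y) : Cn R)
    <= 2 * A * (2^-1) ^+ N.
  rewrite sumE; apply: (@triangular_le _ (Cn R) d (fun m => val (q m) y)
    (2 * A) (K * (K * e) * rnorm y) (K * e * rnorm a)).
  - by rewrite ey rate_norm_ge0.
  - by rewrite ea rate_norm_ge0.
  - by rewrite mulr_ge0.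
  move=> m n; have ea2 : K * e * rnorm a <= 2^-1 by apply: (le_trans ea); lra.
  have -> : val (q m) y - \sum_(l < n) d m l =
      val (q m - \sum_(l < n) shift_coef m a (p (m + l)%N)) y.
    by rewrite ht_valB ht_val_sum.
  have hb : seq_bound (fun m => q m - \sum_(l < n) shift_coef m a (p (m + l)%N)) (K * e)
      (2 * A * (K * e * rnorm a) ^+ n).
    by move=> i; rewrite (le_trans (pq e A e0 hA ea2 i n))// mulrAC.
  by have := seq_bound_val k1 m y hb; rewrite mulrAC.
rewrite -(subrKA (\sum_(j < N) val (p j) (a + y))) (le_trans (rnormD _ _))//.
by rewrite [X in _ + X <= _]rnormB; move: h1 h2; lra.
Qed.

Lemma sums_to_taylor f a p q : sums_to f p -> shifts_to a p q -> decays p ->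
  is_taylor f a (fun m => val (q m)).
Proof.
move=> fp pq dp; split=> [m|]; first exact: ht_val_hpoly.
have K0 := growth2_gt0 Th k1.
have a1 : 0 <= rnorm a + 1 by rewrite addr_ge0 ?rnorm_ge0.
have q0 : (0 : R) < 4^-1 by rewrite invr_gt0.
have [e [e0 eK ea]] := small_rate (divr_gt0 q0 K0) q0 a1.
have [A hA] := dp e e0; have Ke0 : 0 <= K * e by rewrite rate_ge0// ltW.
exists 1 => //; apply/uniform_cvgP => r r0.
have r20 : 0 < r / 2 by rewrite divr_gt0.
have [N _ hN] := @half_small R (4 * A) (r / 2) 0 r20.
exists N => n Nn x; rewrite -ball_normE/= -rnormE ltcR rnormB => xa.
have xE : a + (x - a) = x by rewrite addrC subrK.
rewrite -{1}xE; apply: (@le_lt_trans _ _ (r / 2)); last by lra.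
apply: (le_trans (sums_to_shift fp pq (ltW e0) hA _ _ _ n)).
- by apply: le_trans ea; rewrite ler_wpM2l// lerDl.
- rewrite (@le_trans _ _ (4^-1 * rnorm (x - a)))//.
    by rewrite ler_wpM2r ?rnorm_ge0// mulrC -ler_pdivlMr.
  by rewrite ler_piMr ?ltW.
- rewrite xE; apply: (@le_trans _ _ 4^-1); last by lra.
  apply: le_trans ea; rewrite ler_wpM2l// -xE.
  by rewrite (le_trans (rnormD _ _))// lerD2l ltW.
rewrite (le_trans _ hN)// ler_wpM2l ?mulr_ge0 ?(seq_bound_ge0 hA)//.
by rewrite ler_wiXn2l ?invr_ge0// invf_le1 ?ler1n.
Qed.

Lemma sums_to_taylor0 f p : sums_to f p -> decays p ->
  is_taylor f 0 (fun m => val (p m)).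
Proof.
move=> fp dp; split=> [m|]; first exact: ht_val_hpoly.
have q0 : (0 : R) < 2^-1 by rewrite invr_gt0.
have [e [e0 _ ea]] := small_rate ltr01 q0 ler01.
have K0 := growth2_gt0 Th k1.
have [A hA] := dp e e0; have Ke0 : 0 <= K * e by rewrite rate_ge0// ltW.
exists 1 => //; apply/uniform_cvgP => r r0.
have r20 : 0 < r / 2 by rewrite divr_gt0.
have [N _ hN] := @half_small R (2 * A) (r / 2) 0 r20.
exists N => n Nn x; rewrite -ball_normE/= sub0r normrN -rnormE ltcR => x1.
under eq_bigr do rewrite subr0.
apply: (@le_lt_trans _ _ (r / 2)); last by lra.
have ex : K * e * rnorm x <= 2^-1.
  by apply: le_trans ea; rewrite ler_wpM2l// ltW.
rewrite (le_trans (fp x e A (ltW e0) hA ex n))// (le_trans _ hN)//.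
rewrite ler_wpM2l ?mulr_ge0 ?(seq_bound_ge0 hA)//.
apply: (@le_trans _ _ (2^-1 ^+ n)).
  by rewrite lerXn2r ?nnegrE ?rate_norm_ge0 ?(ltW e0).
by rewrite ler_wiXn2l ?invr_ge0// invf_le1 ?ler1n.
Qed.

Lemma sums_to_entire f p : sums_to f p -> decays p -> entire f.
Proof.
move=> fp dp a; have [q pq] := decays_shift a dp.
by exists (fun m => val (q m)); exact: sums_to_taylor pq dp.
Qed.

Definition taylor_coef (f : E -> Cn R) n : V n :=
  xget 0 [set p | val p = (n`!%:R)^-1 *: dhat n f 0].

Lemma exp_coefE f n : exp_coef Th f n = rnorm (taylor_coef f n).
Proof. by []. Qed.

Lemma taylor_coef_uniq f p : is_taylor f 0 (fun n => val (p n)) ->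
  forall n, taylor_coef f n = p n.
Proof.
move=> fp n; have e : val (p n) = (n`!%:R)^-1 *: dhat n f 0.
  rewrite (dhatE _ fp); apply/funext => x; apply/esym.
  by apply: mulKf; rewrite pnatr_eq0 -lt0n fact_gt0.
apply: (@ht_val_inj _ _ Th); rewrite e /taylor_coef.
by case: xgetP => // /(_ _ e).
Qed.

Lemma taylor_coefP f : entire f -> (forall n, ht_poly Th n (dhat n f 0)) ->
  is_taylor f 0 (fun n => val (taylor_coef f n)).
Proof.
move=> ef pf; have [P fP] := ef 0; suff -> : (fun n => val (taylor_coef f n)) = P by [].
apply/funext => n; have [p _ pE] := pf n.
have e : val ((n`!%:R)^-1 *: p) = (n`!%:R)^-1 *: dhat n f 0.
  by rewrite linearZ/= pE.
have -> : val (taylor_coef f n) = (n`!%:R)^-1 *: dhat n f 0.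
  by rewrite /taylor_coef; case: xgetP => // /(_ _ e).
rewrite (dhatE _ fP); apply/funext => x.
by apply: mulKf; rewrite pnatr_eq0 -lt0n fact_gt0.
Qed.

Let term f (rho : R) n := rho ^- n * w n * exp_coef Th f n.

Let term_ge0 f rho n : 0 < rho -> 0 <= term f rho n.
Proof.
move=> r0; rewrite /term !mulr_ge0 ?exp_weight_ge0 ?exp_coef_ge0//.
by rewrite invr_ge0 exprn_ge0// ltW.
Qed.

Lemma exp_norm_le f (rho A : R) : 0 < rho ->
  seq_bound (taylor_coef f) (rho / 2) A -> (exp_norm Th k rho f <= (2 * A)%:E)%E.
Proof.
move=> r0 fA; rewrite /exp_norm; apply: lime_le.
  by apply: is_cvg_nneseries => n _ _; rewrite lee_fin term_ge0.
near=> N; rewrite sumEFin lee_fin big_mkord.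
apply: (@le_trans _ _ (\sum_(i < N) A * (2^-1) ^+ i)).
  apply: ler_sum => i _; rewrite exp_coefE -[leLHS]mulrA [leLHS]mulrC.
  rewrite ler_pdivrMr ?exprn_gt0// (le_trans (fA i))// expr_div_n exprVn le_eqVlt.
  by apply/orP; left; apply/eqP; ring.
rewrite -mulr_sumr mulrC ler_wpM2r ?(seq_bound_ge0 fA)// geo_sum_le//.
by rewrite invr_ge0 lexx andbT.
Unshelve. all: by end_near. Qed.

Lemma exp_norm_bound f (rho A : R) : 0 < rho ->
  (exp_norm Th k rho f <= A%:E)%E -> seq_bound (taylor_coef f) rho A.
Proof.
move=> r0 fA n; have : ((term f rho n)%:E <= A%:E)%E.
  apply: le_trans fA; rewrite /exp_norm.
  apply: le_trans (nneseries_lim_ge n.+1 _); last first.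
    by move=> i _ _; rewrite lee_fin term_ge0.
  rewrite sumEFin lee_fin big_nat_recr//= lerDr sumr_ge0// => i _.
  exact: term_ge0.
rewrite lee_fin /term -mulrA mulrC ler_pdivrMr ?exprn_gt0//.
Qed.

(** For [k = +oo] the condition on [n]-th roots holds because a constant factor
    is absorbed by halving the rate. *)
Lemma decays_Exp f p : sums_to f p -> decays p -> Exp Th k f.
Proof.
move=> fp dp; have fT := sums_to_taylor0 fp dp.
have cE := taylor_coef_uniq fT.
split; first exact: sums_to_entire dp.
  by move=> n; exists (n`!%:R *: p n) => //; rewrite linearZ/= (dhatE _ fT).
have [kE|_] := eqVneq k +oo%E; last first.
  move=> rho r0; have [A hA] := dp (rho / 2) ltac:(by rewrite divr_gt0).
  by apply: (@le_lt_trans _ _ (2 * A)%:E); rewrite ?ltry// exp_norm_le// => n; rewrite cE.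
apply/cvgrPdist_le => e e0; have e20 : 0 < e / 2 by rewrite divr_gt0.
have [A hA] := dp (e / 2) e20.
have [N _ hN] := @half_small R A 1 0 ltr01.
near=> j; rewrite sub0r normrN ger0_norm ?powR_ge0//.
have j0 : j%:R != 0 :> R by rewrite pnatr_eq0 -lt0n; near: j; exists 1%N.
have Nj : (N <= j)%N by near: j; exists N.
have cj : exp_coef Th f j <= e ^+ j.
  have := hA j; rewrite exp_coefE cE kE mul1r => /le_trans; apply.
  rewrite expr_div_n mulrCA ler_piMr ?exprn_ge0 ?(ltW e0)// -exprVn.
  rewrite (le_trans _ hN)// ler_wpM2l ?(seq_bound_ge0 hA)//.
  by rewrite ler_wiXn2l ?invr_ge0// invf_le1 ?ler1n.
have -> : e = (e ^+ j) `^ j%:R^-1.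
  by rewrite -powR_mulrn ?(ltW e0)// -powRrM mulfV// powRr1// ltW.
by apply: ge0_ler_powR; rewrite ?nnegrE ?invr_ge0 ?exp_coef_ge0 ?exprn_ge0// ltW.
Unshelve. all: by end_near. Qed.

Lemma Exp_decays f : Exp Th k f -> decays (taylor_coef f).
Proof.
move=> [_ _ nf] e e0.
have [kE|kE] := eqVneq k +oo%E; last first.
  move: nf; rewrite (negbTE kE) => /(_ e e0) nf.
  exists (fine (exp_norm Th k e f)); apply: exp_norm_bound => //.
  rewrite fineK// ge0_fin_numE//; apply: nneseries_ge0 => n _ _.
  by rewrite lee_fin term_ge0.
move: nf; rewrite kE eqxx => /cvgrPdist_lt/(_ e e0)[N _ hN].
exists (1 + \sum_(i < N.+1) exp_coef Th f i * e ^- i) => n.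
have s0 (i : nat) : 0 <= exp_coef Th f i * e ^- i.
  by rewrite mulr_ge0 ?exp_coef_ge0// invr_ge0 exprn_ge0// ltW.
rewrite mul1r -exp_coefE -ler_pdivrMr ?exprn_gt0//.
have [nN|Nn] := leqP n N.
  have h : (n < N.+1)%N by [].
  by rewrite (bigD1 (Ordinal h))//= addrCA lerDl addr_ge0// sumr_ge0.
apply: (@le_trans _ _ 1); last by rewrite lerDl sumr_ge0.
rewrite ler_pdivrMr ?exprn_gt0// mul1r.
have := hN n (ltnW Nn); rewrite sub0r normrN ger0_norm ?powR_ge0// => /ltW h.
have n0 : n%:R != 0 :> R by rewrite pnatr_eq0 -lt0n (leq_ltn_trans _ Nn).
rewrite -powR_mulrn ?(ltW e0)// -[leLHS]powRr1 ?exp_coef_ge0// -[X in _ `^ X <= _](mulVf n0) powRrM.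
by apply: ge0_ler_powR; rewrite ?nnegrE ?powR_ge0// ltW.
Qed.

End power_series_in_Exp.

(** * The identity theorem *)

Section identity_theorem.
Context (R : realType) (E : normedModType R[i]).

Lemma is_taylor_line (h : E -> Cn R) b Q (x : E) : is_taylor h b Q ->
  exists2 d : R, 0 < d & forall s : R, `|s| < d -> forall e : R, 0 < e ->
    exists N, forall n, (N <= n)%N ->
      cnorm (h (b + s%:C%C *: x) - \sum_(m < n) s%:C%C ^+ m * Q m x) < e.
Proof.
move=> [hQ [r r0 /uniform_cvgP hr]].
have x0 : 0 < rnorm x + 1 by rewrite ltr_wpDl ?rnorm_ge0.
exists (r / (rnorm x + 1)); first by rewrite divr_gt0.
move=> s sr e e0; have [N hN] := hr e e0; exists N => n Nn.
have bx : ball b r%:C%C (b + s%:C%C *: x).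
  rewrite -ball_normE/= opprD addrA subrr sub0r normrN -rnormE ltcR.
  rewrite rnorm_scale cnorm_real; apply: (@le_lt_trans _ _ (`|s| * (rnorm x + 1))).
    by rewrite ler_wpM2l// lerDl.
  by rewrite -ltr_pdivlMr.
have := hN n Nn _ bx; rewrite addrAC subrr add0r.
by under eq_bigr => i _ do rewrite (hpolyZ (hQ i)).
Qed.

Lemma cnorm_lt_all (z : R[i]) : (forall e : R, 0 < e -> cnorm z < e) -> z = 0.
Proof.
move=> h; apply/eqP; rewrite -cnorm_eq0 eq_le cnorm_ge0 andbT.
by apply/ler_addgt0Pl => e e0; rewrite addr0 ltW// h.
Qed.

(** For [t > 0] the Taylor coefficients at [t x] along the line are determined by
    the values at parameters slightly less than [t], hence vanish; for [t = 0]
    the expansion is the given one. *)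
Lemma line_vanish (h : E -> Cn R) (x : E) (t : R) : entire h ->
  is_taylor h 0 (fun=> 0) -> 0 <= t ->
  (forall s : R, 0 <= s < t -> h (s%:C%C *: x) = 0) ->
  exists2 d : R, 0 < d & forall s : R, `|s| < d -> h ((t + s)%:C%C *: x) = 0.
Proof.
move=> eh h0 t0 ht.
have [Q hQ] := eh (t%:C%C *: x).
have [d d0 hd] := is_taylor_line x hQ.
suff Q0 m : Q m x = 0.
  exists d => // s sd; apply: cnorm_lt_all => e e0.
  have [N hN] := hd s sd e e0; have := hN N (leqnn N).
  rewrite big1 ?subr0; last by move=> m _; rewrite Q0 mulr0.
  by rewrite -scalerDl -rmorphD.
have [te|tn] := eqVneq t 0.
  rewrite te scale0r in hQ.
  by rewrite (is_taylor_uniq hQ h0).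
have tp : 0 < t by rewrite lt_def tn.
suff /eqP : (-1) ^+ m * Q m x = 0 :> R[i].
  by rewrite mulf_eq0 signr_eq0 /= => /eqP.
pose t1 := Num.min t (d / 2).
have t10 : 0 < t1 by rewrite lt_min tp divr_gt0.
apply: (@power_series_eq0 _ t1 (fun m => (-1) ^+ m * Q m x) t10 _ m) => s /andP[s0 st] e e0.
have sd : `|- s| < d.
  rewrite normrN gtr0_norm// (le_lt_trans st)// (@le_lt_trans _ _ (d / 2))//.
    by rewrite /t1 ge_min lexx orbT.
  by rewrite ltr_pdivrMr// ltr_pMr// ltr1n.
have [N hN] := hd (- s) sd e e0; exists N => n Nn; have := hN n Nn.
have -> : t%:C%C *: x + (- s)%:C%C *: x = (t - s)%:C%C *: x.
  by rewrite -scalerDl -rmorphD.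
rewrite ht; last by rewrite subr_ge0 (le_trans st) ?ge_min ?lexx//= ltrBlDr ltrDl.
rewrite sub0r cnormN => /ltW; congr (_ <= _); congr rnorm.
apply: eq_bigr => i _.
have -> : (- s)%:C%C ^+ i = (-1) ^+ i * s%:C%C ^+ i :> R[i] by rewrite rmorphN [in LHS]exprNn.
exact: mulrAC.
Qed.

(** The supremum of the parameters up to which the difference vanishes, on the
    segment from 0 to [x], can be increased unless it is 1. *)
Lemma entire_ext (f g : E -> Cn R) P : entire f -> entire g ->
  is_taylor f 0 P -> is_taylor g 0 P -> f = g.
Proof.
move=> ef eg fP gP; pose h : E -> Cn R := (-1 : R[i]) *: f + g.
have eh : entire h by exact: entireD.
have h0 : is_taylor h 0 (fun=> 0).
  have := is_taylorD (-1) fP gP.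
  rewrite (_ : (fun m : nat => -1 *: P m + P m) = fun=> 0)//.
  by apply/funext => m; rewrite scaleN1r addNr.
suff hx x : h x = 0.
  apply/funext => x; have := hx x; rewrite /h.
  rewrite -[LHS]/((-1) * f x + g x) mulN1r addrC => /eqP.
  by rewrite subr_eq0 => /eqP.
pose Z : set R := [set t | 0 <= t <= 1 /\ forall s : R, 0 <= s <= t -> h (s%:C%C *: x) = 0].
have Z0 : Z 0.
  split=> [|s s0]; first by rewrite lexx ler01.
  have -> : s = 0 by apply/eqP; rewrite eq_le andbC.
  have L0 (u : R) : 0 <= u < 0 -> h (u%:C%C *: x) = 0 by case/andP => u0 /(le_lt_trans u0); rewrite ltxx.
  have [d d0 hd] := line_vanish eh h0 (lexx 0) L0.
  by have := hd 0; rewrite normr0 addr0; exact.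
have Zs : has_sup Z by split; [exists 0|exists 1 => t [/andP[]]].
pose t := sup Z.
have t0 : 0 <= t by apply: ub_le_sup Z0; have [] := Zs.
have t1 : t <= 1 by apply: ge_sup; [exists 0|move=> s [/andP[]]].
have ht (s : R) : 0 <= s < t -> h (s%:C%C *: x) = 0.
  move=> /andP[s0 st]; have st0 : 0 < t - s by rewrite subr_gt0.
  have [u [_ hu]] := sup_adherent st0 Zs; rewrite -/t => su.
  by apply: hu; rewrite s0 ltW//; move: su; rewrite opprB addrCA subrr addr0.
have [d d0 hd] := line_vanish eh h0 t0 ht.
have ht' (s : R) : 0 <= s < t + d -> h (s%:C%C *: x) = 0.
  move=> /andP[s0 sd]; have [st|ts] := ltP s t; first by rewrite ht// s0.
  have := hd (s - t); rewrite addrCA subrr addr0; apply.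
  by rewrite ger0_norm ?subr_ge0// ltrBlDl.
suff t1' : 1 <= t by have := ht' 1; rewrite scale1r; apply; rewrite ler01/=; lra.
rewrite leNgt; apply/negP => tl1.
pose u := Num.min 1 (t + d / 2).
have tu : t < u by rewrite lt_min tl1 ltrDl divr_gt0.
have : Z u.
  split; first by rewrite (le_trans t0 (ltW tu)) ge_min lexx.
  move=> s /andP[s0 su]; apply: ht'; rewrite s0 (le_lt_trans su)// gt_min ltrD2l.
  by rewrite ltr_pdivrMr// ltr_pMr// ltr1n orbT.
by have [_ /ub_le_sup] := Zs; move=> /[apply]; rewrite -/t leNgt tu.
Qed.

(** The difference of the two expansions is a power series that vanishes for
    small positive [t]. *)
Lemma is_taylor_series (h : E -> Cn R) b Q (a : E) (c : nat -> R[i]) :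
  is_taylor h b Q -> entire_series (fun t => h (b + t *: a)) c ->
  forall m, Q m a = c m.
Proof.
move=> hQ hc m; have [d d0 hd] := is_taylor_line a hQ.
suff : Q m a - c m = 0 by move/eqP; rewrite subr_eq0 => /eqP.
have d20 : 0 < d / 2 by rewrite divr_gt0.
apply: (@power_series_eq0 _ (d / 2) (fun m => Q m a - c m) d20 _ m) => s /andP[s0 st] e e0.
have sd : `|s| < d by rewrite gtr0_norm//; lra.
have e20 : 0 < e / 2 by rewrite divr_gt0.
have [N1 hN1] := hd s sd (e / 2) e20.
have [C hC] := entire_series_half hc d20.
have [N2 _ hN2] := @half_small R C (e / 2) 0 e20.
exists (maxn N1 N2) => n; rewrite geq_max => /andP[n1 n2].
have h1 := hN1 n n1; have := hC n s%:C%C; rewrite cnorm_real gtr0_norm// => /(_ st) h2.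
have h3 : C * 2^-1 ^+ n <= e / 2.
  have [C0|C0] := leP 0 C; last first.
    by rewrite (@le_trans _ _ 0) ?(ltW e20)// nmulr_rle0// exprn_ge0// invr_ge0.
  rewrite (le_trans _ hN2)// ler_wpM2l//.
  by rewrite ler_wiXn2l ?invr_ge0// invf_le1 ?ler1n.
have -> : \sum_(i < n) (Q i a - c i) * s%:C%C ^+ i =
   (h (b + s%:C%C *: a) - \sum_(j < n) s%:C%C ^+ j * c j) -
   (h (b + s%:C%C *: a) - \sum_(j < n) s%:C%C ^+ j * Q j a) :> R[i].
  rewrite opprB addrC subrKA -sumrB; apply: eq_bigr => i _.
  by rewrite mulrBl; congr (_ - _); exact: mulrC.
rewrite -cnormE (le_trans (cnormD _ _))// cnormN.
by move: h1 h2 h3; lra.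
Qed.

End identity_theorem.

(** * Seminorms, translations and directional derivatives *)

Section exp_space_theory.
Context (R : realType) (E : normedModType R[i]) (Th : holomorphy_type E)
  (k : \bar R).
Hypothesis k1 : (1 < k)%E.

Local Notation w := (exp_weight k).
Local Notation V := (ht_space Th).
Local Notation val := (ht_val Th _).
Local Notation c := (growth Th k).
Local Notation K := (growth Th k ^+ 2).
Local Notation X := (exp_space Th k).
Implicit Types (f g : X).

Lemma exp_funD f g x : (f + g) x = f x + g x.
Proof. by []. Qed.

Lemma exp_funZ (a : R[i]) f x : (a *: f) x = a * f x :> R[i].
Proof. by []. Qed.

Lemma exp_funN f x : (- f) x = - f x.
Proof. by []. Qed.

Lemma exp_fun_inj f g : (forall x, f x = g x) -> f = g.
Proof. by move=> fg; apply/val_inj/funext. Qed.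

Definition tcoef f n : V n := taylor_coef Th f n.

Definition bnd f (e A : R) := seq_bound k (tcoef f) e A.

Lemma exp_taylor f : is_taylor f 0 (fun n => val (tcoef f n)).
Proof. by have /set_mem[ef pf _] := exp_funP f; exact: taylor_coefP. Qed.

Lemma exp_entire f : entire f.
Proof. by have /set_mem[] := exp_funP f. Qed.

Lemma tcoef_decays f : decays k (tcoef f).
Proof. by have /set_mem := exp_funP f; exact: Exp_decays. Qed.

Lemma tcoef_uniq f p : is_taylor f 0 (fun n => val (p n)) -> forall n, tcoef f n = p n.
Proof. exact: taylor_coef_uniq. Qed.

Lemma tcoef_inj f g : (forall n, tcoef f n = tcoef g n) -> f = g.
Proof.
move=> fg; apply/val_inj; apply: (entire_ext (exp_entire f) (exp_entire g) (exp_taylor f)).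
have -> : (fun n => val (tcoef f n)) = (fun n => val (tcoef g n)).
  by apply/funext => n; rewrite fg.
exact: exp_taylor.
Qed.

Lemma exp_of_coef (p : forall n, V n) : decays k p ->
  exists f : X, forall n, tcoef f n = p n.
Proof.
move=> dp; have [f fp] := decays_sum k1 dp.
have fX : f \in Exp Th k by apply/mem_set; exact: (decays_Exp k1 fp dp).
by exists (ExpSpace fX); apply: tcoef_uniq; exact: (sums_to_taylor0 k1 fp dp).
Qed.

Lemma exp_sums f : sums_to k f (tcoef f).
Proof.
have [h hp] := decays_sum k1 (@tcoef_decays f).
have hT := sums_to_taylor0 k1 hp (@tcoef_decays f).
have hE := sums_to_entire k1 hp (@tcoef_decays f).
by rewrite (entire_ext (exp_entire f) hE (exp_taylor f) hT).
Qed.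

Lemma tcoefD f g n : tcoef (f + g) n = tcoef f n + tcoef g n.
Proof.
apply: (@tcoef_uniq _ (fun n => tcoef f n + tcoef g n)).
have := is_taylorD 1 (exp_taylor f) (exp_taylor g); rewrite scale1r.
suff -> : (fun m => 1 *: val (tcoef f m) + val (tcoef g m)) =
  (fun n => val (tcoef f n + tcoef g n)) by [].
by apply/funext => m; rewrite scale1r linearD.
Qed.

Lemma tcoefZ (a : R[i]) f n : tcoef (a *: f) n = a *: tcoef f n.
Proof.
apply: (@tcoef_uniq _ (fun n => a *: tcoef f n)).
have := is_taylorD a (exp_taylor f) (@is_taylor0 _ _ _); rewrite addr0.
suff -> : (fun m => a *: val (tcoef f m) + 0) = (fun n => val (a *: tcoef f n)) by [].
by apply/funext => m; rewrite linearZ/= addr0.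
Qed.

Lemma tcoefN f n : tcoef (- f) n = - tcoef f n.
Proof. by rewrite -scaleN1r tcoefZ scaleN1r. Qed.

Lemma tcoef0 n : tcoef 0 n = 0.
Proof. by rewrite -[0 in LHS](scale0r 0) tcoefZ scale0r. Qed.

Lemma tcoef_sum I (r : seq I) (f : I -> X) n :
  tcoef (\sum_(j <- r) f j) n = \sum_(j <- r) tcoef (f j) n.
Proof. by apply: (big_morph (fun f => tcoef f n)) => [f' g'|]; rewrite ?tcoefD ?tcoef0. Qed.

Lemma bnd_ge0 f e A : bnd f e A -> 0 <= A.
Proof. exact: seq_bound_ge0. Qed.

Lemma bnd_ex f e : 0 < e -> exists A, bnd f e A.
Proof. exact: tcoef_decays. Qed.

Lemma bnd0 e A : 0 <= e -> 0 <= A -> bnd 0 e A.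
Proof. by move=> e0 A0 n; rewrite tcoef0 rnorm0 mulr0 mulr_ge0 ?exprn_ge0. Qed.

Lemma bndD f g e A B : bnd f e A -> bnd g e B -> bnd (f + g) e (A + B).
Proof.
move=> hf hg n; rewrite tcoefD mulrDl (le_trans _ (lerD (hf n) (hg n)))//.
by rewrite -mulrDr ler_wpM2l ?exp_weight_ge0// rnormD.
Qed.

Lemma bndZ (a : R[i]) f e A : bnd f e A -> bnd (a *: f) e (cnorm a * A).
Proof.
by move=> hf n; rewrite tcoefZ rnorm_scale mulrCA -mulrA ler_wpM2l ?cnorm_ge0.
Qed.

Lemma bndN f e A : bnd f e A -> bnd (- f) e A.
Proof. by move=> hf n; rewrite tcoefN rnormN. Qed.

Lemma bnd_le f e e' A A' : bnd f e A -> 0 <= e <= e' -> A <= A' -> bnd f e' A'.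
Proof.
move=> hf /andP[e0 ee'] AA' n; rewrite (le_trans (hf n))//.
rewrite ler_pM ?exprn_ge0 ?(bnd_ge0 hf)//.
by rewrite lerXn2r ?nnegrE// (le_trans e0).
Qed.

(** The form in which continuity of functionals is used, for evaluations as well
    as for the given functional. *)
Definition bounded (T : X -> Cn R) := exists C e : R,
  0 < e /\ forall f A, bnd f e A -> cnorm (T f) <= C * A.

Lemma eval_bounded (x : E) : bounded (fun f => f x).
Proof.
have h : (0 : R) < 2^-1 by rewrite invr_gt0.
have [e [e0 _ ex]] := small_rate Th k1 ltr01 h (rnorm_ge0 x).
exists 2, e; split=> // f A fA.
have := exp_sums (ltW e0) fA ex 0%N.
by rewrite big_ord0 subr0 expr0 mulr1.
Qed.

(** The version of [entire_series] for values in the space, one seminorm at a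
    time. *)
Definition expansion (F : R[i] -> X) (D : nat -> X) := forall e r : R, 0 < e -> 0 < r ->
  exists C : R, forall J t, cnorm t <= r ->
    bnd (F t - \sum_(j < J) t ^+ j *: D j) e (C * (cnorm t / r) ^+ J).

Lemma expansion_apply (T : {linear X -> Cn R}) F D : bounded T -> expansion F D ->
  entire_series (fun t => T (F t)) (fun j => T (D j)).
Proof.
move=> [C [e [e0 hT]]] FD r r0; have [B hB] := FD e r e0 r0.
exists (C * B) => J t tr; have := hT _ _ (hB J t tr).
rewrite linearB linear_sum mulrA; apply: le_trans.
rewrite le_eqVlt; apply/orP; left; apply/eqP; congr (cnorm (_ - _)).
by apply: eq_bigr => j _; rewrite linearZ.
Qed.

Lemma eval_linear x : linear (fun f : X => f x : Cn R).
Proof. by []. Qed.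

Lemma expansion_eval x F D : expansion F D ->
  entire_series (fun t => F t x) (fun j => D j x).
Proof.
move=> FD; pose ev := GRing.isLinear.Build _ _ _ _ _ (eval_linear x).
exact: (@expansion_apply (HB.pack (fun f : X => f x : Cn R) ev) F D (eval_bounded x) FD).
Qed.

Definition shift (a : E) f : X := xget 0 [set g | exp_fun g = translate a f].

(** The derivative of order [l] in the direction [a], divided by [l!], is defined
    through its Taylor coefficients, which shows at once that it belongs to the
    space. *)
Definition dir_deriv (l : nat) (a : E) f : X :=
  xget 0 [set g | forall m, tcoef g m = shift_coef m a (tcoef f (m + l)%N)].

Lemma dir_derivE l a f m : tcoef (dir_deriv l a f) m = shift_coef m a (tcoef f (m + l)%N).
Proof.
suff [g hg] : exists g : X, forall m, tcoef g m = shift_coef m a (tcoef f (m + l)%N).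
  by rewrite /dir_deriv; case: xgetP => [h _ ->//|/(_ g)].
apply: exp_of_coef => e' e'0.
have [e [e0 ee' _]] := small_rate Th k1 e'0 ltr01 (rnorm_ge0 a).
have [A fA] := bnd_ex f e0; have h := seq_bound_shift k1 a l (ltW e0) fA.
exists (A * (K * e * rnorm a) ^+ l) => n; rewrite (le_trans (h n))//.
rewrite ler_wpM2l ?(seq_bound_ge0 h)// lerXn2r ?nnegrE ?(ltW e'0)//.
exact: (rate_ge0 Th k1 (ltW e0)).
Qed.

Lemma is_taylor_translate (h : E -> Cn R) (a b : E) Q : is_taylor h (b + a) Q ->
  is_taylor (translate a h) b Q.
Proof.
move=> [hQ [r r0 /uniform_cvgP hr]]; split=> //; exists r => //.
apply/uniform_cvgP => e e0; have [N hN] := hr e e0; exists N => n Nn x bx.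
have := hN n Nn (x + a); rewrite opprD addrACA subrr addr0; apply.
by move: bx; rewrite -!ball_normE/= opprD addrACA subrr addr0.
Qed.

(** The translate and the sum of the translated series have the same Taylor
    coefficients at 0, so they agree by the identity theorem. *)
Lemma shift_ex a f : exists g : X, exp_fun g = translate a f /\
  shifts_to k a (tcoef f) (tcoef g).
Proof.
have [q fq] := decays_shift k1 a (@tcoef_decays f).
have [g gq] := exp_of_coef (shifts_to_decays k1 fq (@tcoef_decays f)).
have eg : exp_fun g = translate a f.
  apply: (entire_ext (exp_entire g) _ (exp_taylor g)).
    move=> b; have [Q hQ] := exp_entire f (b + a).
    by exists Q; exact: is_taylor_translate.
  apply: is_taylor_translate; rewrite add0r.
  have -> : (fun n => val (tcoef g n)) = (fun n => val (q n)).
    by apply/funext => n; rewrite gq.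
  exact: (sums_to_taylor k1 (@exp_sums f) fq (@tcoef_decays f)).
exists g; split=> //; have -> // : tcoef g = q :> (forall n, V n).
by apply: functional_extensionality_dep => n; exact: gq.
Qed.

Lemma shiftE a f : exp_fun (shift a f) = translate a f.
Proof.
have [g [gE _]] := shift_ex a f.
by rewrite /shift; case: xgetP => [h _ ->//|/(_ g)].
Qed.

Lemma shift_shifts a f : shifts_to k a (tcoef f) (tcoef (shift a f)).
Proof.
have [g [gE fg]] := shift_ex a f; suff -> : shift a f = g by [].
by apply/val_inj; rewrite /= shiftE gE.
Qed.

Lemma shift_val a f x : shift a f x = f (x + a).
Proof. by rewrite shiftE. Qed.

Lemma shift_linear a : linear (shift a).
Proof.
move=> b f g; apply: exp_fun_inj => x.
by rewrite exp_funD !shift_val exp_funD [in RHS](exp_funZ b) shift_val.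
Qed.

Lemma shift_shift a b f : shift a (shift b f) = shift (a + b) f.
Proof. by apply: exp_fun_inj => x; rewrite !shift_val addrA. Qed.

Lemma shift0 f : shift 0 f = f.
Proof. by apply: exp_fun_inj => x; rewrite shift_val addr0. Qed.

(** Taylor's formula in the topology of the space: the coefficients of the
    remainder are tails of the series defining those of the translate. *)
Lemma shift_expansion a f :
  expansion (fun t => shift (t *: a) f) (fun l => dir_deriv l a f).
Proof.
move=> e' r e'0 r0; have r20 : 0 < (2 * r)^-1 by rewrite invr_gt0 mulr_gt0.
have [e [e0 ee' ea]] := small_rate Th k1 e'0 r20 (rnorm_ge0 a).
have [A fA] := bnd_ex f e0; have A0 := bnd_ge0 fA.
have Ke0 := rate_ge0 Th k1 (ltW e0).
exists (2 * A) => J t tr m.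
have ta : K * e * rnorm (t *: a) <= cnorm t / (2 * r).
  by rewrite rnorm_scale mulrCA ler_wpM2l ?cnorm_ge0.
have ta2 : K * e * rnorm (t *: a) <= 2^-1.
  apply: (le_trans ta); rewrite ler_pdivrMr ?mulr_gt0//; lra.
have tar : K * e * rnorm (t *: a) <= cnorm t / r.
  apply: (le_trans ta); rewrite ler_wpM2l ?cnorm_ge0// lef_pV2 ?posrE ?mulr_gt0//; lra.
have := @shift_shifts (t *: a) f _ _ (ltW e0) fA ta2 m J.
rewrite tcoefD tcoefN tcoef_sum.
have -> : \sum_(l < J) shift_coef m (t *: a) (tcoef f (m + l)%N) =
    \sum_(j < J) tcoef (t ^+ j *: dir_deriv j a f) m.
  apply: eq_bigr => l _; rewrite tcoefZ dir_derivE.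
  apply: (@ht_val_inj _ _ Th); apply/funext => y.
  rewrite ht_valZ !shift_coefE ?leq_addr//.
  have := taylor_polyZ a t 1 y (ht_val_hpoly (tcoef f (m + l)%N)) (leq_addr l m).
  by rewrite scale1r expr1n mulr1 addKn.
have e'm : (K * e) ^+ m <= e' ^+ m by rewrite lerXn2r ?nnegrE ?(ltW e'0).
have tJ : (K * e * rnorm (t *: a)) ^+ J <= (cnorm t / r) ^+ J.
  by rewrite lerXn2r ?nnegrE ?(rate_norm_ge0 Th k1)// ?(ltW e0)// divr_ge0 ?cnorm_ge0 ?(ltW r0).
move/le_trans; apply; rewrite mulrAC; apply: ler_pM => //.
- by rewrite !mulr_ge0 ?exprn_ge0// (rate_norm_ge0 Th k1)// ltW.
- by rewrite exprn_ge0.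
- by rewrite ler_wpM2l ?mulr_ge0.
Qed.

(** Evaluation at [y] turns the expansion of the translates into a power series
    for [t |-> f (y + t a)], to be compared with the Taylor series at [y]. *)
Lemma dhat_dir_deriv l a f y : dhat l f y a = (l`!%:R : R[i]) * dir_deriv l a f y.
Proof.
have [Q fQ] := exp_entire f y; rewrite (dhatE _ fQ).
have h : entire_series (fun t => f (y + t *: a)) (fun l => dir_deriv l a f y).
  have := expansion_eval y (shift_expansion a f).
  by under eq_fun do rewrite shift_val.
by have <- := is_taylor_series fQ h l.
Qed.

Lemma shift_dir_deriv l a b f : dir_deriv l a (shift b f) = shift b (dir_deriv l a f).
Proof.
apply: exp_fun_inj => y; rewrite shift_val.
have l0 : l`!%:R != 0 :> R[i] by rewrite pnatr_eq0 -lt0n fact_gt0.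
apply: (mulfI l0); rewrite -!dhat_dir_deriv.
have [Q fQ] := exp_entire f (y + b).
have := is_taylor_translate fQ; rewrite -shiftE => sQ.
by rewrite (dhatE _ fQ) (dhatE _ sQ).
Qed.

End exp_space_theory.

(** * The topology in terms of the seminorms *)

Section exp_topology.
Context (R : realType) (E : normedModType R[i]) (Th : holomorphy_type E)
  (k : \bar R).
Hypothesis k1 : (1 < k)%E.

Local Notation w := (exp_weight k).
Local Notation V := (ht_space Th).
Local Notation val := (ht_val Th _).
Local Notation X := (exp_space Th k).
Implicit Types (f g : X).

Lemma exp_norm_bnd f (rho A : R) : 0 < rho -> bnd f (rho / 2) A ->
  (exp_norm Th k rho f <= (2 * A)%:E)%E.
Proof. exact: exp_norm_le. Qed.

Lemma bnd_exp_norm f (rho A : R) : 0 < rho ->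
  (exp_norm Th k rho f <= A%:E)%E -> bnd f rho A.
Proof. exact: exp_norm_bound. Qed.

Lemma exp_norm_ge0 f (rho : R) : 0 < rho -> (0 <= exp_norm Th k rho f)%E.
Proof.
move=> r0; apply: nneseries_ge0 => n _ _.
by rewrite lee_fin !mulr_ge0 ?exp_weight_ge0 ?exp_coef_ge0// invr_ge0 exprn_ge0// ltW.
Qed.

Lemma exp_norm_fin f (rho : R) : 0 < rho -> exp_norm Th k rho f \is a fin_num.
Proof.
move=> r0; have r20 : 0 < rho / 2 by rewrite divr_gt0.
have [A fA] := bnd_ex f r20.
rewrite ge0_fin_numE ?exp_norm_ge0//.
by rewrite (le_lt_trans (exp_norm_bnd r0 fA))// ltry.
Qed.

Lemma bnd_fine f (rho : R) : 0 < rho -> bnd f rho (fine (exp_norm Th k rho f)).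
Proof. by move=> r0; apply: bnd_exp_norm => //; rewrite fineK// exp_norm_fin. Qed.

Lemma exp_normD f g (rho : R) : 0 < rho ->
  (exp_norm Th k rho (exp_fun (f + g)%R) <= exp_norm Th k rho f + exp_norm Th k rho g)%E.
Proof.
move=> r0; rewrite /exp_norm.
have t0 (h : X) i : 0 <= rho ^- i * w i * exp_coef Th h i.
  by rewrite !mulr_ge0 ?exp_weight_ge0 ?exp_coef_ge0// invr_ge0 exprn_ge0// ltW.
rewrite -nneseriesD; [|by move=> i _ _; rewrite lee_fin..].
apply: lee_nneseries => [i _ _|i _]; first by rewrite lee_fin.
rewrite -EFinD lee_fin -mulrDr ler_wpM2l ?mulr_ge0 ?exp_weight_ge0 ?invr_ge0 ?exprn_ge0 ?(ltW r0)//.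
by rewrite !exp_coefE -/(tcoef _ _) tcoefD// rnormD.
Qed.

Definition exp_ball f (rho d : R) : set X :=
  [set g : X | (exp_norm Th k rho (exp_fun (g - f)%R) < d%:E)%E].

Lemma exp_ball_open f rho d : 0 < rho -> 0 < d -> open (exp_ball f rho d).
Proof.
move=> r0 d0; exists [set exp_ball f rho d]; last by rewrite bigcup_set1.
move=> _ ->; exact: (@finI_from1 _ _ [set i : X * R * R | 0 < i.1.2 /\ 0 < i.2]
  (fun i => [set g : X | (exp_norm Th k i.1.2 (g - i.1.1)%R < i.2%:E)%E]) (f, rho, d)).
Qed.

Lemma open_finite (U : set X) f : open U -> U f ->
  exists s : seq (X * R * R),
    (forall i, i \in s -> [/\ 0 < i.1.2, 0 < i.2 & exp_ball i.1.1 i.1.2 i.2 f]) /\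
    forall g, (forall i, i \in s -> exp_ball i.1.1 i.1.2 i.2 g) -> U g.
Proof.
move=> [D' sD' <-] [B /[dup] DB /sD' [D sD BD] Bf].
exists (finmap.enum_fset D : seq (X * R * R)); split.
  move=> i iD; have /set_mem[h1 h2] := sD i iD; split=> //.
  by move: Bf => /=; rewrite -BD => /(_ i iD).
by move=> g h; exists B => //=; rewrite -BD => i iD; exact: h i iD.
Qed.

(** Neighbourhoods are finite intersections of balls with arbitrary centres; the
    triangle inequality recentres them, and one seminorm dominates finitely many. *)
Lemma open_bnd (U : set X) f : open U -> U f ->
  exists e d : R, [/\ 0 < e, 0 < d & forall g, bnd (g - f) e d -> U g].
Proof.
move=> oU /(open_finite oU)[s0 [hs0 sU]].
suff : forall s : seq (X * R * R),
    (forall i, i \in s -> [/\ 0 < i.1.2, 0 < i.2 & exp_ball i.1.1 i.1.2 i.2 f]) ->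
    exists e d : R, [/\ 0 < e, 0 < d & forall g, bnd (g - f) e d ->
      forall i, i \in s -> exp_ball i.1.1 i.1.2 i.2 g].
  by move=> /(_ s0 hs0)[e [d [e0 d0 h]]]; exists e, d; split=> // g /h /sU.
move=> s {s0 hs0 sU}; elim: s => [|[[h rho] del] s ih] hs; first by exists 1, 1; split.
have [|e [d [e0 d0 hd]]] := ih; first by move=> i si; apply: hs; rewrite in_cons si orbT.
have [/= r0 del0 fh] := hs _ (mem_head _ _).
pose N := fine (exp_norm Th k rho (exp_fun (f - h))).
have NE : exp_norm Th k rho (exp_fun (f - h)) = N%:E by rewrite fineK// exp_norm_fin.
have Nd : N < del by have : (exp_norm Th k rho (exp_fun (f - h)%R) < del%:E)%E := fh; rewrite NE lte_fin.
exists (Num.min e (rho / 2)), (Num.min d ((del - N) / 4)); split.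
- by rewrite lt_min e0 divr_gt0.
- by rewrite lt_min d0 divr_gt0 ?subr_gt0.
have m0 : 0 <= Num.min e (rho / 2) by rewrite le_min (ltW e0) divr_ge0// ltW.
move=> g gf i; rewrite in_cons => /predU1P[->|si]; last first.
  apply: hd si; apply: bnd_le gf _ _; first by rewrite m0 ge_min lexx.
  by rewrite ge_min lexx.
have g2 : bnd (g - f) (rho / 2) ((del - N) / 4).
  apply: bnd_le gf _ _; first by rewrite m0 ge_min lexx orbT.
  by rewrite ge_min lexx orbT.
have gE : g - h = (g - f) + (f - h) by rewrite addrA subrK.
suff : (exp_norm Th k rho (exp_fun (g - h)%R) < del%:E)%E by [].
rewrite gE (le_lt_trans (exp_normD _ _ r0))// NE.
rewrite (le_lt_trans (leeD2r _ (exp_norm_bnd r0 g2)))// -EFinD lte_fin.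
move: Nd; lra.
Qed.

Lemma nbhs_bnd (U : set X) f : nbhs f U ->
  exists e d : R, [/\ 0 < e, 0 < d & forall g, bnd (g - f) e d -> U g].
Proof.
rewrite nbhsE => -[B [oB Bf] BU]; have [e [d [e0 d0 h]]] := open_bnd oB Bf.
by exists e, d; split=> // g /h /BU.
Qed.

Lemma bnd_nbhs (U : set X) f (e d : R) : 0 < e -> 0 < d ->
  (forall g, bnd (g - f) e d -> U g) -> nbhs f U.
Proof.
move=> e0 d0 h; rewrite nbhsE; exists (exp_ball f e d).
  split; first exact: exp_ball_open.
  suff : (exp_norm Th k e (exp_fun (f - f)%R) < d%:E)%E by [].
  rewrite subrr (_ : exp_norm _ _ _ _ = 0%E) ?lte_fin//.
  by apply: eseries0 => n _ _; rewrite exp_coefE -/(tcoef _ _) tcoef0 rnorm0 mulr0.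
by move=> g gf; apply: h; apply: bnd_exp_norm => //; exact: ltW.
Qed.

Lemma form_scale (T : {linear X -> Cn R}) (a : R[i]) f : T (a *: f) = a * T f :> R[i].
Proof. by rewrite linearZ. Qed.

Lemma continuous_bounded (T : {linear X -> Cn R}) : continuous T ->
  exists C e : R, [/\ 0 < C, 0 < e & forall f A, bnd f e A -> cnorm (T f) <= C * A].
Proof.
move=> cT; have /nbhs_bnd[e [d [e0 d0 h]]] : nbhs (0 : X) [set f | cnorm (T f) < 1].
  have /cvgrPdist_lt/(_ 1%:C%C) := cT 0; rewrite ltcR ltr01 => /(_ isT).
  apply: filterS => f; rewrite linear0 sub0r normrN -rnormE ltcR; exact.
exists d^-1, e; split; rewrite ?invr_gt0// => f A fA; have A0 := bnd_ge0 fA.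
apply/ler_addgt0Pl => r r0; have rd : 0 < d * r by rewrite mulr_gt0.
have Ar : 0 < A + d * r by rewrite ltr_wpDl.
pose s : R := d / (A + d * r).
have s0 : 0 < s by rewrite divr_gt0.
have : cnorm (T (s%:C%C *: f)) < 1.
  apply: h; rewrite subr0; apply: bnd_le (bndZ s%:C%C fA) _ _; first by rewrite ltW//=.
  rewrite cnorm_real gtr0_norm// /s mulrAC ler_pdivrMr// ler_pM2l// lerDl ltW//.
rewrite form_scale cnormM cnorm_real gtr0_norm// mulrC.
rewrite -ltr_pdivlMr// div1r invf_div => /ltW/le_trans; apply.
by rewrite mulrDl mulrAC divff ?gt_eqF// mul1r addrC mulrC.
Qed.

Lemma bounded_continuous (L : {linear X -> X}) :
  (forall e' : R, 0 < e' -> exists C e : R, [/\ 0 < C, 0 < e &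
    forall f A, bnd f e A -> bnd (L f) e' (C * A)]) -> continuous L.
Proof.
move=> hL f U /nbhs_bnd[e' [d' [e'0 d'0 h]]]; have [C [e [C0 e0 hC]]] := hL e' e'0.
apply: (@bnd_nbhs _ _ e (d' / C)) => //; first by rewrite divr_gt0.
move=> g /hC; rewrite linearB mulrCA divff ?gt_eqF// mulr1; exact: h.
Qed.

End exp_topology.

(** * Homogeneous polynomials as elements of the space *)

Section monomials.
Context (R : realType) (E : normedModType R[i]) (Th : holomorphy_type E)
  (k : \bar R).
Hypothesis k1 : (1 < k)%E.

Local Notation w := (exp_weight k).
Local Notation V := (ht_space Th).
Local Notation val := (ht_val Th _).
Local Notation X := (exp_space Th k).
Implicit Types (f g : X).

Lemma val_shift_coef j m a (p : V j) :
  val (shift_coef m a p) = taylor_poly j (val p) a m.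
Proof.
have [mj|jm] := leqP m j; first exact: shift_coefE.
have e : val (0 : V m) = taylor_poly j (val p) a m.
  by rewrite linear0 /taylor_poly bin_small// scale0r.
by rewrite /shift_coef; case: xgetP => // /(_ _ e).
Qed.

(** The expansion at 0 of a homogeneous polynomial has a single term; it provides
    a family in the spaces [V n] without any transport along [n = j]. *)
Lemma shift_coef0 j n (p : V j) y :
  val (shift_coef n 0 p) y = if n == j then val p y else 0.
Proof.
have hp := ht_val_hpoly p; rewrite val_shift_coef.
have [nj|jn] := leqP n j; last first.
  by rewrite gtn_eqF// taylor_polyE bin_small// mul0r.
have := taylor_polyZ (0 : E) 0 1 y hp nj; rewrite scaler0 scale1r expr1n mulr1.
have [->|nj'] := eqVneq n j => h; last first.
  by rewrite h expr0n subn_eq0 leqNgt ltn_neqAle nj' nj mul0r.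
have := poly_translate 0 y hp; rewrite add0r big_ord_recr/= big1 ?add0r; first by move=> ->.
move=> i _; have ij : (i <= j)%N by apply: ltnW.
have := taylor_polyZ (0 : E) 0 1 y hp ij; rewrite scaler0 scale1r expr1n mulr1 => ->.
by rewrite expr0n subn_eq0 leqNgt ltn_ord mul0r.
Qed.

Definition mono j (p : V j) : X := xget 0 [set g | exp_fun g = val p].

Lemma monoP j (p : V j) : exp_fun (mono p) = val p /\
  forall n, tcoef (mono p) n = shift_coef n 0 p.
Proof.
have hp := ht_val_hpoly p.
have T0 : is_taylor (val p) 0 (fun n => val (shift_coef n 0 p)).
  have := is_taylor_poly 0 hp.
  suff -> : (fun n => val (shift_coef n 0 p)) = taylor_poly j (val p) 0 by [].
  by apply/funext => n; rewrite val_shift_coef.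
have [g gE] : exists g : X, forall n, tcoef g n = shift_coef n 0 p.
  apply: exp_of_coef => // e e0.
  exists (w j * rnorm p / e ^+ j) => n; have [->|nj] := eqVneq n j.
    have -> : shift_coef j 0 p = p.
      by apply: (@ht_val_inj _ _ Th); apply/funext => y; rewrite shift_coef0 eqxx.
    by rewrite divfK// gt_eqF// exprn_gt0.
  have -> : shift_coef n 0 p = 0.
    apply: (@ht_val_inj _ _ Th); apply/funext => y.
    by rewrite shift_coef0 (negbTE nj) linear0.
  rewrite rnorm0 mulr0 !mulr_ge0 ?exp_weight_ge0 ?rnorm_ge0 ?invr_ge0 ?exprn_ge0 ?(ltW e0)//.
have gp : exp_fun g = val p.
  apply: (entire_ext (exp_entire g) (hpoly_entire hp) (exp_taylor g)).
  suff -> : (fun n => val (tcoef g n)) = (fun n => val (shift_coef n 0 p)) by [].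
  by apply/funext => n; rewrite gE.
suff -> : mono p = g by [].
rewrite /mono; case: xgetP => [h _ /= hE|/(_ g)//].
by apply/val_inj; rewrite /= hE gp.
Qed.

Lemma mono_val j (p : V j) x : mono p x = val p x.
Proof. by have [-> _] := monoP p. Qed.

Lemma tcoef_mono j (p : V j) : tcoef (mono p) j = p.
Proof.
have [_ ->] := monoP p; apply: (@ht_val_inj _ _ Th); apply/funext => y.
by rewrite shift_coef0 eqxx.
Qed.

Lemma tcoef_mono_neq j n (p : V j) : n != j -> tcoef (mono p) n = 0.
Proof.
have [_ h] := monoP p; move=> nj; rewrite h; apply: (@ht_val_inj _ _ Th).
by apply/funext => y; rewrite shift_coef0 (negbTE nj) linear0.
Qed.

Lemma mono_bnd j (p : V j) e A : 0 < e -> w j * rnorm p <= A * e ^+ j -> bnd (mono p) e A.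
Proof.
move=> e0 pA n; have [->|nj] := eqVneq n j; first by rewrite tcoef_mono.
rewrite tcoef_mono_neq// rnorm0 mulr0 mulr_ge0 ?exprn_ge0 ?(ltW e0)//.
have := le_trans (mulr_ge0 (exp_weight_ge0 k j) (rnorm_ge0 p)) pA.
by rewrite pmulr_lge0// exprn_gt0.
Qed.

(** A bound at rate [e / 2] read at rate [e] gains the factor [2^(- n)] on the
    terms of order at least [n]. *)
Lemma mono_sum_bnd f e A n : 0 < e -> bnd f (e / 2) A ->
  bnd (f - \sum_(m < n) mono (tcoef f m)) e (A * (2^-1) ^+ n).
Proof.
move=> e0 fA i; have A0 := bnd_ge0 fA.
rewrite tcoefD tcoefN tcoef_sum; have [iltn|ni] := ltnP i n.
  rewrite (bigD1 (Ordinal iltn))//= tcoef_mono big1 ?addr0 ?subrr ?rnorm0 ?mulr0.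
    by rewrite !mulr_ge0 ?exprn_ge0 ?invr_ge0 ?(ltW e0).
  by move=> j ji; rewrite tcoef_mono_neq//; apply: contra_neq ji => ij; exact/val_inj.
rewrite big1 ?subr0 => [|j _]; last first.
  by rewrite tcoef_mono_neq// gtn_eqF// (leq_trans (ltn_ord j)).
rewrite (le_trans (fA i))// expr_div_n mulrA mulrAC -exprVn.
rewrite ler_wpM2r ?exprn_ge0 ?(ltW e0)// ler_wpM2l//.
by rewrite ler_wiXn2l ?invr_ge0// invf_le1 ?ler1n.
Qed.

Lemma bin_le_2exp n m : ('C(n, m) <= 2 ^ n)%N.
Proof.
elim: n m => [|n ih] [|m]; rewrite ?bin0 ?expn_gt0//.
by rewrite binS expnS mul2n -addnn leq_add.
Qed.

End monomials.

(** * The convolution operator *)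

Section convolution_operator.
Context (R : realType) (E : normedModType R[i]) (Th : holomorphy_type E)
  (k : \bar R).
Hypothesis k1 : (1 < k)%E.

Local Notation w := (exp_weight k).
Local Notation V := (ht_space Th).
Local Notation val := (ht_val Th _).
Local Notation K := (growth Th k ^+ 2).
Local Notation X := (exp_space Th k).
Implicit Types (f g : X).

Variable T : {linear X -> Cn R}.
Hypothesis cT : continuous T.

Lemma apply_bounded : bounded T.
Proof. by have [C [e [_ e0 h]]] := continuous_bounded cT; exists C, e. Qed.

(** The contractions of the polarization of [p] are its Taylor components divided
    by binomial coefficients, which are at most [2^(m + l)]: hence the doubling of
    the constant [M] given by the axiom. *)
Lemma pi2_forms : pi2_type Th k -> exists C M rho : R, [/\ 0 < C, 0 < M, 0 < rho &
  forall m l (p : V (m + l)%N), exists2 G : V l,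
    forall y, val G y = T (mono k (shift_coef m y p)) &
    rnorm G <= C * M ^+ (m + l) * rho ^- m * w m * rnorm p].
Proof.
move=> /(_ T cT)[h1 h2]; have [C [rho [C0 r0 hC]]] := continuous_bounded cT.
have [|M M0 hM] := h2 C rho C0 r0.
  move=> f; rewrite -(fineK (exp_norm_fin f r0)) -EFinM lee_fin.
  exact: hC (bnd_fine f r0).
exists C, (2 * M), rho; split; rewrite ?mulr_gt0// => m l p.
have b0 : 'C(m + l, m)%:R != 0 :> R[i] by rewrite pnatr_eq0 -lt0n bin_gt0 leq_addr.
pose g y : X := ('C(m + l, m)%:R^-1 : R[i]) *: mono k (shift_coef m y p).
have gE y : exp_fun (g y) = contract (polar (m + l) (val p)) m y.
  apply/funext => x; rewrite exp_funZ mono_val// val_shift_coef taylor_polyE.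
  exact: mulKf.
have := hM m (m + l)%N p g (leq_addr l m) gE.
have := h1 m (m + l)%N p g (leq_addr l m) gE; rewrite addKn => -[G _ GE].
rewrite -GE ht_normE => Gle; exists ('C(m + l, m)%:R *: G) => [y|].
  rewrite ht_valZ GE /g form_scale; exact: mulVKf.
rewrite rnorm_scale cnorm_nat (le_trans (ler_wpM2l _ Gle))//.
have h : C * 'C(m + l, m)%:R <= C * 2 ^+ (m + l).
  by rewrite ler_pM2l// -natrX ler_nat bin_le_2exp.
rewrite exprMn.
rewrite !mulrA ler_wpM2r ?rnorm_ge0// ler_wpM2r ?exp_weight_ge0//.
rewrite ler_wpM2r ?invr_ge0 ?exprn_ge0 ?(ltW r0)// ler_wpM2r ?exprn_ge0 ?(ltW M0)//.
by rewrite [leLHS]mulrC.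
Qed.

Lemma apply_shift_series f x : forall r : R, 0 < r -> exists N, forall J, (N <= J)%N ->
  cnorm (T (shift x f) - \sum_(l < J) T (dir_deriv l x f)) <= r.
Proof.
move=> r r0; have h := expansion_apply apply_bounded (shift_expansion k1 x f).
have [C hC] := entire_series_half h ltr01.
have [N _ hN] := @half_small R `|C| r 0 r0; exists N => J NJ.
have := hC J 1; rewrite cnorm1 lexx scale1r => /(_ isT).
under eq_bigr do rewrite expr1n mul1r.
move/le_trans; apply; rewrite (le_trans _ hN)//.
rewrite (@le_trans _ _ (`|C| * 2^-1 ^+ J))//.
  by rewrite ler_wpM2r ?exprn_ge0 ?invr_ge0// ler_norm.
by rewrite ler_wpM2l// ler_wiXn2l ?invr_ge0// invf_le1 ?ler1n.
Qed.

(** The [l]-homogeneous component of [x |-> T (shift x f)] is the sum over [m] of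
    the polynomials that the axioms of pi2-types produce from the Taylor
    coefficients of order [m + l]. *)
Lemma convolution_ex : pi2_type Th k -> exists C M rho : R, [/\ 0 < C, 0 < M, 0 < rho &
  forall f, exists g : X, (forall x, g x = T (shift x f)) /\
    forall e A : R, 0 <= e -> bnd f e A -> M * e / rho <= 2^-1 ->
      bnd g (M * e) (2 * C * A)].
Proof.
move=> /pi2_forms[C [M [rho [C0 M0 r0 hG]]]]; exists C, M, rho; split=> // f.
pose G m l : V l := s2val (cid2 (hG m l (tcoef f (m + l)%N))).
have GE m l y : val (G m l) y = T (mono k (shift_coef m y (tcoef f (m + l)%N))).
  by rewrite /G; case: cid2.
have G1 m l : rnorm (G m l) <= C * M ^+ (m + l) * rho ^- m * w m * rnorm (tcoef f (m + l)%N).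
  by rewrite /G; case: cid2.
(* Multiplicativity of the weights makes the bound geometric in [m], with a ratio
   that is small with [e]. *)
have Gle l e A : 0 <= e -> bnd f e A -> forall m,
    rnorm (G m l) <= (C * A * (M * e) ^+ l / w l) * (M * e / rho) ^+ m.
  move=> e0 fA m; rewrite mulrAC ler_pdivlMr ?(weight_gt0 Th k1)//.
  rewrite (le_trans (ler_wpM2r (exp_weight_ge0 _ _) (G1 m l)))//.
  have -> : C * M ^+ (m + l) * rho ^- m * w m * rnorm (tcoef f (m + l)%N) * w l =
    (C * M ^+ (m + l) * rho ^- m) * ((w m * w l) * rnorm (tcoef f (m + l)%N)) by ring.
  have c0 : 0 <= C * M ^+ (m + l) * rho ^- m.
    by rewrite !mulr_ge0 ?invr_ge0 ?exprn_ge0 ?(ltW C0) ?(ltW M0) ?(ltW r0).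
  have h : (w m * w l) * rnorm (tcoef f (m + l)%N) <= A * e ^+ (m + l).
    by rewrite (le_trans _ (fA _))// ler_wpM2r ?rnorm_ge0// exp_weightM.
  rewrite (le_trans (ler_wpM2l c0 h))// !exprMn !exprD exprVn le_eqVlt.
  by apply/orP; left; apply/eqP; ring.
have small e' : 0 < e' -> exists e : R, [/\ 0 < e, M * e <= e' & M * e / rho <= 2^-1].
  move=> e'0; exists (Num.min (e' / M) (rho / 2 / M)); split.
  - by rewrite lt_min !divr_gt0.
  - by rewrite mulrC -ler_pdivlMr// ge_min lexx.
  - rewrite ler_pdivrMr// mulrC -ler_pdivlMr// ge_min.
    by rewrite [2^-1 * _]mulrC lexx orbT.
have pos e : 0 <= e -> 0 <= M * e / rho.
  by move=> e0; rewrite divr_ge0 ?(ltW r0)// mulr_ge0// ltW.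
have HQ l : exists q : V l, forall A r : R, 0 <= r <= 2^-1 ->
    (forall m, rnorm (G m l) <= A * r ^+ m) ->
    forall n, rnorm (q - \sum_(m < n) G m l) <= 2 * A * r ^+ n.
  apply: geo_sum; have [e [e0 _ er]] := small 1 ltr01.
  have [A fA] := bnd_ex f e0.
  exists (C * A * (M * e) ^+ l / w l), (M * e / rho); split; last exact: Gle (ltW e0) fA.
  by rewrite er pos ?(ltW e0).
pose Q l : V l := sval (cid (HQ l)).
have Qle e A : 0 <= e -> bnd f e A -> M * e / rho <= 2^-1 -> forall l n,
    rnorm (Q l - \sum_(m < n) G m l) <=
      2 * (C * A * (M * e) ^+ l / w l) * (M * e / rho) ^+ n.
  move=> e0 fA er l n; rewrite /Q; case: cid => q /= hq.
  by apply: hq; [rewrite er pos|exact: Gle].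
have Qb e A : 0 <= e -> bnd f e A -> M * e / rho <= 2^-1 ->
    seq_bound k Q (M * e) (2 * C * A).
  move=> e0 fA er l; have := Qle e A e0 fA er l 0%N.
  rewrite big_ord0 subr0 expr0 mulr1 => h.
  rewrite mulrC -ler_pdivlMr ?(weight_gt0 Th k1)// (le_trans h)// le_eqVlt.
  by apply/orP; left; apply/eqP; ring.
have dQ : decays k Q.
  move=> e' e'0; have [e [e0 ee' er]] := small e' e'0.
  have [A fA] := bnd_ex f e0; exists (2 * C * A) => n.
  rewrite (le_trans (Qb e A (ltW e0) fA er n))// ler_wpM2l//.
    by rewrite !mulr_ge0 ?(ltW C0) ?(bnd_ge0 fA).
  by rewrite lerXn2r ?nnegrE ?mulr_ge0 ?(ltW M0) ?(ltW e0) ?(ltW e'0).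
have [g gQ] := exp_of_coef k1 dQ.
exists g; split; last by move=> e A e0 fA er n; rewrite gQ; exact: Qb.
move=> x.
(* Both sides are the sum over [m] of the values at [x] of [G m l]. *)
have TQ l : T (dir_deriv l x f) = val (Q l) x.
  apply/eqP; rewrite -subr_eq0; apply/eqP; apply: cnorm_lt_all => r rp.
  have r40 : 0 < r / 4 by rewrite divr_gt0.
  have [C1 [e1 [e10 hT]]] := apply_bounded.
  have e120 : 0 < e1 / 2 by rewrite divr_gt0.
  have [B dB] := bnd_ex (dir_deriv l x f) e120.
  have [N1 _ hN1] := @half_small R (C1 * B) (r / 4) 0 r40.
  have [e [e0 _ er]] := small 1 ltr01; have [A fA] := bnd_ex f e0.
  pose D : R := growth Th k ^+ l * (2 * (C * A * (M * e) ^+ l / w l)) * rnorm x ^+ l.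
  have D0 : 0 <= D.
    rewrite /D !mulr_ge0 ?exprn_ge0 ?(growth_ge0 Th k1) ?rnorm_ge0 ?(ltW C0) ?(bnd_ge0 fA)//.
      by rewrite mulr_ge0 ?(ltW M0) ?(ltW e0).
    by rewrite invr_ge0 exp_weight_ge0.
  have [N2 N12 hN2] := @half_small R D (r / 4) N1 r40.
  have h1 := hT _ _ (mono_sum_bnd k1 N2 e10 dB).
  have sumE : T (\sum_(m < N2) mono k (tcoef (dir_deriv l x f) m)) = \sum_(m < N2) val (G m l) x.
    by rewrite linear_sum; apply: eq_bigr => m _; rewrite GE dir_derivE.
  rewrite linearB sumE in h1.
  have h2 : rnorm (val (Q l - \sum_(m < N2) G m l) x : Cn R) <= D * 2^-1 ^+ N2.
    rewrite (le_trans (val_le k1 _ _))// /D.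
    have -> : growth Th k ^+ l * (2 * (C * A * (M * e) ^+ l / w l)) * rnorm x ^+ l * 2^-1 ^+ N2
      = growth Th k ^+ l * (2 * (C * A * (M * e) ^+ l / w l) * 2^-1 ^+ N2) * rnorm x ^+ l by ring.
    rewrite ler_wpM2r ?exprn_ge0 ?rnorm_ge0// ler_wpM2l ?exprn_ge0 ?(growth_ge0 Th k1)//.
    rewrite (le_trans (Qle e A (ltW e0) fA er l N2))// ler_wpM2l//.
      rewrite !mulr_ge0 ?invr_ge0 ?exp_weight_ge0 ?exprn_ge0 ?(ltW C0) ?(bnd_ge0 fA)//.
      by rewrite mulr_ge0 ?(ltW M0) ?(ltW e0).
    by rewrite lerXn2r ?nnegrE ?pos ?(ltW e0)// invr_ge0.
  rewrite ht_valB ht_val_sum in h2.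
  have h3 : C1 * (B * 2^-1 ^+ N2) <= r / 4.
    rewrite mulrA; have [c0|c0] := leP 0 (C1 * B); last first.
      by rewrite (@le_trans _ _ 0) ?(ltW r40)// nmulr_rle0// exprn_ge0// invr_ge0.
    rewrite (le_trans _ hN1)// ler_wpM2l// ler_wiXn2l ?invr_ge0// invf_le1 ?ler1n//.
  rewrite -(subrKA (\sum_(m < N2) val (G m l) x)) (le_lt_trans (cnormD _ _))//.
  by rewrite [X in _ + X < _]cnormB; move: (le_trans h1 h3) (le_trans h2 hN2); rewrite -!cnormE; lra.
apply/eqP; rewrite -subr_eq0; apply/eqP; apply: cnorm_lt_all => r rp.
have r40 : 0 < r / 4 by rewrite divr_gt0.
have [N1 hN1] := apply_shift_series f x r40.
have h20 : (0 : R) < 2^-1 by rewrite invr_gt0.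
have [e [e0 _ ex]] := small_rate Th k1 ltr01 h20 (rnorm_ge0 x).
have [A gA] := bnd_ex g e0.
have [N N1N hN] := @half_small R (2 * A) (r / 4) N1 r40.
have h1 := hN1 N N1N.
have h2 := exp_sums k1 (ltW e0) gA ex N.
have h3 : 2 * A * (K * e * rnorm x) ^+ N <= r / 4.
  rewrite (le_trans _ hN)// ler_wpM2l ?mulr_ge0 ?(bnd_ge0 gA)//.
  by rewrite lerXn2r ?nnegrE ?(rate_norm_ge0 Th k1) ?(ltW e0)// ltW.
have sE : \sum_(l < N) T (dir_deriv l x f) = \sum_(l < N) val (tcoef g l) x.
  by apply: eq_bigr => l _; rewrite TQ gQ.
rewrite sE in h1.
rewrite -(subrKA (\sum_(l < N) val (tcoef g l) x)) (le_lt_trans (cnormD _ _))//.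
by rewrite [X in _ + X < _]cnormB; move: h1 (le_trans h2 h3); rewrite -!cnormE; lra.
Qed.

End convolution_operator.

(** * Exponentials of functionals *)

Section exponentials.
Context (R : realType) (E : normedModType R[i]) (Th : holomorphy_type E)
  (k : \bar R).
Hypothesis k1 : (1 < k)%E.
Hypothesis pi1 : pi1_type Th.

Local Notation w := (exp_weight k).
Local Notation V := (ht_space Th).
Local Notation val := (ht_val Th _).
Local Notation K := (growth Th k ^+ 2).
Local Notation X := (exp_space Th k).
Implicit Types (f g : X) (phi psi : E -> Cn R).

Lemma dualD phi psi (t : R[i]) : dual phi -> dual psi ->
  dual (fun x => phi x + t * psi x).
Proof.
move=> [lphi cphi] [lpsi cpsi]; split.
  move=> a x y; rewrite lphi lpsi.
  rewrite -![_ *: _]/(_ * _ : R[i]); ring.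
move=> x; apply: cvgD; first exact: cphi.
suff : (t *: (psi y : Cn R)) @[y --> x] --> t *: (psi x : Cn R) by [].
by apply: cvgZr; exact: cpsi.
Qed.

Lemma dual0 : dual ((fun=> 0) : E -> Cn R).
Proof.
split; last exact: cst_continuous.
by move=> a x y; rewrite scaler0 addr0.
Qed.

Lemma dual_bound phi : dual phi -> exists2 N : R, 0 <= N &
  forall x, rnorm x <= 1 -> cnorm (phi x) <= N.
Proof.
move=> [lphi cphi]; have phi0 : phi 0 = 0.
  by have := lphi (-1) 0 0; rewrite scaler0 addr0 scaleN1r addNr.
have /cvgrPdist_lt/(_ 1%:C%C) := cphi 0; rewrite ltcR ltr01 => /(_ isT).
move=> /nbhs_ballP[d /= d0 hd].
have dE : (complex.Re d)%:C%C = d by rewrite RRe_real// gtr0_real.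
have rd0 : 0 < complex.Re d by rewrite -ltcR dE.
pose s : R := complex.Re d / 2; have s0 : 0 < s by rewrite divr_gt0.
exists s^-1; first by rewrite invr_ge0 ltW.
move=> x x1; have : cnorm (phi (s%:C%C *: x)) <= 1.
  have /hd : ball 0 d (s%:C%C *: x).
    rewrite -ball_normE/= sub0r normrN -rnormE -dE ltcR rnorm_scale cnorm_real gtr0_norm//.
    rewrite (@le_lt_trans _ _ s)//; first by rewrite ler_piMr// ltW.
    by rewrite /s ltr_pdivrMr// ltr_pMr// ltr1n.
  by rewrite phi0 sub0r normrN -rnormE ltcR => /ltW.
have := lphi (s%:C%C) x 0; rewrite !addr0 phi0 addr0 => ->.
rewrite cnormE rnorm_scale cnorm_real gtr0_norm// => h.
by rewrite -div1r ler_pdivlMr// mulrC.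
Qed.

Definition fpow n phi : V n := xget 0 [set p | val p = fun x => phi x ^+ n].

Lemma fpow_val n phi : dual phi -> val (fpow n phi) = fun x => phi x ^+ n.
Proof.
move=> dphi; have [h _ _] := pi1.
have [|p _ pE] := h n (fun x => phi x ^+ n).
  exists 1%N, (fun=> 1), (fun=> phi); split=> //.
  by apply/funext => x; rewrite big_ord1 mul1r.
by rewrite /fpow; case: xgetP => // /(_ _ pE).
Qed.

Lemma fpow_bound : exists2 B : R, 0 < B & forall n phi N, dual phi -> 0 <= N ->
  (forall x, rnorm x <= 1 -> cnorm (phi x) <= N) ->
  rnorm (fpow n phi) <= (B * N) ^+ n.
Proof.
have [_ [B B0 hB] _] := pi1; exists B => // n phi N dphi N0 phiN.
have := hB phi 1 n dphi.
have -> : (fun x => 1 * phi x ^+ n) = val (fpow n phi).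
  by rewrite fpow_val//; apply/funext => x; rewrite mul1r.
rewrite ht_normE -cnormE cnorm1 mulr1 => /le_trans; apply.
rewrite exprMn ler_wpM2l ?exprn_ge0 ?(ltW B0)//.
have hub : ubound [set rnorm (phi x) | x in [set x | rnorm x <= 1]] N.
  by move=> _ [x /= x1 <-]; exact: phiN.
have h0 : [set rnorm (phi x) | x in [set x | rnorm x <= 1]] (rnorm (phi 0)).
  by exists 0 => //=; rewrite rnorm0.
rewrite lerXn2r ?nnegrE//.
  apply: (le_trans (rnorm_ge0 (phi 0))); apply: ub_le_sup h0; by exists N.
by apply: ge_sup => //; exists (rnorm (phi 0)).
Qed.

Lemma fact_neq0 n : n`!%:R != 0 :> R[i].
Proof. by rewrite pnatr_eq0 -lt0n fact_gt0. Qed.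

Lemma weight_fact_le (B e : R) : 0 <= B -> 0 < e -> exists2 C : R, 0 <= C &
  forall n, w n * (B ^+ n / n`!%:R) <= C * e ^+ n.
Proof.
move=> B0 e0; have Be : 0 <= B / e by rewrite divr_ge0// ltW.
have [C hC] := exp_weight_fact k1 Be; exists C.
  by have := hC 0%N; rewrite exp_weight0 !mulr1; apply: le_trans.
move=> n; have := hC n; have n0 : (0 : R) < n`!%:R by rewrite ltr0n fact_gt0.
rewrite expr_div_n mulrA mulrA ler_pdivrMr ?exprn_gt0// ler_pdivrMr//.
by rewrite mulrAC.
Qed.

(** The weights grow more slowly than the factorials, because [1 < k]. *)
Lemma exp_of_fact (p : forall n, V n) (B : R) : 0 <= B ->
  (forall n, rnorm (p n) <= B ^+ n) ->
  exists f : X, forall n, tcoef f n = (n`!%:R^-1 : R[i]) *: p n.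
Proof.
move=> B0 hp; apply: exp_of_coef => // e e0.
have [C C0 hC] := weight_fact_le B0 e0; exists C => n.
rewrite (le_trans _ (hC n))// ler_wpM2l ?exp_weight_ge0//.
rewrite rnorm_scale cnormV cnorm_nat mulrC ler_wpM2r// invr_ge0//.
Qed.

Definition expo phi : X :=
  xget 0 [set g | forall n, tcoef g n = (n`!%:R^-1 : R[i]) *: fpow n phi].

Lemma tcoef_expo phi n : dual phi -> tcoef (expo phi) n = (n`!%:R^-1 : R[i]) *: fpow n phi.
Proof.
move=> dphi; have [B B0 hB] := fpow_bound; have [N N0 hN] := dual_bound dphi.
have [|g hg] := @exp_of_fact (fun n => fpow n phi) (B * N) (mulr_ge0 (ltW B0) N0).
  by move=> m; exact: hB.
by rewrite /expo; case: xgetP => [h _ ->//|/(_ g)].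
Qed.

Lemma shift_coef_fpow j m a phi : dual phi ->
  shift_coef m a (fpow j phi) = ('C(j, m)%:R * phi a ^+ (j - m) : R[i]) *: fpow m phi.
Proof.
move=> dphi; have [lphi _] := dphi; apply: (@ht_val_inj _ _ Th); rewrite val_shift_coef.
pose Q m : E -> Cn R := ('C(j, m)%:R * phi a ^+ (j - m) : R[i]) *: val (fpow m phi).
have hQ : is_taylor (val (fpow j phi)) a Q.
  split.
    move=> n; have := hpolyD ('C(j, n)%:R * phi a ^+ (j - n) : R[i])
      (ht_val_hpoly (fpow n phi)) (ht_val_hpoly (0 : V n)).
    by rewrite linear0 addr0.
  exists 1 => //; apply/uniform_cvgP => e e0; exists j.+1 => n jn x _.
  rewrite fpow_val//.
  have -> : phi x = phi a + phi (x - a).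
    have := lphi 1 (x - a) a; rewrite !scale1r subrK => ->; exact: addrC.
  rewrite exprDn (big_ord_widen n (fun i => phi a ^+ (j - i) * phi (x - a) ^+ i *+ 'C(j, i)) jn).
  rewrite big_mkcond/= -sumrB big1 ?rnorm0// => i _.
  have QE : Q i (x - a) = phi a ^+ (j - i) * phi (x - a) ^+ i *+ 'C(j, i).
    rewrite /Q fpow_val// -[LHS]/('C(j, i)%:R * phi a ^+ (j - i) * phi (x - a) ^+ i : R[i]).
    by rewrite -mulrA mulr_natl.
  rewrite QE; case: ifPn => [_|]; first by rewrite subrr.
  by rewrite -leqNgt => ji; rewrite bin_small// mulr0n subrr.
rewrite (is_taylor_uniq (is_taylor_poly a (ht_val_hpoly (fpow j phi))) hQ).
by rewrite /Q linearZ.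
Qed.

Lemma eq_of_rnorm_le (U : normedModType R[i]) (x y : U) :
  (forall r : R, 0 < r -> rnorm (x - y) <= r) -> x = y.
Proof.
move=> h; apply/eqP; rewrite -subr_eq0 -rnorm_eq0 eq_le rnorm_ge0 andbT.
by apply/ler_addgt0Pl => r r0; rewrite addr0 h.
Qed.

Lemma shift_coefZ j m a (c : R[i]) (p : V j) :
  shift_coef m a (c *: p) = c *: shift_coef m a p.
Proof.
apply: (@ht_val_inj _ _ Th); rewrite linearZ /= !val_shift_coef.
have := is_taylorD c (is_taylor_poly a (ht_val_hpoly p)) (@is_taylor0 _ _ a).
rewrite addr0 -linearZ_LR => h.
rewrite (is_taylor_uniq (is_taylor_poly a (ht_val_hpoly (c *: p))) h).
by rewrite /= addr0.
Qed.

(** The functional equation of the exponential, on Taylor coefficients: translation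
    by [a] multiplies each of them by the same series in [phi a]. *)
Lemma shift_expo phi a : dual phi -> shift a (expo phi) = (expo phi a : R[i]) *: expo phi.
Proof.
move=> dphi; apply: tcoef_inj => m; rewrite tcoefZ tcoef_expo//; apply: eq_of_rnorm_le => r r0.
have h20 : (0 : R) < 2^-1 by rewrite invr_gt0.
have [e [e0 _ ea]] := small_rate Th k1 ltr01 h20 (rnorm_ge0 a).
have [A fA] := bnd_ex (expo phi) e0; have A0 := bnd_ge0 fA.
have r20 : 0 < r / 2 by rewrite divr_gt0.
pose S n : R[i] := \sum_(l < n) phi a ^+ l / l`!%:R.
pose v := (m`!%:R^-1 : R[i]) *: fpow m phi.
have sE n : \sum_(l < n) shift_coef m a (tcoef (expo phi) (m + l)%N) = S n *: v.
  rewrite scaler_suml; apply: eq_bigr => l _.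
  rewrite tcoef_expo// shift_coefZ shift_coef_fpow// addKn /v !scalerA; congr (_ *: _).
  have := bin_fact (leq_addr l m); rewrite addKn => /(congr1 (fun n => n%:R : R[i])).
  rewrite !natrM => <-; have := fact_neq0 m; have := fact_neq0 l => l0 m0.
  have b0 : 'C(m + l, m)%:R != 0 :> R[i] by rewrite pnatr_eq0 -lt0n bin_gt0 leq_addr.
  by field; rewrite l0 m0 b0.
have Ke0 := rate_ge0 Th k1 (ltW e0).
have wm := weight_gt0 Th k1 m.
have D0 : 0 <= 2 * A * (K * e) ^+ m / w m.
  by rewrite divr_ge0 ?(ltW wm)// mulr_ge0 ?exprn_ge0// mulr_ge0.
have [N1 _ hN1] := @half_small R (2 * A * (K * e) ^+ m / w m) (r / 2) 0 r20.
have [N N1N hN] := @half_small R (2 * A * rnorm v) (r / 2) N1 r20.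
have q01 : (K * e * rnorm a) ^+ N <= 2^-1 ^+ N.
  by rewrite lerXn2r ?nnegrE ?(rate_norm_ge0 Th k1) ?invr_ge0// ltW.
have h1 : rnorm (tcoef (shift a (expo phi)) m - S N *: v) <= r / 2.
  have := @shift_shifts _ _ _ _ k1 a (expo phi) _ _ (ltW e0) fA ea m N.
  rewrite sE mulrC -ler_pdivlMr// mulrAC => /le_trans; apply.
  rewrite (le_trans _ hN1)//; apply: ler_wpM2l => //.
  by rewrite (le_trans q01)// ler_wiXn2l ?invr_ge0// invf_le1 ?ler1n.
have h2 : rnorm ((S N - expo phi a : R[i]) *: v) <= r / 2.
  have := @exp_sums _ _ _ _ k1 (expo phi) a _ _ (ltW e0) fA ea N.
  have -> : \sum_(i < N) val (tcoef (expo phi) i) a = S N.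
    apply: eq_bigr => i _; rewrite tcoef_expo// ht_valZ fpow_val//; exact: mulrC.
  rewrite -cnormE cnormB rnorm_scale => h; rewrite (le_trans _ hN)//.
  rewrite mulrAC ler_wpM2r ?rnorm_ge0// (le_trans h)// ler_wpM2l// mulr_ge0//.
rewrite -(subrKA (S N *: v)) (le_trans (rnormD _ _))// -scalerBl.
by move: h1 h2; lra.
Qed.

Lemma expansion0 F D : expansion F D -> F 0 = D 0%N :> X.
Proof.
move=> FD; have [C hC] := FD 1 1 ltr01 ltr01; have := hC 1%N 0.
rewrite cnorm0 => /(_ ler01); rewrite big_ord1 mul0r expr1 mulr0 expr0 scale1r => h.
apply/eqP; rewrite -subr_eq0; apply/eqP; apply: tcoef_inj => n; rewrite tcoef0.
apply/eqP; rewrite -rnorm_eq0 eq_le rnorm_ge0 andbT.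
by have := h n; rewrite mul0r pmulr_rle0 ?(weight_gt0 Th k1).
Qed.

(** The coefficients of the polynomial [t |-> (phi + t psi)^n], in the space of
    [n]-homogeneous polynomials; their norms are estimated by averaging over
    roots of unity, which avoids polarization constants. *)
Lemma fpow_line phi psi : dual phi -> dual psi -> exists2 B : R, 0 <= B &
  forall n, exists c : nat -> V n, [/\
    forall t, fpow n (fun x => phi x + t * psi x) = \sum_(j < n.+1) t ^+ j *: c j,
    forall j, rnorm (c j) <= B ^+ n,
    forall j, (n < j)%N -> c j = 0 &
    forall j x, val (c j) x = 'C(n, j)%:R * (phi x ^+ (n - j) * psi x ^+ j) :> R[i]].
Proof.
move=> dphi dpsi; have [B0 B00 hB] := fpow_bound.
have [N0 N00 hN0] := dual_bound dphi; have [N1 N10 hN1] := dual_bound dpsi.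
have N01 : 0 <= N0 + N1 by rewrite addr_ge0.
have B'0 : 0 <= B0 * (N0 + N1) by rewrite mulr_ge0// ltW.
exists (B0 * (N0 + N1)) => // n.
have [z zP] := @prim_root_ex R n.+1 isT; have z1 := prim_root_rnorm zP.
pose c j : V n := if (j <= n)%N then (n.+1%:R^-1 : R[i]) *: \sum_(l < n.+1)
  ((z ^- l) ^+ j : R[i]) *: fpow n (fun x => phi x + z ^+ l * psi x) else 0.
have cv j x : val (c j) x = 'C(n, j)%:R * (phi x ^+ (n - j) * psi x ^+ j) :> R[i].
  rewrite /c; case: ifPn => [jn|]; last first.
    by rewrite -ltnNge => nj; rewrite linear0 bin_small// mul0r.
  pose d i : Cn R := 'C(n, i)%:R * (phi x ^+ (n - i) * psi x ^+ i).
  have -> : 'C(n, j)%:R * (phi x ^+ (n - j) * psi x ^+ j) = d j by [].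
  rewrite (root_average d zP) ?ltnS// ht_valZ ht_val_sum; congr (_ * _).
  apply: eq_bigr => l _; rewrite ht_valZ; congr (_ * _).
  rewrite fpow_val; last exact: dualD.
  rewrite exprDn; apply: eq_bigr => i _; rewrite /d exprMn -[_ *: _]/(_ * _ : R[i]).
  by rewrite -mulr_natl; ring.
exists c; split=> //.
- move=> t; apply: (@ht_val_inj _ _ Th); apply/funext => x.
  rewrite fpow_val; last exact: dualD.
  rewrite ht_val_sum exprDn; apply: eq_bigr => i _; rewrite ht_valZ cv exprMn.
  by rewrite -mulr_natl; ring.
- move=> j; rewrite /c; case: ifP => _; last by rewrite rnorm0 exprn_ge0.
  rewrite rnorm_scale cnormV cnorm_nat mulrC ler_pdivrMr ?ltr0n//.
  rewrite (le_trans (rnorm_sumI _ _ _))// mulr_natr.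
  have -> : (B0 * (N0 + N1)) ^+ n *+ n.+1 = \sum_(l < n.+1) (B0 * (N0 + N1)) ^+ n.
    by rewrite sumr_const card_ord.
  apply: ler_sum => l _; rewrite rnorm_scale cnormX cnormV cnormX z1 expr1n invr1 expr1n mul1r.
  apply: (hB _ _ _ (dualD _ dphi dpsi) N01).
  move=> x x1; rewrite (le_trans (cnormD _ _))// lerD ?hN0//.
  by rewrite cnormM cnormX z1 expr1n mul1r hN1.
- by move=> j nj; rewrite /c leqNgt nj.
Qed.

Lemma geo_sum_1D (r : R) n : 0 <= r -> \sum_(j < n.+1) r ^+ j <= (1 + r) ^+ n.
Proof.
move=> r0; elim: n => [|n ih]; first by rewrite big_ord1.
rewrite big_ord_recr/= [leRHS]exprS mulrDl mul1r lerD// exprS ler_wpM2l//.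
by rewrite lerXn2r ?nnegrE ?addr_ge0// lerDr.
Qed.

(** The bound on the coefficients of [(phi + t psi)^n] is geometric in [n], so
    dividing by [n!] leaves room for any power of [1 + r]. *)
Lemma expo_expansion phi psi : dual phi -> dual psi -> exists D : nat -> X,
  expansion (fun t => expo (fun x => phi x + t * psi x)) D /\
  forall j n x, val (tcoef (D j) n) x =
    n`!%:R^-1 * ('C(n, j)%:R * (phi x ^+ (n - j) * psi x ^+ j)) :> R[i].
Proof.
move=> dphi dpsi; have [B B0 hB] := fpow_line dphi dpsi.
pose c n j : V n := sval (cid (hB n)) j.
have cP n : [/\ forall t, fpow n (fun x => phi x + t * psi x) = \sum_(j < n.+1) t ^+ j *: c n j,
    forall j, rnorm (c n j) <= B ^+ n,
    forall j, (n < j)%N -> c n j = 0 &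
    forall j x, val (c n j) x = 'C(n, j)%:R * (phi x ^+ (n - j) * psi x ^+ j) :> R[i]].
  by rewrite /c; case: cid.
have /choice[D hD] : forall j, exists f : X, forall n, tcoef f n = (n`!%:R^-1 : R[i]) *: c n j.
  by move=> j; apply: (exp_of_fact B0) => n; have [_ h _ _] := cP n.
exists D; split; last first.
  by move=> j n x; rewrite hD ht_valZ; have [_ _ _ ->] := cP n.
move=> e r e0 r0; have B1 : 0 <= B * (1 + r) by rewrite mulr_ge0// addr_ge0// ltW.
have [C C0 hC] := weight_fact_le B1 e0; exists C => J t tr n.
have [cE cB c0 _] := cP n.
have q1 : cnorm t / r <= 1 by rewrite ler_pdivrMr// mul1r.
have q0 : 0 <= cnorm t / r by rewrite divr_ge0 ?cnorm_ge0// ltW.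
have dE : tcoef (expo (fun x => phi x + t * psi x) - \sum_(j < J) t ^+ j *: D j) n =
    (n`!%:R^-1 : R[i]) *: (\sum_(j < n.+1) t ^+ j *: c n j - \sum_(j < J) t ^+ j *: c n j).
  rewrite tcoefD tcoefN tcoef_sum tcoef_expo; last exact: dualD.
  rewrite cE scalerBr; congr (_ - _); rewrite scaler_sumr; apply: eq_bigr => j _.
  by rewrite tcoefZ hD !scalerA mulrC.
have tail : rnorm (\sum_(j < n.+1) t ^+ j *: c n j - \sum_(j < J) t ^+ j *: c n j) <=
    (cnorm t / r) ^+ J * (B * (1 + r)) ^+ n.
  have [Jn|nJ] := leqP J n.+1; last first.
    have -> : \sum_(j < J) t ^+ j *: c n j = \sum_(j < n.+1) t ^+ j *: c n j.
      rewrite (big_ord_widen J (fun j => t ^+ j *: c n j) (ltnW nJ)) [RHS]big_mkcond.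
      apply: eq_bigr => j _; case: ifPn => // ; rewrite -leqNgt => nj.
      by rewrite c0// scaler0.
    by rewrite subrr rnorm0 mulr_ge0 ?exprn_ge0.
  rewrite -!(big_mkord xpredT (fun j => t ^+ j *: c n j)) (@big_cat_nat _ _ _ J 0 n.+1)//=.
  rewrite addrAC subrr add0r (le_trans (rnorm_sumI _ _ _))//.
  apply: (@le_trans _ _ (\sum_(J <= j < n.+1) (cnorm t / r) ^+ J * B ^+ n * r ^+ j)).
    rewrite big_nat_cond [leRHS]big_nat_cond; apply: ler_sum => j /andP[/andP[Jj _] _].
    have tE : cnorm t ^+ j = (cnorm t / r) ^+ j * r ^+ j.
      by rewrite -exprMn divfK// gt_eqF.
    rewrite rnorm_scale cnormX tE mulrAC ler_wpM2r ?exprn_ge0 ?(ltW r0)//.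
    by apply: ler_pM; rewrite ?exprn_ge0 ?rnorm_ge0// ler_wiXn2l.
  rewrite -mulr_sumr [(B * _) ^+ n]exprMn mulrA ler_wpM2l ?mulr_ge0 ?exprn_ge0//.
  rewrite (le_trans _ (geo_sum_1D n (ltW r0)))//.
  rewrite -(big_mkord xpredT (fun j => r ^+ j)) (@big_cat_nat _ _ _ J 0 n.+1)//= lerDr.
  by rewrite sumr_ge0// => j _; rewrite exprn_ge0// ltW.
rewrite dE rnorm_scale cnormV cnorm_nat.
have n0 : (0 : R) <= (n`!%:R)^-1 by rewrite invr_ge0.
rewrite (le_trans (ler_wpM2l (exp_weight_ge0 k n) (ler_wpM2l n0 tail)))//.
have := ler_wpM2l (exprn_ge0 J q0) (hC n) => h.
apply: le_trans (le_trans h _); rewrite le_eqVlt; apply/orP; left; apply/eqP; ring.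
Qed.

End exponentials.

(** * Density of exponentials *)

Lemma sub_scale_inv (F : fieldType) (W : lmodType F) (u : F) (x y : W) : u != 0 ->
  x - u^-1 *: y = (- u^-1) *: (y - u *: x).
Proof.
by move=> u0; rewrite scalerBr !scaleNr scalerA mulVf// scale1r opprK addrC.
Qed.

Section density.
Context (R : realType) (E : normedModType R[i]) (Th : holomorphy_type E)
  (k : \bar R).
Hypothesis k1 : (1 < k)%E.

Local Notation w := (exp_weight k).
Local Notation V := (ht_space Th).
Local Notation val := (ht_val Th _).
Local Notation X := (exp_space Th k).
Implicit Types (f g : X) (phi psi : E -> Cn R) (M : set X).

Definition subspace M := M 0 /\ forall (a : R[i]) f g, M f -> M g -> M (a *: f + g).

(** The closure, in terms of the seminorms. *)
Definition adherence M : set X :=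
  [set f | forall e d : R, 0 < e -> 0 < d -> exists2 m, M m & bnd (f - m) e d].

Lemma subspaceZ M a f : subspace M -> M f -> M (a *: f).
Proof. by move=> [M0 MD] Mf; rewrite -[_ *: _]addr0; exact: MD. Qed.

Lemma subspaceB M f g : subspace M -> M f -> M g -> M (f - g).
Proof.
by move=> [_ MD] Mf Mg; rewrite addrC -scaleN1r; apply: MD.
Qed.

Lemma subspace_sum M I (r : seq I) (F : I -> X) : subspace M ->
  (forall i, M (F i)) -> M (\sum_(i <- r) F i).
Proof.
move=> [M0 MD] MF; elim/big_ind: _ => [|f g Mf Mg|i _]; [exact: M0| |exact: MF].
by rewrite -[f]scale1r; exact: MD.
Qed.

Lemma subset_adherence M : M `<=` adherence M.
Proof.
move=> f Mf e d e0 d0; exists f; first exact: Mf.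
by rewrite subrr; apply: bnd0; rewrite ltW.
Qed.

Lemma adherence_subspace M : subspace M -> subspace (adherence M).
Proof.
move=> [M0 MD]; split; first exact: subset_adherence.
move=> a f g Mf Mg e d e0 d0.
have d20 : 0 < d / 2 by rewrite divr_gt0.
have a0 : 0 < cnorm a + 1 by rewrite ltr_wpDl ?cnorm_ge0.
have [m1 Mm1 fm1] := Mf e (d / 2 / (cnorm a + 1)) e0 (divr_gt0 d20 a0).
have [m2 Mm2 gm2] := Mg e (d / 2) e0 d20.
exists (a *: m1 + m2); first exact: MD.
have -> : a *: f + g - (a *: m1 + m2) = a *: (f - m1) + (g - m2).
  by rewrite scalerBr opprD addrACA.
apply: bnd_le (bndD (bndZ a fm1) gm2) _ _; first by rewrite (ltW e0) lexx.
rewrite [leRHS](splitr d) lerD2r mulrCA ler_piMr ?(ltW d20)//.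
by rewrite ler_pdivrMr// mul1r lerDl.
Qed.

Lemma adherence_closed M f :
  (forall e d : R, 0 < e -> 0 < d -> exists2 m, adherence M m & bnd (f - m) e d) ->
  adherence M f.
Proof.
move=> h e d e0 d0; have d20 : 0 < d / 2 by rewrite divr_gt0.
have [m1 Mm1 fm1] := h e (d / 2) e0 d20; have [m2 Mm2 m12] := Mm1 e (d / 2) e0 d20.
exists m2; first exact: Mm2.
have -> : f - m2 = (f - m1) + (m1 - m2) by rewrite addrA subrK.
apply: bnd_le (bndD fm1 m12) _ _; first by rewrite (ltW e0) lexx.
by rewrite -splitr.
Qed.

(** The coefficient of order [j] is the limit at 0 of the series minus its terms
    of lower order, divided by [t^j]; so the coefficients are obtained one after
    the other. *)
Lemma expansion_coef M F D (r : R) : subspace M -> expansion F D -> 0 < r ->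
  (forall t, cnorm t < r -> adherence M (F t)) -> forall j, adherence M (D j).
Proof.
move=> sM FD r0 hF j; have sA := adherence_subspace sM.
have [n] := ubnP j; elim: n j => // n ih j; rewrite ltnS => jn.
apply: adherence_closed => e d e0 d0.
have [C hC] := FD e r e0 r0.
have C0 : 0 <= C.
  have := hC 0%N 0; rewrite cnorm0 => /(_ (ltW r0))/bnd_ge0.
  by rewrite expr0 mulr1.
pose s : R := Num.min (r / 2) (d * r ^+ j.+1 / (C + 1)).
have C1 : 0 < C + 1 by rewrite ltr_wpDl.
have s0 : 0 < s by rewrite lt_min !divr_gt0// mulr_gt0// exprn_gt0.
have sr : s < r.
  by rewrite gt_min ltr_pdivrMr// ltr_pMr// ltr1n.
have cs : cnorm s%:C%C = s by rewrite cnorm_real gtr0_norm.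
have sn0 : (s%:C%C : R[i]) ^+ j != 0 by rewrite expf_neq0// -cnorm_gt0 cs.
exists ((s%:C%C ^+ j)^-1 *: (F s%:C%C - \sum_(i < j) s%:C%C ^+ i *: D i)).
  apply: (subspaceZ _ sA); apply: (subspaceB sA); first by apply: hF; rewrite cs.
  apply: (subspace_sum _ sA) => i; apply: (subspaceZ _ sA); apply: ih.
  exact: leq_trans (ltn_ord i) jn.
have h := hC j.+1 s%:C%C; rewrite cs in h.
have {}h := h (ltW sr); rewrite big_ord_recr/= opprD addrA in h.
set A := F _ - _ in h *; set u := s%:C%C ^+ j in sn0 h *.
have -> : D j - u^-1 *: A = (- u^-1) *: (A - u *: D j).
  exact: sub_scale_inv.
apply: bnd_le (bndZ _ h) _ _; first by rewrite (ltW e0) lexx.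
rewrite cnormN cnormV /u cnormX cs expr_div_n exprS mulrC.
have rj : 0 < r ^+ j.+1 by rewrite exprn_gt0.
have sj : s ^+ j != 0 by rewrite gt_eqF// exprn_gt0.
have -> : C * (s * s ^+ j / r ^+ j.+1) / s ^+ j = C * s / r ^+ j.+1.
  by field; rewrite sj gt_eqF.
rewrite ler_pdivrMr// (@le_trans _ _ ((C + 1) * s))//.
  by rewrite ler_wpM2r ?(ltW s0)// lerDl.
by rewrite mulrC -ler_pdivlMr// ge_min lexx orbT.
Qed.

Lemma expansion_value M F D t : subspace M -> expansion F D ->
  (forall j, adherence M (D j)) -> adherence M (F t).
Proof.
move=> sM FD hD; have sA := adherence_subspace sM.
apply: adherence_closed => e d e0 d0.
have r0 : 0 < 2 * (cnorm t + 1) by rewrite mulr_gt0// ltr_wpDl ?cnorm_ge0.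
have [C hC] := FD e _ e0 r0.
have tr : cnorm t <= 2 * (cnorm t + 1) by have := cnorm_ge0 t; lra.
have C0 : 0 <= C by have := bnd_ge0 (hC 0%N t tr); rewrite expr0 mulr1.
have [J _ hJ] := @half_small R C d 0 d0.
exists (\sum_(j < J) t ^+ j *: D j).
  by apply: (subspace_sum _ sA) => j; apply: (subspaceZ _ sA).
apply: bnd_le (hC J t tr) _ _; first by rewrite (ltW e0) lexx.
rewrite (le_trans _ hJ)// ler_wpM2l// lerXn2r ?nnegrE ?invr_ge0//.
  by rewrite divr_ge0 ?cnorm_ge0// ltW.
by rewrite ler_pdivrMr// mulKf//; have := cnorm_ge0 t; lra.
Qed.

Hypothesis pi1 : pi1_type Th.

(** Powers of functionals span a dense subspace of each [V j], by the second
    axiom of pi1-types, and Taylor series converge in the space. *)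
Lemma powers_dense M : subspace M ->
  (forall j phi, dual phi -> adherence M (mono k (fpow Th j phi))) ->
  forall f, adherence M f.
Proof.
move=> sM hM f; have sA := adherence_subspace sM.
have hmono j (p : V j) : adherence M (mono k p).
  apply: adherence_closed => e d e0 d0; have [_ _ hd] := pi1.
  have dej : 0 < d * e ^+ j / w j.
    by rewrite divr_gt0 ?(weight_gt0 Th k1)// mulr_gt0// exprn_gt0.
  have [||q [pq [n [c [phi [dphi qE]]]]]] := hd j (ball p (d * e ^+ j / w j)%:C%C) _ _.
  - by exists p; apply: ballxx; rewrite ltcR.
  - by apply: ball_open; rewrite ltcR.
  exists (mono k q).
    have -> : mono k q = \sum_(i < n) c i *: mono k (fpow Th j (phi i)).
      apply: exp_fun_inj => x; rewrite mono_val// qE.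
      have -> : (\sum_(i < n) c i *: mono k (fpow Th j (phi i))) x =
          \sum_(i < n) (c i *: mono k (fpow Th j (phi i))) x.
        by apply: (big_morph (fun f : X => f x)).
      apply: eq_bigr => i _; rewrite exp_funZ mono_val// fpow_val//.
    by apply: (subspace_sum _ sA) => i; apply: (subspaceZ _ sA); exact: hM.
  have -> : mono k p - mono k q = mono k (p - q).
    apply: exp_fun_inj => x; rewrite exp_funD exp_funN !mono_val// ht_valB.
    by [].
  apply: (mono_bnd k1) => //.
  move: pq; rewrite -ball_normE /= -rnormE ltcR => /ltW pq.
  by rewrite mulrC -ler_pdivlMr ?(weight_gt0 Th k1).
apply: adherence_closed => e d e0 d0; have e20 : 0 < e / 2 by rewrite divr_gt0.
have [A fA] := bnd_ex f e20; have [n _ hn] := @half_small R A d 0 d0.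
exists (\sum_(m < n) mono k (tcoef f m)); first exact: (subspace_sum _ sA).
by apply: bnd_le (mono_sum_bnd k1 n e0 fA) _ hn; rewrite (ltW e0) lexx.
Qed.

End density.

(** * The mixing criterion *)

Section mixing_criterion.
Context (R : realType) (E : normedModType R[i]) (Th : holomorphy_type E)
  (k : \bar R).
Hypothesis k1 : (1 < k)%E.

Local Notation X := (exp_space Th k).
Implicit Types (f g : X) (phi psi : E -> Cn R) (M : set X).

Definition null_seq (u : nat -> X) := forall e d : R, 0 < e -> 0 < d ->
  exists N, forall n, (N <= n)%N -> bnd (u n) e d.

Lemma null_seqD (a : R[i]) u v : null_seq u -> null_seq v ->
  null_seq (fun n => a *: u n + v n).
Proof.
move=> hu hv e d e0 d0; have d20 : 0 < d / 2 by rewrite divr_gt0.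
have a0 : 0 < cnorm a + 1 by rewrite ltr_wpDl ?cnorm_ge0.
have [N1 hN1] := hu e (d / 2 / (cnorm a + 1)) e0 (divr_gt0 d20 a0).
have [N2 hN2] := hv e (d / 2) e0 d20.
exists (maxn N1 N2) => n; rewrite geq_max => /andP[n1 n2].
apply: bnd_le (bndD (bndZ a (hN1 n n1)) (hN2 n n2)) _ _; first by rewrite (ltW e0) lexx.
rewrite [leRHS](splitr d) lerD2r mulrCA ler_piMr ?(ltW d20)//.
by rewrite ler_pdivrMr// mul1r lerDl.
Qed.

Lemma null_seq0 : null_seq (fun=> 0).
Proof. by move=> e d e0 d0; exists 0%N => n _; apply: bnd0; exact: ltW. Qed.

Lemma null_seq_geo (q : R[i]) f : cnorm q < 1 -> null_seq (fun n => q ^+ n *: f).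
Proof.
move=> q1 e d e0 d0; have [A fA] := bnd_ex f e0.
have : A * cnorm q ^+ n @[n --> \oo] --> A * (0 : R).
  by apply: cvgMr; apply: cvg_expr; rewrite ger0_norm ?cnorm_ge0.
rewrite mulr0 => /cvgrPdist_le/(_ d d0)[N _ hN]; exists N => n Nn.
apply: bnd_le (bndZ (q ^+ n) fA) _ _; first by rewrite (ltW e0) lexx.
rewrite cnormX mulrC (le_trans (ler_norm _))//.
by have := hN n Nn; rewrite sub0r normrN.
Qed.

Variable L : {linear X -> X}.

Lemma iter_linear n a f g : iter n L (a *: f + g) = a *: iter n L f + iter n L g.
Proof. by elim: n => //= n ->; rewrite linearP. Qed.

Lemma iter_eigen n (q : R[i]) f : L f = q *: f -> iter n L f = q ^+ n *: f.
Proof.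
move=> fq; elim: n => [|n ih]; first by rewrite scale1r.
by rewrite iterS ih linearZ/= fq scalerA exprSr.
Qed.

Definition attracted : set X := [set f | null_seq (fun n => iter n L f)].

Definition repelled : set X :=
  [set f | exists2 u, null_seq u & forall n, iter n L (u n) = f].

Lemma attracted_subspace : subspace attracted.
Proof.
split.
  rewrite /attracted /=; have -> : (fun n => iter n L 0) = fun=> 0.
    by apply/funext => n; elim: n => //= n ->; rewrite linear0.
  exact: null_seq0.
move=> a f g hf hg; rewrite /attracted /=.
have -> : (fun n => iter n L (a *: f + g)) = (fun n => a *: iter n L f + iter n L g).
  by apply/funext => n; rewrite iter_linear.
exact: null_seqD.
Qed.

Lemma repelled_subspace : subspace repelled.
Proof.
split.
  exists (fun=> 0); first exact: null_seq0.
  by elim=> //= n ->; rewrite linear0.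
move=> a f g [u hu uf] [v hv vg]; exists (fun n => a *: u n + v n); first exact: null_seqD.
by move=> n; rewrite iter_linear uf vg.
Qed.

Lemma eigen_attracted (q : R[i]) f : L f = q *: f -> cnorm q < 1 -> attracted f.
Proof.
move=> fq q1; rewrite /attracted /=.
have -> : (fun n => iter n L f) = (fun n => q ^+ n *: f).
  by apply/funext => n; exact: iter_eigen.
exact: null_seq_geo.
Qed.

Lemma eigen_repelled (q : R[i]) f : L f = q *: f -> 1 < cnorm q -> repelled f.
Proof.
move=> fq q1; have q0 : q != 0 by rewrite -cnorm_gt0 (lt_trans ltr01).
exists (fun n => q^-1 ^+ n *: f).
  apply: null_seq_geo; rewrite cnormV invf_lt1//; exact: lt_trans q1.
move=> n; rewrite (iter_eigen n (q := q)); last by rewrite linearZ/= fq !scalerA mulrC.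
by rewrite scalerA -exprMn divff// expr1n scale1r.
Qed.

(** Kitai's criterion: [u + w_n], with [u] attracted, [w_n] tending to 0 and
    [L^n w_n = v], goes from near [u] to near [v] in [n] steps. *)
Lemma mixing_criterion : (forall f, adherence attracted f) ->
  (forall f, adherence repelled f) -> mixing (X := X) L.
Proof.
move=> hA hB U W oU oW [f0 Uf0] [g0 Wg0].
have approx M (O : set X) f : (forall f, adherence M f) -> open O -> O f ->
    exists m, [/\ M m, O m & exists e d : R, [/\ 0 < e, 0 < d &
      forall g, bnd (g - m) e d -> O g]].
  move=> hM oO Of; have [e [d [e0 d0 h]]] := open_bnd oO Of.
  have [m Mm fm] := hM f e d e0 d0; have Om : O m.
    by apply: h; rewrite -opprB; exact: bndN.
  by exists m; split=> //; exact: open_bnd oO Om.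
have [u [Au _ [e1 [d1 [e10 d10 hU]]]]] := approx _ _ _ hA oU Uf0.
have [v [[b b0 bv] _ [e2 [d2 [e20 d20 hW]]]]] := approx _ _ _ hB oW Wg0.
have [N1 hN1] := b0 e1 d1 e10 d10; have [N2 hN2] := Au e2 d2 e20 d20.
exists (maxn N1 N2) => n; rewrite geq_max => /andP[n1 n2].
exists (iter n L (u + b n)); split.
  exists (u + b n) => //; apply: hU; rewrite addrAC subrr add0r; exact: hN1.
apply: hW; have := iter_linear n 1 u (b n); rewrite !scale1r => ->.
by rewrite bv addrK; exact: hN2.
Qed.

End mixing_criterion.

(** * Convolution operators are mixing *)

Section convolution_mixing.
Context (R : realType) (E : normedModType R[i]) (Th : holomorphy_type E)
  (k : \bar R).
Hypothesis k1 : (1 < k)%E.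
Hypothesis pi1 : pi1_type Th.

Local Notation V := (ht_space Th).
Local Notation val := (ht_val Th _).
Local Notation X := (exp_space Th k).
Implicit Types (f g : X) (phi psi : E -> Cn R) (M : set X).

Lemma expo_expansion0 psi D : dual psi -> (forall j n x, val (tcoef (D j) n) x =
    n`!%:R^-1 * ('C(n, j)%:R * (0 ^+ (n - j) * psi x ^+ j)) :> R[i]) ->
  forall j, D j = (j`!%:R^-1 : R[i]) *: mono k (fpow Th j psi).
Proof.
move=> dpsi DE j; apply: tcoef_inj => n; rewrite tcoefZ.
apply: (@ht_val_inj _ _ Th); apply/funext => x; rewrite DE ht_valZ.
have [->|nj] := eqVneq n j.
  by rewrite tcoef_mono// fpow_val// binn subnn expr0 !mul1r.
rewrite tcoef_mono_neq// linear0 mulr0.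
have [jn|nj'] := ltnP j n; last first.
  by rewrite bin_small ?mul0r ?mulr0// ltn_neqAle nj nj'.
by rewrite expr0n subn_eq0 leqNgt jn !(mul0r, mulr0).
Qed.

(** The closure of [M] contains the coefficients of [t |-> expo (phi + t (psi - phi))],
    hence its value [expo psi] at [t = 1]; knowing this for all multiples of
    [psi], it contains the coefficients of [t |-> expo (t psi)], which are the
    powers of [psi] up to factorials. *)
Lemma expo_dense M phi : subspace M -> dual phi ->
  (forall psi, dual psi -> exists2 r : R, 0 < r & forall t : R[i], cnorm t < r ->
    M (expo Th k (fun x => phi x + t * psi x))) ->
  forall f, adherence M f.
Proof.
move=> sM dphi hM; have sA := adherence_subspace sM.
have hexp psi : dual psi -> adherence M (expo Th k psi).
  move=> dpsi; have dd := dualD (-1) dpsi dphi.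
  have [r r0 hr] := hM _ dd; have [D [FD _]] := expo_expansion k1 pi1 dphi dd.
  have hD := expansion_coef sM FD r0 (fun t tr => subset_adherence (hr t tr)).
  have := expansion_value 1 sM FD hD.
  suff -> : (fun x => phi x + 1 * (psi x + -1 * phi x)) = psi by [].
  by apply/funext => x; rewrite mul1r mulN1r addrCA subrr addr0.
apply: (powers_dense k1 pi1 sM) => j psi dpsi.
have [D [FD DE]] := expo_expansion k1 pi1 (@dual0 R E) dpsi.
have hD : adherence M (D j).
  apply: (expansion_coef sM FD ltr01) => t _; apply: hexp; exact: dualD (dual0 _) dpsi.
have -> : mono k (fpow Th j psi) = (j`!%:R : R[i]) *: D j.
  by rewrite (expo_expansion0 dpsi DE) scalerA divff ?scale1r// fact_neq0.
exact: (subspaceZ _ sA hD).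
Qed.

Variable T : {linear X -> Cn R}.
Hypothesis cT : continuous T.

(** Otherwise [T] vanishes on all powers of functionals of positive degree, which
    span with the constants a dense subspace, so that [T] is a multiple of the
    evaluation at 0. *)
Lemma apply_expo_nonconstant :
  ~ (exists c : R[i], forall f : X, T f = c * f 0) ->
  exists2 psi, dual psi & exists2 a, entire_series (fun t => T (expo Th k (fun x => 0 + t * psi x))) a &
    exists2 j, (0 < j)%N & a j != 0.
Proof.
move=> nT; apply: contrapT => h; apply: nT.
have bT := apply_bounded cT.
have T0 j psi : dual psi -> (0 < j)%N -> T (mono k (fpow Th j psi)) = 0.
  move=> dpsi j0; have [D [FD DE]] := expo_expansion k1 pi1 (@dual0 R E) dpsi.
  apply: contrapT => Tn; apply: h; exists psi => //.
  exists (fun j => T (D j)); first exact: (expansion_apply bT FD).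
  exists j => //; rewrite (expo_expansion0 dpsi DE) form_scale.
  by apply: mulf_neq0; [rewrite invr_neq0// fact_neq0|exact/eqP].
have [one oneE _] := ht_space0 Th 1.
pose M : set X := [set f | T f = T (mono k one) * f 0].
have sM : subspace M.
  split; first by rewrite /M /= linear0 mulr0.
  move=> a f g Mf Mg.
  suff : T (a *: f + g) = T (mono k one) * (a *: f + g) 0 :> R[i] by [].
  by rewrite linearD form_scale Mf Mg exp_funD exp_funZ mulrDr; congr (_ + _); exact: mulrCA.
(* [M] is closed, as [T] and the evaluation at 0 are bounded. *)
have MA : adherence M `<=` M.
  move=> f Mf; rewrite /M /=; apply/eqP; rewrite -subr_eq0; apply/eqP.
  apply: cnorm_lt_all => r r0.
  have [C1 [e1 [e10 h1]]] := bT; have [C2 [e2 [e20 h2]]] := eval_bounded Th k1 (0 : E).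
  pose e := Num.min e1 e2; have e0 : 0 < e by rewrite lt_min e10.
  pose B := `|C1| + cnorm (T (mono k one)) * `|C2| + 1.
  have B0 : 0 < B by rewrite ltr_wpDl// addr_ge0// mulr_ge0 ?cnorm_ge0.
  pose d := r / 2 / B; have d0 : 0 < d by rewrite !divr_gt0.
  have [m Mm fm] := Mf e d e0 d0.
  have -> : T f - T (mono k one) * f 0 = T (f - m) - T (mono k one) * (f - m) 0 :> R[i].
    rewrite linearB [T m]Mm exp_funD exp_funN mulrBr.
    by rewrite opprB subrKA.
  have b1 : cnorm (T (f - m)) <= `|C1| * d.
    rewrite (le_trans (h1 (f - m) d _))//; last by rewrite ler_wpM2r ?ler_norm ?(ltW d0).
    by apply: bnd_le fm _ _ => //; rewrite (ltW e0) ge_min lexx.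
  have b2 : cnorm ((f - m) 0) <= `|C2| * d.
    rewrite (le_trans (h2 (f - m) d _))//; last by rewrite ler_wpM2r ?ler_norm ?(ltW d0).
    by apply: bnd_le fm _ _ => //; rewrite (ltW e0) ge_min lexx orbT.
  rewrite (le_lt_trans (cnormD _ _))// cnormN cnormM.
  apply: (@le_lt_trans _ _ (B * d)).
    have := ler_wpM2l (cnorm_ge0 (T (mono k one))) b2; rewrite /B; move: (ltW d0) b1; nra.
  by rewrite /d mulrC divfK ?gt_eqF// ltr_pdivrMr// ltr_pMr// ltr1n.
exists (T (mono k one)) => f; apply: MA; apply: (powers_dense k1 pi1 sM) => j phi dphi.
apply: subset_adherence; rewrite /M /= mono_val//.
case: j => [|j]; last first.
  rewrite T0// fpow_val// (_ : phi 0 = 0) ?expr0n ?mulr0//.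
  by have := dphi.1 (-1) 0 0; rewrite scaler0 addr0 scaleN1r addNr.
have -> : fpow Th 0 phi = one.
  by apply: (@ht_val_inj _ _ Th); rewrite fpow_val// oneE.
by rewrite oneE mulr1.
Qed.

(** The expansion of [t |-> expo (phi + t psi)] at order 1. *)
Lemma apply_expo_near phi psi (r : R) : dual phi -> dual psi -> 0 < r ->
  exists2 s : R, 0 < s & forall t : R[i], cnorm t < s ->
    cnorm (T (expo Th k (fun x => phi x + t * psi x)) - T (expo Th k phi)) < r.
Proof.
move=> dphi dpsi r0; have [D [FD _]] := expo_expansion k1 pi1 dphi dpsi.
have [C hC] := expansion_apply (apply_bounded cT) FD ltr01.
have D0 : D 0%N = expo Th k phi.
  rewrite -(expansion0 k1 FD); congr (expo Th k _).
  by apply/funext => x; rewrite mul0r addr0.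
have C1 : 0 < `|C| + 1 by rewrite ltr_wpDl.
exists (Num.min 1 (r / (`|C| + 1))); first by rewrite lt_min ltr01 divr_gt0.
move=> t; rewrite lt_min => /andP[t1 tr].
have := hC 1%N t (ltW t1); rewrite big_ord1 expr0 mul1r D0 divr1 expr1 => h.
rewrite (le_lt_trans h)// (@le_lt_trans _ _ ((`|C| + 1) * cnorm t))//.
  by rewrite ler_wpM2r ?cnorm_ge0// (le_trans (ler_norm C))// lerDl.
by rewrite mulrC -ltr_pdivlMr.
Qed.


(** Liouville's theorem makes [t |-> T (expo (t psi))] take values both inside
    and outside the unit disc, hence the eigenvectors [expo phi] that the
    convolution operator contracts, resp. expands, span dense subspaces. *)
Lemma convolution_mixing (L : {linear X -> X}) :
  ~ (exists c : R[i], forall f : X, T f = c * f 0) ->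
  (forall f x, L f x = T (shift x f)) -> mixing (X := X) L.
Proof.
move=> nT LE; have [psi dpsi [a ga [j j0 aj]]] := apply_expo_nonconstant nT.
have eigen phi : dual phi -> L (expo Th k phi) = (T (expo Th k phi) : R[i]) *: expo Th k phi.
  move=> dphi; apply: exp_fun_inj => x; rewrite LE (shift_expo k1 pi1)// form_scale exp_funZ.
  exact: mulrC.
have dl t : dual (fun x => 0 + t * psi x) by exact: dualD (dual0 _) dpsi.
have [t1 ht1] : exists t, cnorm (T (expo Th k (fun x => 0 + t * psi x))) < 1.
  apply: contrapT => h; move/eqP: aj; apply; apply: (liouville_away0 ga) j0 => t.
  by rewrite leNgt; apply/negP => ht; apply: h; exists t.
have [t2 ht2] : exists t, 1 < cnorm (T (expo Th k (fun x => 0 + t * psi x))).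
  apply: contrapT => h; move/eqP: aj; apply; apply: (liouville_bounded ga) j0 => t.
  by rewrite leNgt; apply/negP => ht; apply: h; exists t.
apply: mixing_criterion => f.
- apply: (expo_dense (attracted_subspace L) (dl t1)) => chi dchi.
  have r0 : 0 < 1 - cnorm (T (expo Th k (fun x => 0 + t1 * psi x))) by rewrite subr_gt0.
  have [s s0 hs] := apply_expo_near (dl t1) dchi r0; exists s => // t ts.
  have dt := dualD t (dl t1) dchi; apply: (eigen_attracted (eigen _ dt)).
  have := hs t ts; set A := T _; set B := T _ => hAB.
  have := cnormD (A - B) B; rewrite subrK; lra.
- apply: (expo_dense (repelled_subspace L) (dl t2)) => chi dchi.
  have r0 : 0 < cnorm (T (expo Th k (fun x => 0 + t2 * psi x))) - 1 by rewrite subr_gt0.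
  have [s s0 hs] := apply_expo_near (dl t2) dchi r0; exists s => // t ts.
  have dt := dualD t (dl t2) dchi; apply: (eigen_repelled (eigen _ dt)).
  have := hs t ts; set A := T _; set B := T _; rewrite cnormB => hAB.
  have := cnormD (B - A) A; rewrite subrK; lra.
Qed.

End convolution_mixing.

Theorem theorem4p6 (R : realType) (E : completeNormedModType R[i])
    (k : \bar R) (Th : holomorphy_type E)
    (T : {linear exp_space Th k -> Cn R}) :
  (1 < k)%E ->
  dual_separable E ->
  pi1_type Th ->
  pi2_type Th k ->
  continuous T ->
  ~ (exists c : R[i], forall f : exp_space Th k, T f = c * f 0) ->
  exists L : exp_space Th k -> exp_space Th k,
    [/\ is_convolution_by T L,
        convolution_operator L,
        ~ (exists c : R[i], forall f : exp_space Th k, L f = c *: f) &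
        mixing L].
Proof.
move=> k1 _ pi1 pi2 cT nT.
have [C [M [rho [C0 M0 r0 hL]]]] := convolution_ex k1 cT pi2.
have /choice[L0 L0P] := hL.
have L0E (f : exp_space Th k) x : L0 f x = T (shift x f) by have [h _] := L0P f.
have linL : linear L0.
  move=> a f g; apply: exp_fun_inj => x.
  by rewrite L0E (shift_linear k1) linearP exp_funD [in RHS]exp_funZ !L0E.
pose L : {linear exp_space Th k -> exp_space Th k} := HB.pack L0 (GRing.isLinear.Build _ _ _ _ L0 linL).
have cL : continuous L.
  apply: bounded_continuous => e' e'0.
  pose e := Num.min (e' / M) (rho / 2 / M).
  have e0 : 0 < e by rewrite lt_min !divr_gt0.
  have Me : M * e <= e' by rewrite mulrC -ler_pdivlMr// ge_min lexx.
  have Mr : M * e / rho <= 2^-1.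
    rewrite ler_pdivrMr// mulrC -ler_pdivlMr// ge_min.
    by rewrite [2^-1 * _]mulrC lexx orbT.
  exists (2 * C), e; split; rewrite ?mulr_gt0// => f A fA.
  have [_ h] := L0P f; apply: bnd_le (h e A (ltW e0) fA Mr) _ (lexx _).
  by rewrite Me mulr_ge0// ltW.
exists L; split.
- move=> f x; exists (shift x f); first exact: shiftE.
  exact: L0E.
- split; [exact: linL|exact: cL|].
  move=> a f; exists (dir_deriv 1 a f).
    by apply/funext => x; rewrite (dhat_dir_deriv k1) (_ : 1`! = 1)%N ?mul1r.
  apply/funext => x; have [Q fQ] := exp_entire (L0 f) x.
  rewrite (dhatE _ fQ) [RHS]L0E -(shift_dir_deriv k1).
  (* Both sides are the linear coefficient of [t |-> T (shift (x + t a) f)]. *)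
  have h : entire_series (fun t => L0 f (x + t *: a)) (fun l => T (dir_deriv l a (shift x f))).
    have := expansion_apply (apply_bounded cT) (shift_expansion k1 a (shift x f)).
    suff -> : (fun t => T (shift (t *: a) (shift x f))) = (fun t => L0 f (x + t *: a)) by [].
    by apply/funext => t; rewrite (shift_shift k1) L0E addrC.
  rewrite -(is_taylor_series fQ h 1); exact: mul1r.
- move=> [c hc]; apply: nT; exists c => f.
  by have := congr1 (fun g : exp_space Th k => g 0) (hc f); rewrite L0E (shift0 k1).
- exact: (convolution_mixing k1 pi1 cT).
Qed.
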